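(* Suppose that $\vec{\mathscr I}=(\mathscr I_1,\mathscr I_2,\ldots,\mathscr I_{N-1})$ is the row-vector function defined by $$\mathscr I_1:=I_N(a_1,qa_2,\ldots,qa_{N-1},a_N,\ldots,a_{2N}),$$ $$\mathscr I_i:=I_N(a_1,qa_2,\ldots,qa_{i-1},a_i,qa_{i+1},\ldots,qa_{N-1},a_N,\ldots,a_{2N}),\qquad 2\le i\le N-1.$$ Then $\vec{\mathscr I}$ satisfies the $q$-difference system $$T_{a_1}\vec{\mathscr I}=\vec{\mathscr I}\,A,$$ where $A$ is the $(N-1)\times(N-1)$ matrix defined by its Gauss decomposition $$A=\begin{pmatrix} c_1& a_1a_2^{-1}&a_1a_3^{-1}&\cdots&a_1a_{N-1}^{-1}\\ &d_2&&&\\ &&d_3&&\\ &&&\ddots&\\ &&&&d_{N-1}\end{pmatrix}\begin{pmatrix}1&&&&\\ c_2&1&&&\\ c_3&&1&&\\ \vdots&&&\ddots&\\ c_{N-1}&&&&1\end{pmatrix}.$$ Here entries not shown are zero, while $$c_i=\frac{\prod_{m=N}^{2N}(1-a_ia_m)}{(1-a_1a_2\cdots a_{2N})\prod_{1\le j\le N-1,\ j\ne i}(1-a_ia_j^{-1})}\quad(1\le i\le N-1)$$ and $$d_i=(1-a_1a_i)(1-a_1a_i^{-1})\quad(2\le i\le N-1).$$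
   Context: Let $N\ge 2$ be an integer and $|q|<1$. $T_a$ is the $q$-shift operator with respect to $a\mapsto qa$, i.e. $T_af(a)=f(qa)$ for a function $f(a)$ (applied entrywise to vectors). Notation: $(a;q)_\infty=\prod_{k\ge0}(1-aq^k)$, $(az^{\pm1};q)_\infty=(az;q)_\infty(az^{-1};q)_\infty$, $(z^{\pm N};q^{N/2})_\infty=(z^{N};q^{N/2})_\infty(z^{-N};q^{N/2})_\infty$. The parameters of $I_N$ are $a_j=q^{s_j}$ with $|a_j|<1$. Put $$\Phi(z)=\frac{z-z^{-1}}{z^{N/2}-z^{-N/2}}\,\frac{(z^{\pm N};q^{N/2})_\infty}{\prod_{j=1}^{2N}(a_jz^{\pm1};q)_\infty},\qquad I_N=I_N(a_1,\ldots,a_{2N})=\int_C\frac{dz}{2\pi\sqrt{-1}\,z}\,\Phi(z).$$ For $N$ even, $C$ is the unit circle $\mathbb T$ traversed anticlockwise. For $N$ odd, the integrand has a branch cut, conventionally taken to be $(-\infty,0)$, and $C=\mathbb T\cup\mathbb H$ is a contour of Hankel type with a tail $\mathbb H$, starting at $\infty e^{-\pi i}$ and finishing at $\infty e^{+\pi i}$; the tail contributes an integral over $[1,\infty)$, which (using an asymptotic expansion of the integrand valid for $|\arg(a_j)|\le\pi$) converges under the additional condition $\sum_{j=1}^{2N}\mathrm{Re}(s_j)<N-1$.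
   Formalization: For N odd the integral in the first entry of T_{a_1}I never converges when all |a_j|<1; there I_N means its analytic continuation, q is taken in (0,1), no a_j lies on the cut (-∞,0), and a_1...a_{2N} ≠ q^n (n≥1). Also a_i ≠ a_j for 1≤i<j≤N-1, so that A is defined. *)

(* Defs.v *)
Set Warnings "-notation-overridden,-ambiguous-paths,-notation-incompatible-prefix".
From mathcomp Require Export all_boot all_order all_algebra.
From mathcomp Require Export complex.
From mathcomp Require Export all_classical all_reals all_analysis.

Set Implicit Arguments.
Unset Strict Implicit.
Unset Printing Implicit Defensive.

Export Order.TTheory GRing.Theory Num.Theory numFieldNormedType.Exports.
Local Open Scope classical_set_scope.
Local Open Scope ring_scope.
Local Open Scope complex_scope.

(* R[i] itself carries no topology in the library; R[i]^o does, and it is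
   ascribed wherever a limit or a complex derivative is taken.

   The parameters (a_1, ..., a_2N) are a function a : nat -> R[i] of which only
   the values at 1 <= j <= 2N matter, so that indices are those of the formulas
   on paper. *)

(* (x; q)_oo *)
Definition qpoch (R : realType) (x q : R[i]) : R[i] :=
  lim ((fun n : nat => \prod_(k < n) (1 - x * q ^+ k) : R[i]^o) @ \oo).

Definition qpoch_pm (R : realType) (x z q : R[i]) : R[i] :=
  qpoch (x * z) q * qpoch (x * z^-1) q.

(* The power q^(N/2). For N even it does not depend on the square root; for N
   odd it is used with q > 0 only, and sqrtC is then the positive root. *)
Definition qhalf (R : realType) (N : nat) (q : R[i]) : R[i] := sqrtC q ^+ N.

(* The integrand at z = u ^ 2. Writing it in terms of a square root u of z fixes
   the branch: z^(N/2) is u ^ N. At the finitely many points of the unit circle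
   where z^N = 1 the formula reads 0 / 0; they form a null set. *)
Definition Phi (R : realType) (N : nat) (q : R[i]) (a : nat -> R[i])
    (u : R[i]) : R[i] :=
  let z := u ^+ 2 in
  (z - z^-1) / (u ^+ N - u ^- N) *
  (qpoch_pm 1 (z ^+ N) (qhalf N q) /
   \prod_(1 <= j < (2 * N).+1) qpoch_pm (a j) z q).

Definition cintegral (R : realType) (D : set R) (f : R -> R[i]) : R[i] :=
  (\int[lebesgue_measure]_(x in D) complex.Re (f x)) +i*
  (\int[lebesgue_measure]_(x in D) complex.Im (f x)).

(* Integral of Phi dz / (2 pi i z) over the unit circle z = e^(i t), t from -pi
   to pi, with z^(1/2) = e^(i t / 2): the principal branch, cut (-oo, 0). *)
Definition circle_integral (R : realType) (N : nat) (q : R[i])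
    (a : nat -> R[i]) : R[i] :=
  (2 * pi)^-1%:C *
  cintegral `[- pi, pi] (fun t => Phi N q a (cos (t / 2) +i* sin (t / 2))).

(* Integral of Phi dz / (2 pi i z) from oo e^(- pi i) to -1 below the cut, and
   from -1 to oo e^(pi i) above it. With z = r e^(- pi i) and z = r e^(pi i),
   z^(1/2) is -i r^(1/2) and i r^(1/2) respectively, and dz / z = dr / r. *)
Definition tail_integral (R : realType) (N : nat) (q : R[i])
    (a : nat -> R[i]) : R[i] :=
  (0 +i* (2 * pi))^-1 *
  cintegral `[1, +oo[ (fun r =>
    (Phi N q a (0 +i* Num.sqrt r) - Phi N q a (0 +i* - Num.sqrt r)) *
    (r^-1)%:C).

Definition contour_integral (R : realType) (N : nat) (q : R[i])
    (a : nat -> R[i]) : R[i] :=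
  if odd N then circle_integral N q a + tail_integral N q a
  else circle_integral N q a.

(* x ^ s for a real base x > 0 *)
Definition cpow (R : realType) (x : R) (s : R[i]) : R[i] :=
  (x `^ complex.Re s)%:C *
  (cos (complex.Im s * ln x) +i* sin (complex.Im s * ln x)).

(* The condition under which the contour integral converges. For N odd, q is a
   positive real number, i.e. q = Re q. *)
Definition contour_converges (R : realType) (N : nat) (q : R[i])
    (a : nat -> R[i]) : Prop :=
  odd N -> exists s : nat -> R[i],
    (forall j, (1 <= j <= 2 * N)%N -> a j = cpow (complex.Re q) (s j)) /\
    \sum_(1 <= j < (2 * N).+1) complex.Re (s j) < (N.-1)%:R.

(* Parameters at which I_N is considered. When N is odd, a parameter on
   (-oo, 0) would put poles of Phi on the tail of the contour, and the
   continuation of I_N beyond the region of convergence has its poles where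
   a_1 ... a_2N = q^(N-1+n) with n >= 0. (`a j <= 0` in R[i] means that a j is
   real and nonpositive.) *)
Definition IN_domain (R : realType) (N : nat) (q : R[i])
    (a : nat -> R[i]) : Prop :=
  (forall j, (1 <= j <= 2 * N)%N ->
     [/\ a j != 0, `|a j| < 1 & odd N -> ~~ (a j <= 0)]) /\
  (odd N -> forall n : nat,
     \prod_(1 <= j < (2 * N).+1) a j != q ^+ (N.-1 + n)).

Definition set_param (R : realType) (a : nat -> R[i]) (j : nat) (t : R[i]) :
    nat -> R[i] :=
  fun k => if k == j then t else a k.

(* I is the function I_N: it is the contour integral wherever that converges
   and, for N odd, its analytic continuation elsewhere. For N even the contour
   integral always converges. For N odd the continuation cannot be avoided: the
   shifted tuple (q a_1, ..., q a_(N-1), a_N, ..., a_2N) violates the convergence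
   condition as soon as all |a_j| < 1. In the variables log a_j the domain is a
   convex set minus complex hyperplanes, hence it is connected and the
   continuation is unique; holomorphy in each variable separately is enough for
   this (Hartogs). *)
Definition is_IN (R : realType) (N : nat) (q : R[i])
    (I : (nat -> R[i]) -> R[i]) : Prop :=
  (forall a, IN_domain N q a -> contour_converges N q a ->
     I a = contour_integral N q a) /\
  (odd N -> forall a j, IN_domain N q a -> (1 <= j <= 2 * N)%N ->
     derivable (fun t : R[i]^o => I (set_param a j t) : R[i]^o) (a j) 1).

Definition qshift (R : realType) (q : R[i]) (S : pred nat) (a : nat -> R[i]) :
    nat -> R[i] :=
  fun j => if S j then q * a j else a j.

Definition Tq (R : realType) (V : Type) (q : R[i]) (j : nat)
    (f : (nat -> R[i]) -> V) : (nat -> R[i]) -> V :=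
  fun a => f (qshift q (pred1 j) a).

(* Column i : 'I_(N.-1) carries the index i.+1. For i.+1 = 1 the condition
   k != i.+1 is void, which yields the first component. *)
Definition vecI (R : realType) (N : nat) (q : R[i])
    (I : (nat -> R[i]) -> R[i]) (a : nat -> R[i]) : 'rV[R[i]]_(N.-1) :=
  \row_(i < N.-1) I (qshift q (fun k => (2 <= k < N)%N && (k != i.+1)) a).

Definition c_coef (R : realType) (N : nat) (a : nat -> R[i]) (i : nat) : R[i] :=
  \prod_(N <= m < (2 * N).+1) (1 - a i * a m) /
  ((1 - \prod_(1 <= j < (2 * N).+1) a j) *
   \prod_(1 <= j < N | j != i) (1 - a i * (a j)^-1)).

Definition d_coef (R : realType) (a : nat -> R[i]) (i : nat) : R[i] :=
  (1 - a 1%N * a i) * (1 - a 1%N * (a i)^-1).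

Definition A_upper (R : realType) (N : nat) (a : nat -> R[i]) :
    'M[R[i]]_(N.-1) :=
  \matrix_(i < N.-1, j < N.-1)
    if i == 0%N :> nat then
      if j == 0%N :> nat then c_coef N a 1 else a 1%N * (a j.+1)^-1
    else if i == j then d_coef a i.+1 else 0.

Definition A_lower (R : realType) (N : nat) (a : nat -> R[i]) :
    'M[R[i]]_(N.-1) :=
  \matrix_(i < N.-1, j < N.-1)
    if i == j then 1
    else if j == 0%N :> nat then c_coef N a i.+1 else 0.

Definition A_mx (R : realType) (N : nat) (a : nat -> R[i]) :
    'M[R[i]]_(N.-1) :=
  A_upper N a *m A_lower N a.

(* Main.v *)
Require Import Defs.
From mathcomp Require Import ring lra zify measurable_realfun.

(** Write z = u ^ 2 and let psi_a be the integrand without its factor z - 1/z.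
    Replacing a_i by q a_i multiplies psi_a by (1 - a_i z) (1 - a_i / z), so all
    the integrals in the system are integrals of psi_a (z - 1/z) times Laurent
    polynomials in z.

    For i >= 2 the i-th column of the system holds pointwise: it comes from
      (1 - a_1 z) (1 - a_1 / z) = (a_1 / a_i) (1 - a_i z) (1 - a_i / z) + d_i
    ([column_other_far]).

    The first column comes from shifting the contour. The function
    psi_a(z) prod_j (1 - a_j / z) has no pole between the contour and its image
    under z -> q z, and its value at q z is q^(-N) z^(-2N) psi_a(z)
    prod_j (1 - a_j z) ([Hf_shift]); by Cauchy's theorem both have the same
    integral, also after multiplication by a power of z ([cfun_shift],
    [contour_shift]). Let b be a with a_1, ..., a_(N-1) replaced by their
    q-multiples. The power z^1 with the tuple b turns (1 - a_1 ... a_2N) I(b)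
    into the integral of psi_b g for an explicit Laurent polynomial g that stays
    bounded at infinity ([contour_step1]). The power z^N with the tuple a,
    corrected by the previous relation so that the leading terms at infinity
    cancel, turns this integral into a combination of the I(b^(i)), where b^(i)
    is b with a_i left alone ([contour_step2]). The coefficients c_i come from
    the partial fraction identity [laurent_identity], an identity between
    polynomials of degree 2N which is checked at 2N + 1 points.

    For N even this is the whole proof. For N odd the contour has a tail. There
    the shift relation is a recurrence which shows that |psi_a| decays like
    |z|^(-k) with q^k = q^N / |a_1 ... a_2N| ([Psi_decay]). Hence everything
    above makes sense if |a_1 ... a_2N| > q, with one exception: the contour
    integral for b diverges, so that I(b) is a value of the continuation. But
    the integral of psi_b g converges and is holomorphic in b_1
    ([cfun_param_derivable]), and it agrees with (1 - a_1 ... a_2N) I(b) where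
    |b_1| is close to 1; so it gives the continuation ([IN_step1]). Finally, the
    two sides of each column are holomorphic in each a_j, so they agree
    everywhere once they agree for |a_1 ... a_2N| > q ([continuation]): the
    variables of small modulus are moved out one at a time along rays
    ([ray_identity]).

    The complex analysis is built from Goursat's bisection argument: Cauchy's
    formula, the identity theorem along a segment, and the holomorphy of limits
    and of integrals with a parameter. The last two rest on a Lipschitz estimate
    for difference quotients ([dquot_lip]), which passes to limits and integrals
    and gives back differentiability. *)

Set Implicit Arguments.
Unset Strict Implicit.
Unset Printing Implicit Defensive.

Local Open Scope classical_set_scope.
Local Open Scope ring_scope.
Local Open Scope complex_scope.


(** * Modulus, limits and derivatives over the complex numbers *)

Notation normc := ComplexField.Normc.normc.
Arguments ComplexField.Normc.normc : simpl never.

Section ComplexBasics.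
Variable R : realType.
Implicit Types (x y z : R[i]).

Lemma normc_ge0 x : 0 <= normc x.
Proof. by case: x => a b; rewrite /= sqrtr_ge0. Qed.

Lemma normcE x : `|x| = (normc x)%:C.
Proof. by []. Qed.

Lemma normc_eq0 x : (normc x == 0) = (x == 0).
Proof. by rewrite -[RHS]normr_eq0 normcE (inj_eq (@complexI _)). Qed.

Lemma normc_gt0 x : (0 < normc x) = (x != 0).
Proof. by rewrite lt_neqAle normc_ge0 andbT eq_sym normc_eq0. Qed.

Lemma normcM x y : normc (x * y) = normc x * normc y.
Proof. exact: ComplexField.Normc.normcM. Qed.

Lemma normcV x : normc x^-1 = (normc x)^-1.
Proof. exact: ComplexField.Normc.normcV. Qed.

Lemma normcX x n : normc (x ^+ n) = normc x ^+ n.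
Proof. by apply: (@complexI R); rewrite rmorphXn -!normcE normrX. Qed.

Lemma normcN x : normc (- x) = normc x.
Proof. by apply: (@complexI R); rewrite -!normcE normrN. Qed.

Lemma normcB x y : normc (x - y) = normc (y - x).
Proof. by rewrite -normcN opprB. Qed.

Lemma normc_real (r : R) : normc r%:C = `|r|.
Proof. by rewrite /normc /= expr0n addr0 sqrtr_sqr. Qed.

Lemma normc1 : normc (1 : R[i]) = 1.
Proof. exact: ComplexField.Normc.normc1. Qed.

Lemma normc0 : normc (0 : R[i]) = 0.
Proof. exact: ComplexField.Normc.normc0. Qed.

Lemma normcD x y : normc (x + y) <= normc x + normc y.
Proof. by rewrite -lecR rmorphD -!normcE ler_normD. Qed.

Lemma normcBD x y : normc (x - y) <= normc x + normc y.
Proof. by rewrite -(normcN y) normcD. Qed.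

Lemma ler_dist_normc x y : `|normc x - normc y| <= normc (x - y).
Proof.
rewrite ler_norml lerBrDr addrC lerBlDr; apply/andP; split.
  by rewrite normcB addrC -{1}(subrK x y) normcD.
by rewrite lerBlDr -{1}(subrK y x) normcD.
Qed.

Lemma normc_lt x (r : R) : (`|x| < r%:C) = (normc x < r).
Proof. by rewrite normcE ltcR. Qed.

Lemma normc_prod I (s : seq I) (P : pred I) (f : I -> R[i]) :
  normc (\prod_(i <- s | P i) f i) = \prod_(i <- s | P i) normc (f i).
Proof. by elim/big_rec2: _ => [|i y1 y2 _ <-]; rewrite ?normc1 ?normcM. Qed.

Lemma Re_le_normc x : `|complex.Re x| <= normc x.
Proof. by case: x => a b; rewrite /normc /= -sqrtr_sqr ler_wsqrtr // lerDl sqr_ge0. Qed.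

Lemma Im_le_normc x : `|complex.Im x| <= normc x.
Proof. by case: x => a b; rewrite /normc /= -sqrtr_sqr ler_wsqrtr // lerDr sqr_ge0. Qed.

Lemma normc_le_ReIm x : normc x <= `|complex.Re x| + `|complex.Im x|.
Proof.
case: x => a b; rewrite /normc /= -[leRHS]ger0_norm ?addr_ge0// -sqrtr_sqr.
rewrite ler_wsqrtr// sqrrD !real_normK ?num_real// addrAC lerDl.
by rewrite mulrn_wge0// mulr_ge0.
Qed.

Lemma gtc0_real (e : R[i]) : 0 < e -> exists2 r : R, 0 < r & e = r%:C.
Proof.
case: e => a b; rewrite ltcE /= => /andP[/eqP ->] a0.
by exists a.
Qed.

End ComplexBasics.

Section Topology.
Variable R : realType.
Local Notation C := (R[i]^o).

Lemma cvgCP {T : Type} {F : set_system T} {FF : Filter F} (f : T -> C) (l : C) :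
  f x @[x --> F] --> l <->
  (forall e : R, 0 < e -> \forall x \near F, normc (l - f x) < e).
Proof.
split => [/cvgrPdist_lt h e e0|h].
  have /h : (0 : R[i]) < e%:C by rewrite ltcR.
  by apply: filterS => x; rewrite normc_lt.
apply/cvgrPdist_lt => e /gtc0_real[r r0 ->].
by apply: filterS (h r r0) => x; rewrite normc_lt.
Qed.

Lemma nbhsCP (x : C) (A : set C) :
  nbhs x A <-> exists2 d : R, 0 < d & forall y, normc (y - x) < d -> A y.
Proof.
split.
  move=> /nbhs_ballP[e /= /gtc0_real[r r0 ->]] h; exists r => // y xy.
  by apply: h; rewrite -ball_normE /= distrC normc_lt.
move=> [d d0 h]; apply/nbhs_ballP; exists d%:C => /=; first by rewrite ltcR.
by move=> y; rewrite -ball_normE /= distrC normc_lt; exact: h.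
Qed.

Lemma cvg_Re {T : Type} {F : set_system T} {FF : Filter F} (f : T -> C) (l : C) :
  f x @[x --> F] --> l -> complex.Re (f x) @[x --> F] --> complex.Re l.
Proof.
move=> /cvgCP h; apply/cvgrPdist_lt => e e0.
apply: filterS (h e e0) => x; apply: le_lt_trans.
by rewrite -raddfB; apply: Re_le_normc.
Qed.

Lemma cvg_Im {T : Type} {F : set_system T} {FF : Filter F} (f : T -> C) (l : C) :
  f x @[x --> F] --> l -> complex.Im (f x) @[x --> F] --> complex.Im l.
Proof.
move=> /cvgCP h; apply/cvgrPdist_lt => e e0.
apply: filterS (h e e0) => x; apply: le_lt_trans.
by rewrite -raddfB; apply: Im_le_normc.
Qed.

Lemma cvg_Complex {T : Type} {F : set_system T} {FF : Filter F} (f g : T -> R)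
    (a b : R) : f x @[x --> F] --> a -> g x @[x --> F] --> b ->
  (f x +i* g x : C) @[x --> F] --> (a +i* b : C).
Proof.
move=> /cvgrPdist_lt fa /cvgrPdist_lt gb; apply/cvgCP => e e0.
have e2 : 0 < e / 2 by rewrite divr_gt0.
near=> x; apply: le_lt_trans (normc_le_ReIm _) _ => /=.
rewrite (splitr e) ltrD//; near: x; [exact: fa|exact: gb].
Unshelve. all: by end_near. Qed.

Lemma cvg_normc {T : Type} {F : set_system T} {FF : Filter F} (f : T -> C) (l : C) :
  f x @[x --> F] --> l -> normc (f x) @[x --> F] --> normc l.
Proof.
move=> /cvgCP h; apply/cvgrPdist_lt => e e0.
apply: filterS (h e e0) => x; apply: le_lt_trans.
exact: ler_dist_normc.
Qed.

(** The epsilon-delta form lets estimates be made with the real-valued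
    modulus rather than with the norm of R[i]^o, whose values are complex. *)
Lemma derivCP (f : C -> C) (z : C) : derivable f z 1 <->
  exists B : C, forall e : R, 0 < e -> exists2 d : R, 0 < d & forall h : C,
    normc h < d -> normc (f (z + h) - f z - B * h) <= e * normc h.
Proof.
split.
  move=> /cvg_ex[/= B /cvgCP h]; exists B => e e0.
  have /nbhsCP[d d0 hd] := h _ e0; exists d => // k kd.
  have [->|k0] := eqVneq k 0; first by rewrite addr0 subrr mulr0 subrr normc0 mulr0.
  move: (hd k); rewrite subr0 => /(_ kd k0).
  rewrite /= -normc_gt0 in k0 *; rewrite -(ltr_pM2r k0) -normcM => /ltW.
  rewrite normcB mulrBl /GRing.scale /= mulr1 [k + z]addrC.
  by rewrite mulrAC mulVf ?mul1r// -normc_gt0.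
move=> [B h]; apply/cvg_ex; exists B; apply/cvgCP => e e0.
have [d d0 hd] := h (e / 2) ltac:(by rewrite divr_gt0).
apply/nbhsCP; exists d => // k; rewrite subr0 => kd k0.
have k0' : 0 < normc k by rewrite normc_gt0.
rewrite /= -(ltr_pM2r k0') -normcM mulrBl normcB /GRing.scale /= mulr1 [k + z]addrC.
rewrite mulrAC mulVf ?mul1r//; apply: le_lt_trans (hd _ kd) _.
by rewrite ltr_pM2r// ltr_pdivrMr// ltr_pMr// ltr1n.
Qed.

Lemma derivC_cont (f : C -> C) (z : C) : derivable f z 1 -> {for z, continuous f}.
Proof. by move/derivable1_diffP; exact: differentiable_continuous. Qed.

Lemma derivC_comp (f g : C -> C) (z : C) :
  derivable f z 1 -> derivable g (f z) 1 -> derivable (fun x => g (f x)) z 1.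
Proof.
move=> /derivable1_diffP df /derivable1_diffP dg; apply/derivable1_diffP.
exact: (differentiable_comp df dg).
Qed.

End Topology.

(** * Integrals of complex functions of a real variable *)

Section ComplexIntegral.
Variable R : realType.
Local Notation C := (R[i]^o).
Local Notation mu := (@lebesgue_measure R).
Implicit Types (D E : set (measurableTypeR R)) (f g : R -> R[i]).

Definition cintg D f :=
  mu.-integrable D (EFin \o (fun x => complex.Re (f x))) /\
  mu.-integrable D (EFin \o (fun x => complex.Im (f x))).

Lemma eq_cintg D f g : measurable D -> {in D, f =1 g} -> cintg D f -> cintg D g.
Proof.
move=> mD fg [h1 h2]; split.
  by apply: eq_integrable h1 => // x xD /=; rewrite fg.
by apply: eq_integrable h2 => // x xD /=; rewrite fg.
Qed.

Lemma eq_cintegral D f g : {in D, f =1 g} -> cintegral D f = cintegral D g.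
Proof.
by move=> fg; congr (_ +i* _); apply: eq_Rintegral => x xD; rewrite fg.
Qed.

Lemma cintgD D f g : measurable D -> cintg D f -> cintg D g ->
  cintg D (fun x => f x + g x).
Proof.
move=> mD [f1 f2] [g1 g2]; split.
  apply: eq_integrable (integrableD mD f1 g1) => // x _ /=.
  by rewrite raddfD.
apply: eq_integrable (integrableD mD f2 g2) => // x _ /=.
by rewrite raddfD.
Qed.

Lemma cintegralD D f g : measurable D -> cintg D f -> cintg D g ->
  cintegral D (fun x => f x + g x) = cintegral D f + cintegral D g.
Proof.
move=> mD [f1 f2] [g1 g2]; rewrite /cintegral.
under eq_Rintegral do rewrite raddfD.
rewrite RintegralD//; under [X in _ +i* X]eq_Rintegral do rewrite raddfD.
by rewrite RintegralD.
Qed.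

Lemma ReD (x y : R[i]) : complex.Re (x + y) = complex.Re x + complex.Re y.
Proof. by case: x y => [a b] [c d]. Qed.

Lemma ImD (x y : R[i]) : complex.Im (x + y) = complex.Im x + complex.Im y.
Proof. by case: x y => [a b] [c d]. Qed.

Lemma ReM (x y : R[i]) : complex.Re (x * y) =
  complex.Re x * complex.Re y - complex.Im x * complex.Im y.
Proof. by case: x y => [a b] [c d]. Qed.

Lemma ImM (x y : R[i]) : complex.Im (x * y) =
  complex.Re x * complex.Im y + complex.Im x * complex.Re y.
Proof. by case: x y => [a b] [c d]. Qed.

Lemma cintgZ D f (c : R[i]) : measurable D -> cintg D f ->
  cintg D (fun x => c * f x).
Proof.
move=> mD [f1 f2]; split.
  apply: eq_integrable (integrableB mD (integrableZl mD (complex.Re c) f1)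
    (integrableZl mD (complex.Im c) f2)) => // x _ /=.
  by rewrite ReM.
apply: eq_integrable (integrableD mD (integrableZl mD (complex.Re c) f2)
    (integrableZl mD (complex.Im c) f1)) => // x _ /=.
by rewrite ImM.
Qed.

Lemma cintegralZ D f (c : R[i]) : measurable D -> cintg D f ->
  cintegral D (fun x => c * f x) = c * cintegral D f.
Proof.
move=> mD [f1 f2]; rewrite /cintegral.
under eq_Rintegral do rewrite ReM.
under [X in _ +i* X]eq_Rintegral do rewrite ImM.
have i1 r := integrableZl mD r f1; have i2 r := integrableZl mD r f2.
rewrite RintegralB//; [|exact: i1|exact: i2].
rewrite RintegralD//; [|exact: i2|exact: i1].
by rewrite !RintegralZl//; case: c.
Qed.

Lemma cintgB D f g : measurable D -> cintg D f -> cintg D g ->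
  cintg D (fun x => f x - g x).
Proof.
move=> mD hf hg; apply: (@eq_cintg _ (fun x => f x + (-1) * g x) _ mD).
  by move=> x _; rewrite mulN1r.
exact: (cintgD mD hf (cintgZ _ mD hg)).
Qed.

Lemma cintegralB D f g : measurable D -> cintg D f -> cintg D g ->
  cintegral D (fun x => f x - g x) = cintegral D f - cintegral D g.
Proof.
move=> mD hf hg; rewrite -mulN1r -cintegralZ// -cintegralD//; last exact: cintgZ.
by apply: eq_cintegral => x _; rewrite mulN1r.
Qed.

(** The factor 2 comes from bounding the real and the imaginary part
    separately; only the order of magnitude is used below. *)
Lemma cintegral_le D f (w : R -> R) : measurable D -> cintg D f ->
  mu.-integrable D (EFin \o w) -> (forall x, D x -> normc (f x) <= w x) ->
  normc (cintegral D f) <= 2 * \int[mu]_(x in D) w x.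
Proof.
move=> mD [f1 f2] iw h; apply: le_trans (normc_le_ReIm _) _; rewrite mulr_natl mulr2n /=.
apply: lerD.
  apply: le_trans (le_normr_Rintegral mD f1) _; apply: le_Rintegral => //.
    exact: integrable_norm.
  by move=> x /h; apply: le_trans; exact: Re_le_normc.
apply: le_trans (le_normr_Rintegral mD f2) _; apply: le_Rintegral => //.
  exact: integrable_norm.
by move=> x /h; apply: le_trans; exact: Im_le_normc.
Qed.

Lemma Rintegral_seg_cst (a b M : R) : a <= b ->
  \int[mu]_(x in `[a, b]) M = M * (b - a).
Proof.
move=> ab; rewrite Rintegral_cst//; congr (_ * _).
by rewrite /= lebesgue_measure_itv /= lte_fin; case: ltP => //= ba; lra.
Qed.

Lemma seg_integrable_cst (a b M : R) : mu.-integrable `[a, b] (EFin \o (fun=> M)).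
Proof.
apply: continuous_compact_integrable; first exact: segment_compact.
by apply: continuous_subspaceT => x; exact: cvg_cst.
Qed.

Lemma cintegral_seg_le (a b M : R) f : a <= b -> cintg `[a, b] f ->
  (forall x, a <= x <= b -> normc (f x) <= M) ->
  normc (cintegral `[a, b] f) <= 2 * M * (b - a).
Proof.
move=> ab hf h; rewrite -mulrA -Rintegral_seg_cst//.
by apply: cintegral_le => //; exact: seg_integrable_cst.
Qed.

Lemma cont_cintg (a b : R) f :
  (forall x, a <= x <= b -> {for x, continuous (f : R -> C)}) -> cintg `[a, b] f.
Proof.
move=> h; split; apply: continuous_compact_integrable; try exact: segment_compact.
  apply: continuous_in_subspaceT => x; rewrite inE /= in_itv /= => /h hx.
  exact: (cvg_Re hx).
apply: continuous_in_subspaceT => x; rewrite inE /= in_itv /= => /h hx.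
exact: (cvg_Im hx).
Qed.

Lemma cintegral_split (a b c : R) f : a <= b <= c -> cintg `[a, c] f ->
  cintegral `[a, c] f = cintegral `[a, b] f + cintegral `[b, c] f.
Proof.
move=> /andP[ab bc] [h1 h2].
have key (h : R -> R) : mu.-integrable `[a, c] (EFin \o h) ->
    \int[mu]_(x in `[a, c]) h x =
    \int[mu]_(x in `[a, b]) h x + \int[mu]_(x in `[b, c]) h x.
  move=> hi; have := @Rintegral_itvB R h (BLeft a) (BRight c) b hi.
  rewrite !bnd_simp => /(_ ab bc) e.
  rewrite Rintegral_itv_obnd_cbnd in e; first by rewrite -e addrC subrK.
  apply: integrableS hi => //; apply: subset_itvr; rewrite bnd_simp.
  exact: ab.
by rewrite /cintegral !key.
Qed.

(** Derivative of a complex function of a real variable. *)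
Definition cder1 (F : R -> R[i]) (x : R) (d : R[i]) :=
  is_derive x 1 (fun t => complex.Re (F t)) (complex.Re d) /\
  is_derive x 1 (fun t => complex.Im (F t)) (complex.Im d).

Lemma cFTC (a b : R) (F f : R -> R[i]) : a <= b ->
  (forall x, a <= x <= b -> cder1 F x (f x)) ->
  (forall x, a <= x <= b -> {for x, continuous (f : R -> C)}) ->
  cintegral `[a, b] f = F b - F a.
Proof.
rewrite le_eqVlt => /predU1P[->|ab] hF hf.
  by rewrite subrr /cintegral set_itv1 !Rintegral_set1.
have key (G g : R -> R) : (forall x, a <= x <= b -> is_derive x 1 G (g x)) ->
    (forall x, a <= x <= b -> {for x, continuous g}) ->
    \int[mu]_(x in `[a, b]) g x = G b - G a.
  move=> hG hg; rewrite /Rintegral (@continuous_FTC2 _ g G)//.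
  - apply: continuous_in_subspaceT => x; rewrite inE /= in_itv /=; exact: hg.
  - have dG x : a <= x <= b -> derivable G x 1 by move/hG => [].
    split; first by move=> x; rewrite in_itv /= => /andP[? ?]; apply: dG; lra.
      apply: cvg_at_right_filter; apply: differentiable_continuous.
      by apply/derivable1_diffP; apply: dG; lra.
    apply: cvg_at_left_filter; apply: differentiable_continuous.
    by apply/derivable1_diffP; apply: dG; lra.
  - move=> x; rewrite in_itv /= => /andP[? ?]; rewrite derive1E.
    by have [] := hG x ltac:(lra).
have e1 := key (fun t => complex.Re (F t)) (fun t => complex.Re (f t))
  (fun x hx => (hF x hx).1) (fun x hx => cvg_Re (hf x hx)).
have e2 := key (fun t => complex.Im (F t)) (fun t => complex.Im (f t))
  (fun x hx => (hF x hx).2) (fun x hx => cvg_Im (hf x hx)).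
by rewrite /cintegral e1 e2; case: (F b) (F a) => [? ?] [? ?].
Qed.

Lemma cder1_eq F x d e : cder1 F x d -> d = e -> cder1 F x e.
Proof. by move=> h <-. Qed.

Lemma cder1_cst (c : R[i]) x : cder1 (fun=> c) x 0.
Proof. by split; exact: is_derive_cst. Qed.

Lemma cder1D F G x d e : cder1 F x d -> cder1 G x e ->
  cder1 (fun t => F t + G t) x (d + e).
Proof.
move=> [F1 F2] [G1 G2]; split; rewrite raddfD.
  rewrite (_ : (fun t => _) = (fun t => complex.Re (F t)) + (fun t => complex.Re (G t))).
    exact: is_deriveD.
  by apply/funext => t; rewrite raddfD.
rewrite (_ : (fun t => _) = (fun t => complex.Im (F t)) + (fun t => complex.Im (G t))).
  exact: is_deriveD.
by apply/funext => t; rewrite raddfD.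
Qed.

Lemma cder1M F G x d e : cder1 F x d -> cder1 G x e ->
  cder1 (fun t => F t * G t) x (d * G x + F x * e).
Proof.
move=> [F1 F2] [G1 G2]; split.
  rewrite (_ : (fun t => _) = (fun t => complex.Re (F t)) * (fun t => complex.Re (G t)) -
     (fun t => complex.Im (F t)) * (fun t => complex.Im (G t))); last first.
    by apply/funext => t; rewrite ReM.
  apply: is_derive_eq (is_deriveB (is_deriveM F1 G1) (is_deriveM F2 G2)) _.
  by rewrite ReD !ReM /GRing.scale /=; ring.
rewrite (_ : (fun t => _) = (fun t => complex.Re (F t)) * (fun t => complex.Im (G t)) +
     (fun t => complex.Im (F t)) * (fun t => complex.Re (G t))); last first.
  by apply/funext => t; rewrite ImM.
apply: is_derive_eq (is_deriveD (is_deriveM F1 G2) (is_deriveM F2 G1)) _.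
by rewrite ImD !ImM /GRing.scale /=; ring.
Qed.

Lemma derivR_cont (h : R -> R) x : derivable h x 1 -> {for x, continuous h}.
Proof. by move/derivable1_diffP; exact: differentiable_continuous. Qed.

Lemma cder1_cont F x d : cder1 F x d -> {for x, continuous (F : R -> C)}.
Proof.
move=> [[h1 _] [h2 _]].
have c1 : {for x, continuous (fun t => complex.Re (F t))}.
  exact: derivR_cont h1.
have c2 : {for x, continuous (fun t => complex.Im (F t))}.
  exact: derivR_cont h2.
have := cvg_Complex c1 c2.
rewrite (_ : (fun _ => _) = F); last by apply/funext => t; case: (F t).
move=> /(_ _); rewrite (_ : complex.Re (F x) +i* complex.Im (F x) = F x).
  exact.
by case: (F x).
Qed.

End ComplexIntegral.

(** * Goursat's theorem for a parametrised rectangle *)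

Section Continuity.
Variable R : realType.
Local Notation C := (R[i]^o).

Lemma contC_cst (T : topologicalType) (c : C) (x : T) :
  {for x, continuous (fun=> c : C)}.
Proof. exact: (@cst_continuous T C c x). Qed.

Lemma contC_id (x : C) : {for x, continuous (fun w : C => w)}.
Proof. by move=> A; exact. Qed.

Lemma contCM (T : topologicalType) (f g : T -> C) x :
  {for x, continuous f} -> {for x, continuous g} ->
  {for x, continuous (fun t => f t * g t : C)}.
Proof. by move=> hf hg; exact: (cvgM hf hg). Qed.

Lemma contCD (T : topologicalType) (f g : T -> C) x :
  {for x, continuous f} -> {for x, continuous g} ->
  {for x, continuous (fun t => f t + g t : C)}.
Proof. by move=> hf hg; exact: (cvgD hf hg). Qed.

Lemma contCB (T : topologicalType) (f g : T -> C) x :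
  {for x, continuous f} -> {for x, continuous g} ->
  {for x, continuous (fun t => f t - g t : C)}.
Proof. by move=> hf hg; exact: (cvgB hf hg). Qed.

Lemma contCV (T : topologicalType) (f : T -> C) x : f x != 0 ->
  {for x, continuous f} -> {for x, continuous (fun t => (f t)^-1 : C)}.
Proof. by move=> f0 hf; exact: (cvgV f0 hf). Qed.

Lemma contC_comp (T : topologicalType) (h : C -> C) (f : T -> C) x :
  {for x, continuous f} -> {for f x, continuous h} ->
  {for x, continuous (fun t => h (f t) : C)}.
Proof. by move=> hf hh; exact: continuous_comp hf hh. Qed.

End Continuity.

Lemma quarter_arith (R : realFieldType) (j a b c d : R) :
  4 * a < j -> 4 * b < j -> 4 * c < j -> 4 * d < j -> j <= a + b + c + d -> False.
Proof. by lra. Qed.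

Section Goursat.
Variable R : realType.
Local Notation C := (R[i]^o).
Variables (z zs zt : R -> R -> R[i]) (s0 s1 t0 t1 L : R).
Hypothesis hzs : forall s t, s0 <= s <= s1 -> t0 <= t <= t1 ->
  cder1 (fun s => z s t) s (zs s t).
Hypothesis hzt : forall s t, s0 <= s <= s1 -> t0 <= t <= t1 ->
  cder1 (fun t => z s t) t (zt s t).
Hypothesis czs : forall s t, s0 <= s <= s1 -> t0 <= t <= t1 ->
  {for s, continuous (fun s => zs s t : C)}.
Hypothesis czt : forall s t, s0 <= s <= s1 -> t0 <= t <= t1 ->
  {for t, continuous (fun t => zt s t : C)}.
Hypothesis bzs : forall s t, s0 <= s <= s1 -> t0 <= t <= t1 -> normc (zs s t) <= L.
Hypothesis bzt : forall s t, s0 <= s <= s1 -> t0 <= t <= t1 -> normc (zt s t) <= L.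

Let es (f : C -> C) t a b := cintegral `[a, b] (fun s => f (z s t) * zs s t).
Let et (f : C -> C) s c d := cintegral `[c, d] (fun t => f (z s t) * zt s t).

Let bnd (f : C -> C) a b c d :=
  et f b c d - et f a c d - (es f d a b - es f c a b).

Let on_rect (P : R[i] -> Prop) :=
  forall s t, s0 <= s <= s1 -> t0 <= t <= t1 -> P (z s t).

Let cf (f : C -> C) := on_rect (fun w => {for (w : C), continuous f}).

Lemma es_cont f s t : cf f -> s0 <= s <= s1 -> t0 <= t <= t1 ->
  {for s, continuous (fun s => f (z s t) * zs s t : C)}.
Proof.
move=> hf hs ht; apply: contCM; last exact: czs.
apply: (@contC_comp _ _ f (fun s => z s t)); last exact: hf.
exact: (cder1_cont (hzs hs ht)).
Qed.

Lemma et_cont f s t : cf f -> s0 <= s <= s1 -> t0 <= t <= t1 ->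
  {for t, continuous (fun t => f (z s t) * zt s t : C)}.
Proof.
move=> hf hs ht; apply: contCM; last exact: czt.
apply: (@contC_comp _ _ f (fun t => z s t)); last exact: hf.
exact: (cder1_cont (hzt hs ht)).
Qed.

Lemma es_int f t a b : cf f -> s0 <= a -> b <= s1 -> t0 <= t <= t1 ->
  cintg `[a, b] (fun s => f (z s t) * zs s t).
Proof. by move=> hf ha hb ht; apply: cont_cintg => s hs; apply: es_cont => //; lra. Qed.

Lemma et_int f s c d : cf f -> t0 <= c -> d <= t1 -> s0 <= s <= s1 ->
  cintg `[c, d] (fun t => f (z s t) * zt s t).
Proof. by move=> hf ha hb ht; apply: cont_cintg => t hs; apply: et_cont => //; lra. Qed.

Lemma bnd_splits f a m b c d : cf f -> s0 <= a -> a <= m <= b -> b <= s1 ->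
  t0 <= c <= t1 -> t0 <= d <= t1 -> bnd f a b c d = bnd f a m c d + bnd f m b c d.
Proof.
move=> hf ha hm hb hc hd; rewrite /bnd /es (@cintegral_split _ a m b _ hm); last first.
  exact: es_int.
rewrite (@cintegral_split _ a m b _ hm); last exact: es_int.
ring.
Qed.

Lemma bnd_splitt f a b c m d : cf f -> t0 <= c -> c <= m <= d -> d <= t1 ->
  s0 <= a <= s1 -> s0 <= b <= s1 -> bnd f a b c d = bnd f a b c m + bnd f a b m d.
Proof.
move=> hf ha hm hb hc hd; rewrite /bnd /et (@cintegral_split _ c m d _ hm); last first.
  exact: et_int.
rewrite (@cintegral_split _ c m d _ hm); last exact: et_int.
ring.
Qed.

Lemma bnd_affine (A B : R[i]) a b c d : s0 <= a -> a <= b -> b <= s1 ->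
  t0 <= c -> c <= d -> d <= t1 -> bnd (fun w => A + B * w) a b c d = 0.
Proof.
move=> ha ab hb hc cd hd.
have caff : cf (fun w => A + B * w).
  move=> s t _ _; apply: (@contCD _ C (fun=> A) (fun w => B * w)).
    exact: contC_cst.
  by apply: (@contCM _ C (fun=> B) (fun w => w)); [exact: contC_cst|exact: contC_id].
pose P w := A * w + (B / 2) * (w * w).
have hP (F : R -> R[i]) x e : cder1 F x e ->
    cder1 (fun x => P (F x)) x ((A + B * F x) * e).
  move=> hF; apply: cder1_eq.
    exact: (cder1D (cder1M (cder1_cst A x) hF)
      (cder1M (cder1_cst (B / 2) x) (cder1M hF hF))).
  have two : (2 : R[i]) != 0 by rewrite pnatr_eq0.
  by field.
have het s : a <= s <= b ->
    et (fun w => A + B * w) s c d = P (z s d) - P (z s c).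
  move=> hs; apply: (@cFTC _ c d (fun t => P (z s t))) => // t ht.
    by apply: hP; apply: hzt; lra.
  by apply: (et_cont caff); lra.
have hes t : c <= t <= d ->
    es (fun w => A + B * w) t a b = P (z b t) - P (z a t).
  move=> ht; apply: (@cFTC _ a b (fun s => P (z s t))) => // s hs.
    by apply: hP; apply: hzs; lra.
  by apply: (es_cont caff); lra.
by rewrite /bnd !het ?hes; [ring|lra..].
Qed.

Lemma speed_ge0 : s0 <= s1 -> t0 <= t1 -> 0 <= L.
Proof.
move=> hs ht; apply: le_trans (normc_ge0 _) (@bzs s0 t0 _ _); lra.
Qed.

Lemma lip_s s s' t : s0 <= s -> s <= s' -> s' <= s1 -> t0 <= t <= t1 ->
  normc (z s' t - z s t) <= 2 * L * (s' - s).
Proof.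
move=> hs ss hs' ht.
rewrite -(@cFTC _ s s' (fun s => z s t) (fun s => zs s t))//; first last.
- by move=> x hx; apply: czs => //; lra.
- by move=> x hx; apply: hzs => //; lra.
apply: cintegral_seg_le => // [|x hx]; last by apply: bzs => //; lra.
by apply: cont_cintg => x hx; apply: czs => //; lra.
Qed.

Lemma lip_t s t t' : t0 <= t -> t <= t' -> t' <= t1 -> s0 <= s <= s1 ->
  normc (z s t' - z s t) <= 2 * L * (t' - t).
Proof.
move=> hs ss hs' ht.
rewrite -(@cFTC _ t t' (fun t => z s t) (fun t => zt s t))//; first last.
- by move=> x hx; apply: czt => //; lra.
- by move=> x hx; apply: hzt => //; lra.
apply: cintegral_seg_le => // [|x hx]; last by apply: bzt => //; lra.
by apply: cont_cintg => x hx; apply: czt => //; lra.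
Qed.

Lemma lip a b c d s t s' t' : s0 <= a -> b <= s1 -> t0 <= c -> d <= t1 ->
  a <= s <= b -> a <= s' <= b -> c <= t <= d -> c <= t' <= d ->
  normc (z s t - z s' t') <= 2 * L * ((b - a) + (d - c)).
Proof.
move=> ha hb hc hd hs hs' ht ht'.
have l0 : 0 <= L by apply: speed_ge0; lra.
have h1 : normc (z s t - z s' t) <= 2 * L * (b - a).
  case: (leP s' s) => ss.
    apply: le_trans (lip_s _ ss _ _) _; try lra.
    by apply: ler_wpM2l; lra.
  rewrite normcB; apply: le_trans (lip_s _ (ltW ss) _ _) _; try lra.
  by apply: ler_wpM2l; lra.
have h2 : normc (z s' t - z s' t') <= 2 * L * (d - c).
  case: (leP t' t) => ss.
    apply: le_trans (lip_t _ ss _ _) _; try lra.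
    by apply: ler_wpM2l; lra.
  rewrite normcB; apply: le_trans (lip_t _ (ltW ss) _ _) _; try lra.
  by apply: ler_wpM2l; lra.
rewrite mulrDr; apply: le_trans (lerD h1 h2).
by apply: le_trans (normcD _ _); rewrite addrA subrK.
Qed.

Variable g : C -> C.
Hypothesis hg : on_rect (fun w => derivable g w 1).

Lemma cg : cf g.
Proof. by move=> s t hs ht; apply: derivC_cont; apply: hg. Qed.

(** The affine part of g at the point contributes nothing, and the rest is o
    of the distance, over a boundary of length proportional to the size. *)
Lemma local_est ps pt (e : R) : 0 < e -> s0 <= ps <= s1 -> t0 <= pt <= t1 ->
  exists2 dl : R, 0 < dl & forall a b c d, s0 <= a -> b <= s1 -> t0 <= c -> d <= t1 ->
    a <= ps <= b -> c <= pt <= d -> (b - a) + (d - c) < dl ->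
    normc (bnd g a b c d) <= e * ((b - a) + (d - c)) ^+ 2.
Proof.
move=> e0 hps hpt.
have l0 : 0 <= L by apply: speed_ge0; lra.
have l2 : 0 < 8 * L ^+ 2 + 1 by rewrite ltr_wpDl// mulr_ge0// sqr_ge0.
have [B hB] := (derivCP _ _).1 (hg hps hpt).
have [dl dl0 hd] := hB (e / (8 * L ^+ 2 + 1)) ltac:(by rewrite divr_gt0).
exists (dl / (2 * L + 1)); first by rewrite divr_gt0//; lra.
move=> a b c d ha hb hc hd' hps' hpt' hsm.
set Z := z ps pt; set e' := e / _ in hd.
have e'0 : 0 <= e' by rewrite divr_ge0// ltW.
pose A := g Z - B * Z.
pose rho (w : C) : C := g w - (A + B * w).
have caff : cf (fun w => A + B * w).
  move=> s t _ _; apply: (@contCD _ C (fun=> A) (fun w => B * w)).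
    exact: contC_cst.
  by apply: (@contCM _ C (fun=> B) (fun w => w)); [exact: contC_cst|exact: contC_id].
have crho : cf rho by move=> s t hs ht; apply: contCB; [exact: cg|exact: caff].
set sg := (b - a) + (d - c) in hsm *.
have sg0 : 0 <= sg by rewrite /sg; lra.
have brho s t : a <= s <= b -> c <= t <= d -> normc (rho (z s t)) <= e' * (2 * L * sg).
  move=> hs ht.
  have hz : normc (z s t - Z) <= 2 * L * sg by apply: lip => //.
  have := hd (z s t - Z); rewrite (_ : Z + (z s t - Z) = z s t); last by ring.
  have -> : g (z s t) - g Z - B * (z s t - Z) = rho (z s t) by rewrite /rho /A; ring.
  move=> /(_ _) h; apply: le_trans (h _) _.
    apply: le_lt_trans hz _; move: hsm; rewrite ltr_pdivlMr; last lra.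
    move=> hsm'; apply: le_lt_trans hsm'.
    by move: (sg) sg0 => x x0; lra.
  by apply: ler_wpM2l.
have Ms s t : a <= s <= b -> c <= t <= d ->
    normc (rho (z s t) * zs s t) <= e' * (2 * L * sg) * L.
  move=> hs ht; rewrite normcM; apply: ler_pM; rewrite ?normc_ge0//; first exact: brho.
  by apply: bzs; lra.
have Mt s t : a <= s <= b -> c <= t <= d ->
    normc (rho (z s t) * zt s t) <= e' * (2 * L * sg) * L.
  move=> hs ht; rewrite normcM; apply: ler_pM; rewrite ?normc_ge0//; first exact: brho.
  by apply: bzt; lra.
have -> : bnd g a b c d = bnd rho a b c d.
  have aff0 : bnd (fun w => A + B * w) a b c d = 0 by apply: bnd_affine; lra.
  rewrite -[RHS]addr0 -aff0.
  have hes t : c <= t <= d ->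
      es g t a b = es rho t a b + es (fun w => A + B * w) t a b.
    move=> ht; rewrite /es -cintegralD//; [|by apply: (es_int crho); lra|by apply: (es_int caff); lra].
    by apply: eq_cintegral => x _; rewrite /rho; ring.
  have het s : a <= s <= b ->
      et g s c d = et rho s c d + et (fun w => A + B * w) s c d.
    move=> ht; rewrite /et -cintegralD//; [|by apply: (et_int crho); lra|by apply: (et_int caff); lra].
    by apply: eq_cintegral => x _; rewrite /rho; ring.
  by rewrite /bnd !hes ?het; [ring|lra..].
have bes t : c <= t <= d -> normc (es rho t a b) <= 2 * (e' * (2 * L * sg) * L) * (b - a).
  move=> ht; apply: cintegral_seg_le; first lra.
    by apply: (es_int crho); lra.
  by move=> x hx; apply: Ms.
have bet s : a <= s <= b -> normc (et rho s c d) <= 2 * (e' * (2 * L * sg) * L) * (d - c).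
  move=> ht; apply: cintegral_seg_le; first lra.
    by apply: (et_int crho); lra.
  by move=> x hx; apply: Mt.
apply: le_trans (_ : 8 * L ^+ 2 * e' * sg ^+ 2 <= _).
  rewrite /bnd; apply: le_trans (normcBD _ _) _.
  apply: le_trans (lerD (normcBD _ _) (normcBD _ _)) _.
  apply: le_trans (lerD (lerD (bet _ _) (bet _ _)) (lerD (bes _ _) (bes _ _))) _; try lra.
  by rewrite le_eqVlt; apply/orP; left; apply/eqP; rewrite /sg; ring.
apply: ler_wpM2r; first exact: sqr_ge0.
rewrite /e' mulrC mulrAC -mulrA ger_pMr// ler_pdivrMr//; lra.
Qed.

Let ws n := (s1 - s0) / 2 ^+ n.
Let wt n := (t1 - t0) / 2 ^+ n.
Let Jn n (p : R * R) := normc (bnd g p.1 (p.1 + ws n) p.2 (p.2 + wt n)).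
Let quarter n (p : R * R) : R * R :=
  let q1 := p in let q2 := (p.1 + ws n.+1, p.2) in
  let q3 := (p.1, p.2 + wt n.+1) in let q4 := (p.1 + ws n.+1, p.2 + wt n.+1) in
  if Jn n p <= 4 * Jn n.+1 q1 then q1 else if Jn n p <= 4 * Jn n.+1 q2 then q2 else
  if Jn n p <= 4 * Jn n.+1 q3 then q3 else q4.
Fixpoint corner_ n : R * R := if n is m.+1 then quarter m (corner_ m) else (s0, t0).

Hypothesis hs01 : s0 <= s1.
Hypothesis ht01 : t0 <= t1.

Lemma ws_ge0 n : 0 <= ws n. Proof. by rewrite divr_ge0// ?subr_ge0// exprn_ge0. Qed.
Lemma wt_ge0 n : 0 <= wt n. Proof. by rewrite divr_ge0// ?subr_ge0// exprn_ge0. Qed.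
Lemma wsS n : ws n = 2 * ws n.+1.
Proof. by rewrite /ws exprS invfM mulrA [RHS]mulrC; field; rewrite expf_neq0. Qed.
Lemma wtS n : wt n = 2 * wt n.+1.
Proof. by rewrite /wt exprS invfM mulrA [RHS]mulrC; field; rewrite expf_neq0. Qed.

Lemma quarter_in n p : s0 <= p.1 -> p.1 + ws n <= s1 -> t0 <= p.2 -> p.2 + wt n <= t1 ->
  [/\ p.1 <= (quarter n p).1, (quarter n p).1 + ws n.+1 <= p.1 + ws n,
      p.2 <= (quarter n p).2, (quarter n p).2 + wt n.+1 <= p.2 + wt n &
      Jn n p <= 4 * Jn n.+1 (quarter n p)].
Proof.
move=> h1 h2 h3 h4.
have := wsS n; have := wtS n; have := ws_ge0 n.+1; have := wt_ge0 n.+1 => w1 w2 w3 w4.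
rewrite /quarter; case: ifPn => [h|/negP n1]; first by split => //= {h}; lra.
case: ifPn => [h|/negP n2]; first by split => //= {h n1}; lra.
case: ifPn => [h|/negP n3]; first by split => //= {h n1 n2}; lra.
split => /=; [by move=> {n1 n2 n3}; lra..|].
rewrite leNgt; apply/negP => n4.
move: n1 n2 n3 => /negP; rewrite -ltNge => n1 /negP; rewrite -ltNge => n2 /negP.
rewrite -ltNge => n3.
apply: (quarter_arith n1 n2 n3 n4) => {n1 n2 n3 n4}.
rewrite {1}/Jn (@bnd_splits _ _ (p.1 + ws n.+1) _ _ _ cg); [|lra..].
rewrite (@bnd_splitt _ p.1 _ _ (p.2 + wt n.+1) _ cg); [|lra..].
rewrite (@bnd_splitt _ (p.1 + ws n.+1) _ _ (p.2 + wt n.+1) _ cg); [|lra..].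
apply: le_trans (normcD _ _) _.
apply: le_trans (lerD (normcD _ _) (normcD _ _)) _; rewrite /Jn /=.
have -> : p.1 + ws n = p.1 + ws n.+1 + ws n.+1 by rewrite wsS mulr_natl mulr2n addrA.
have -> : p.2 + wt n = p.2 + wt n.+1 + wt n.+1 by rewrite wtS mulr_natl mulr2n addrA.
by rewrite -!addrA lerD2l [leLHS]addrCA.
Qed.

Lemma corner_in n : [/\ s0 <= (corner_ n).1, (corner_ n).1 + ws n <= s1,
  t0 <= (corner_ n).2, (corner_ n).2 + wt n <= t1 &
  Jn 0 (s0, t0) <= 4 ^+ n * Jn n (corner_ n)].
Proof.
elim: n => [|n [h1 h2 h3 h4 h5]] /=.
  by rewrite expr0 mul1r /ws /wt expr0 !divr1; split => //; lra.
have [k1 k2 k3 k4 k5] := quarter_in h1 h2 h3 h4.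
split; [by move=> {h5 k5}; lra..|].
by apply: le_trans h5 _; rewrite exprSr -mulrA ler_wpM2l// exprn_ge0.
Qed.

Lemma corner_nested n m : [/\ (corner_ n).1 <= (corner_ (n + m)%N).1,
  (corner_ (n + m)%N).1 + ws (n + m)%N <= (corner_ n).1 + ws n,
  (corner_ n).2 <= (corner_ (n + m)%N).2 &
  (corner_ (n + m)%N).2 + wt (n + m)%N <= (corner_ n).2 + wt n].
Proof.
elim: m => [|m [h1 h2 h3 h4]]; first by rewrite addn0.
have [k1 k2 k3 k4 _] := corner_in (n + m)%N.
have [l1 l2 l3 l4 _] := quarter_in k1 k2 k3 k4.
by rewrite addnS /=; split; [lra|lra|lra|lra].
Qed.

(** The left ends increase and are bounded, so their supremum will do. *)
Lemma nested (u w : nat -> R) : (forall n, 0 <= w n) ->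
  (forall n m, u n <= u (n + m)%N /\ u (n + m)%N + w (n + m)%N <= u n + w n) ->
  exists p, forall n, u n <= p <= u n + w n.
Proof.
move=> w0 h; have hsup : has_sup (range u).
  split; first by exists (u 0%N); exists 0%N.
  exists (u 0%N + w 0%N) => _ [n _ <-]; have [_] := h 0%N n; rewrite add0n.
  by have := w0 n; lra.
exists (sup (range u)) => n; apply/andP; split.
  by apply: ub_le_sup; [exact: hsup.2|exists n].
apply: ge_sup; first exact: hsup.1.
move=> _ [m _ <-]; case: (leqP n m) => nm.
  have [_] := h n (m - n)%N; rewrite subnKC//; have := w0 m; lra.
have [+ _] := h m (n - m)%N; rewrite subnKC ?(ltnW nm)//; have := w0 n; lra.
Qed.

(** The difference of the integrals of g over opposite sides of the image of
    a rectangle. Bisection keeps at least a quarter of the defect at each step, in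
    rectangles that shrink to a point; near that point g is affine up to o(size), and
    affine functions have no defect. A parametrised rectangle covers discs,
    annuli and sectors at once. *)
Lemma goursat :
  cintegral `[t0, t1] (fun t => g (z s1 t) * zt s1 t) -
  cintegral `[t0, t1] (fun t => g (z s0 t) * zt s0 t) =
  cintegral `[s0, s1] (fun s => g (z s t1) * zs s t1) -
  cintegral `[s0, s1] (fun s => g (z s t0) * zs s t0).
Proof.
apply/eqP; rewrite -subr_eq0 -normc_eq0; change (normc (bnd g s0 s1 t0 t1) == 0).
rewrite eq_le normc_ge0 andbT.
have nx n m : (corner_ n).1 <= (corner_ (n + m)%N).1 /\
    (corner_ (n + m)%N).1 + ws (n + m)%N <= (corner_ n).1 + ws n.
  by have [] := corner_nested n m.
have ny n m : (corner_ n).2 <= (corner_ (n + m)%N).2 /\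
    (corner_ (n + m)%N).2 + wt (n + m)%N <= (corner_ n).2 + wt n.
  by have [] := corner_nested n m.
have [ps hps] := nested ws_ge0 nx; have [pt hpt] := nested wt_ge0 ny.
set D := (s1 - s0) + (t1 - t0).
have J0 : Jn 0 (s0, t0) = normc (bnd g s0 s1 t0 t1).
  by rewrite /Jn /ws /wt /= expr0 !divr1 ![_ + (_ - _)]addrC !subrK.
rewrite -J0; apply/ler_addgt0Pr => e e0; rewrite add0r.
have D0 : 0 <= D by rewrite addr_ge0 ?subr_ge0.
have d0 : 0 < D ^+ 2 + 1 by rewrite ltr_wpDl// sqr_ge0.
have hp1 : s0 <= ps <= s1.
  by have := hps 0%N; rewrite /= /ws expr0 divr1; lra.
have hp2 : t0 <= pt <= t1.
  by have := hpt 0%N; rewrite /= /wt expr0 divr1; lra.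
have [dl dl0 hdl] := local_est (e := e / (D ^+ 2 + 1)) ltac:(by rewrite divr_gt0) hp1 hp2.
have [n hn] : exists n, D / 2 ^+ n < dl.
  exists (Num.truncn (D / dl)).+1; rewrite ltr_pdivrMr ?exprn_gt0// mulrC -ltr_pdivrMr//.
  apply: lt_le_trans (Num.Theory.truncnS_gt _) _.
  by rewrite -natrX ler_nat ltnW// ltn_expl.
have [h1 h2 h3 h4 h5] := corner_in n.
have wn : ws n + wt n = D / 2 ^+ n by rewrite /ws /wt -mulrDl.
have := hdl (corner_ n).1 ((corner_ n).1 + ws n) (corner_ n).2 ((corner_ n).2 + wt n)
  h1 h2 h3 h4 (hps n) (hpt n).
rewrite ![_ + ws n]addrC ![_ + wt n]addrC !addrK wn.
rewrite ![ws n + _]addrC ![wt n + _]addrC => /(_ hn) hJ; apply: le_trans h5 _.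
apply: le_trans (ler_wpM2l _ hJ) _; first by rewrite exprn_ge0.
(* The factor 4^n lost by bisection is the square of the scale 2^(-n) gained. *)
have -> : 4 ^+ n * (e / (D ^+ 2 + 1) * (D / 2 ^+ n) ^+ 2) = e * (D ^+ 2 / (D ^+ 2 + 1)).
  have -> : (4 : R) ^+ n = (2 ^+ n) ^+ 2 by rewrite -exprM mulnC exprM -[2 ^+ 2]natrX.
  have : (2 : R) ^+ n != 0 by rewrite expf_neq0.
  by move: (lt0r_neq0 d0) => d1 e1; field; rewrite d1 e1.
by rewrite ger_pMr// ler_pdivrMr// mul1r lerDl.
Qed.

End Goursat.

(** * Cauchy's integral formula on a disc *)

Section Cis.
Variable R : realType.

Definition cis (t : R) : R[i] := cos t +i* sin t.

Lemma cisD x y : cis (x + y) = cis x * cis y.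
Proof.
rewrite /cis cosD sinD [RHS]/(_ * _) /=; congr (_ +i* _).
by rewrite addrC.
Qed.

Lemma cis0 : cis 0 = 1.
Proof. by rewrite /cis cos0 sin0. Qed.

Lemma normc_cis t : normc (cis t) = 1.
Proof. by rewrite /normc /cis cos2Dsin2 sqrtr1. Qed.

Lemma cis_neq0 t : cis t != 0.
Proof. by rewrite -normc_gt0 normc_cis. Qed.

Lemma cis2pi : cis (2 * pi) = 1.
Proof. by rewrite /cis mulr_natl cos2pi sin2pi. Qed.

Lemma cisN t : cis (- t) = (cis t)^-1.
Proof.
by apply: (mulfI (cis_neq0 t)); rewrite -cisD subrr cis0 mulfV ?cis_neq0.
Qed.

Lemma cder1_cis (k s t : R) : cder1 (fun t => cis (k * t + s)) t ((0 +i* k) * cis (k * t + s)).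
Proof.
have hl : is_derive t 1 (fun t : R => k * t + s) k.
  apply: is_derive_eq (is_deriveD (is_deriveZ k (is_derive_id t 1)) (is_derive_cst s t 1)) _.
  by rewrite /GRing.scale /= mulr1 addr0.
split.
  apply: is_derive_eq (is_derive1_comp (is_derive_cos _) hl) _.
  by rewrite ReM /= mul0r sub0r mulrC mulrN.
apply: is_derive_eq (is_derive1_comp (is_derive_sin _) hl) _.
by rewrite ImM /= mul0r add0r mulrC.
Qed.

Lemma cder1_cisl (k t : R) : cder1 (fun t => cis (k * t)) t ((0 +i* k) * cis (k * t)).
Proof.
have := @cder1_cis k 0 t; rewrite addr0.
by rewrite (_ : (fun _ => _) = (fun t => cis (k * t)))//; apply/funext => x; rewrite addr0.
Qed.

End Cis.

Lemma kernel_alg (F : fieldType) (x y c z : F) : x != 0 -> y != 0 ->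
  c + x * y - z != 0 ->
  x * y / (c + x * y - z) = 1 + (z - c) / x / (1 - (z - c) / x / y) / y.
Proof.
move=> x0 y0; have -> : z - c = x * y - (c + x * y - z) by ring.
move: (c + _ - z) => d d0; have e : 1 - (x * y - d) / x / y = d / (x * y).
  by field; rewrite x0 y0.
by rewrite e; field; rewrite x0 y0 d0.
Qed.

Lemma cauchy_alg (F : fieldType) (f g x y d : F) : d != 0 ->
  f * (x * y / d) = x * ((f - g) / d * y) + g * (x * y / d).
Proof. by move=> d0; field. Qed.

Section Cauchy.
Variable R : realType.
Local Notation C := (R[i]^o).

Lemma normc_i (k : R) : normc (0 +i* k) = `|k|.
Proof. by rewrite /normc expr0n add0r sqrtr_sqr. Qed.

(** The circle is shrunk towards zeta along the segments to zeta. The segment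
    at t = 0 and at t = 2 pi is the same, so the integral does not change, and it
    tends to 0 because h is bounded near zeta. The factor k is 1 or -1: the circle
    is run either way. *)
Lemma cauchy_circle (h : C -> C) (c zeta : C) (r k : R) :
  0 < r -> cis (k * (2 * pi)) = 1 -> normc (zeta - c) < r ->
  (forall w : C, normc (w - c) <= r -> w != zeta -> derivable h w 1) ->
  (exists B d, 0 < d /\ forall w, 0 < normc (w - zeta) < d -> normc (h w) <= B) ->
  cintegral `[0, 2 * pi] (fun t => h (c + r%:C * cis (k * t)) *
     (r%:C * ((0 +i* k) * cis (k * t)))) = 0.
Proof.
move=> r0 hk hz hd [B0 [d [d0 hB0]]].
have [B Bge0 hB] : exists2 B, 0 <= B & forall w, 0 < normc (w - zeta) < d -> normc (h w) <= B.
  exists `|B0| => // w /hB0 hw; exact: le_trans hw (ler_norm B0).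
pose gam t : R[i] := c - zeta + r%:C * cis (k * t).
pose dgam t : R[i] := r%:C * ((0 +i* k) * cis (k * t)).
have pi2 : 0 <= 2 * pi :> R by rewrite mulr_ge0// pi_ge0.
have ncis t : normc (r%:C * cis (k * t)) = r.
  by rewrite normcM normc_cis normc_real mulr1 gtr0_norm.
have hgam0 t : gam t != 0.
  rewrite -normc_gt0 /gam -normcN opprD opprB normcB.
  have := ler_dist_normc (r%:C * cis (k * t)) (zeta - c).
  rewrite ncis ger0_norm ?subr_ge0 ?(ltW hz)//; apply: lt_le_trans.
  by rewrite subr_gt0.
have hgam t : normc (gam t) <= 2 * r.
  apply: le_trans (normcD _ _) _; rewrite ncis normcB; lra.
have hdgam t : cder1 gam t (dgam t).
  apply: cder1_eq (cder1D (cder1_cst _ _) (cder1M (cder1_cst _ _) (cder1_cisl k t))) _.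
  by rewrite mul0r !add0r.
have cdgam (t : R) : {for t, continuous (dgam : R -> C)}.
  exact: (cder1_cont (cder1M (cder1_cst r%:C t) (cder1M (cder1_cst (0 +i* k) t) (cder1_cisl k t)))).
have ndgam t : normc (dgam t) = r * `|k|.
  by rewrite /dgam 2!normcM normc_cis normc_i normc_real mulr1 (gtr0_norm r0).
set J := cintegral _ _.
have key e : 0 < e -> e < 1 -> e * (2 * r) < d ->
    normc J <= 2 * (B * (e * (r * `|k|))) * (2 * pi - 0).
  move=> e0 e1 ed.
  (* The homothety with centre zeta, from the given circle (s = 1) to a small one (s = e). *)
  pose z s t : R[i] := zeta + s%:C * gam t.
  pose zs (s t : R) := gam t; pose zt s t : R[i] := s%:C * dgam t.
  have ds (s : R) (t : R) : cder1 (fun s => z s t) s (zs s t).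
    have dr : cder1 (fun s => s%:C) s 1.
      by split => /=; [exact: is_derive_id|exact: is_derive_cst].
    apply: cder1_eq (cder1D (cder1_cst _ _) (cder1M dr (cder1_cst _ _))) _.
    by rewrite add0r mul1r mulr0 addr0.
  have dt (s : R) (t : R) : cder1 (fun t => z s t) t (zt s t).
    apply: cder1_eq (cder1D (cder1_cst _ _) (cder1M (cder1_cst _ _) (hdgam t))) _.
    by rewrite add0r mul0r add0r.
  have zz s t : z s t - zeta = s%:C * gam t by rewrite /z addrC addKr.
  have hz1 s t : e <= s <= 1 -> z s t != zeta.
    move=> hs; rewrite -subr_eq0 zz mulf_neq0//.
    by rewrite eq_complex /= eqxx andbT; apply/eqP; lra.
  have hz2 s t : e <= s <= 1 -> normc (z s t - c) <= r.
    move=> hs.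
    have -> : z s t - c = (1 - s)%:C * (zeta - c) + s%:C * (r%:C * cis (k * t)).
      rewrite /z /gam rmorphB rmorph1; ring.
    apply: le_trans (normcD _ _) _; rewrite 2!normcM ncis !normc_real !ger0_norm; try lra.
    have := ltW hz; have := normc_ge0 (zeta - c); nra.
  have G : cintegral `[0, 2 * pi] (fun t => h (z 1 t) * zt 1 t) -
      cintegral `[0, 2 * pi] (fun t => h (z e t) * zt e t) =
      cintegral `[e, 1] (fun s => h (z s (2 * pi)) * zs s (2 * pi)) -
      cintegral `[e, 1] (fun s => h (z s 0) * zs s 0).
    apply: (@goursat R z zs zt e 1 0 (2 * pi) (2 * r + r * `|k|)
      (fun s t _ _ => ds s t) (fun s t _ _ => dt s t) _ _ _ _ h _ (ltW e1) pi2).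
    - by move=> s t _ _; exact: contC_cst.
    - by move=> s t _ _; apply: contCM; [exact: contC_cst|exact: cdgam].
    - by move=> s t _ _; apply: le_trans (hgam t) _; rewrite lerDl mulr_ge0// ltW.
    - move=> s t hs _; rewrite normcM ndgam normc_real ger0_norm; last lra.
      have : 0 <= r * `|k| by rewrite mulr_ge0// ltW.
      by move: (r * `|k|) => x x0; nra.
    - by move=> s t hs _; apply: hd; [exact: hz2|exact: hz1].
  have J1 : J = cintegral `[0, 2 * pi] (fun t => h (z 1 t) * zt 1 t).
    apply: eq_cintegral => t _; rewrite /z /zt rmorph1 !mul1r /dgam /gam; congr (h _ * _).
    by ring.
  have Je : normc (cintegral `[0, 2 * pi] (fun t => h (z e t) * zt e t)) <=
      2 * (B * (e * (r * `|k|))) * (2 * pi - 0).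
    have hh t : {for t, continuous (fun t => h (z e t) * zt e t : C)}.
      apply: contCM.
        apply: (@contC_comp _ _ h (fun t => z e t)); first exact: (cder1_cont (dt e t)).
        by apply: derivC_cont; apply: hd; [apply: hz2|apply: hz1]; lra.
      by apply: contCM; [exact: contC_cst|exact: cdgam].
    apply: cintegral_seg_le => //; first by apply: cont_cintg => t _; exact: hh.
    move=> t _; rewrite normcM; apply: ler_pM; rewrite ?normc_ge0//.
      apply: hB; rewrite normc_gt0 subr_eq0 hz1 /=; last lra.
      rewrite zz normcM normc_real gtr0_norm//; apply: le_lt_trans ed.
      by rewrite ler_pM2l.
    by rewrite normcM ndgam normc_real gtr0_norm.
  rewrite J1; move: G; rewrite [X in _ = X -> _](_ : _ = 0); last first.
    apply/eqP; rewrite subr_eq0; apply/eqP; apply: eq_cintegral => s _.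
    by rewrite /z /zs /gam hk mulr0 cis0.
  by move/eqP; rewrite subr_eq0 => /eqP ->.
apply/eqP; rewrite -normc_eq0 eq_le normc_ge0 andbT.
apply/ler_addgt0Pr => e e0; rewrite add0r.
pose K := 2 * (B * (r * `|k|)) * (2 * pi - 0).
have K0 : 0 <= K by rewrite !mulr_ge0// ?subr0// ltW.
pose e' := Num.min (2^-1) (Num.min (d / (4 * r)) (e / (K + 1))).
have K1 : 0 < K + 1 by lra.
have r4 : 0 < 4 * r by lra.
have e'0 : 0 < e' by rewrite !lt_min invr_gt0 ltr0n !divr_gt0.
have e'1 : e' <= 2^-1 by rewrite ge_min lexx.
have e'2 : e' <= d / (4 * r) by rewrite !ge_min lexx orbT.
have e'3 : e' <= e / (K + 1) by rewrite !ge_min lexx !orbT.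
apply: le_trans (key e' e'0 _ _) _.
- by apply: le_lt_trans e'1 _; rewrite invf_lt1// ltr1n.
- move: e'2; rewrite ler_pdivlMr// => h2; lra.
- move: e'3; rewrite ler_pdivlMr// => h3.
  rewrite (_ : _ * (2 * pi - 0) = e' * K); first nra.
  by rewrite /K; ring.
Qed.

Lemma cauchy_circle1 (h : C -> C) (c : C) (r : R) (zeta : C) (k : R) :
  0 < r -> k \in [:: 1; -1] -> normc (zeta - c) < r ->
  (forall w : C, normc (w - c) <= r -> w != zeta -> derivable h w 1) ->
  (exists B d, 0 < d /\ forall w, 0 < normc (w - zeta) < d -> normc (h w) <= B) ->
  cintegral `[0, 2 * pi] (fun t => h (c + r%:C * cis (k * t)) * cis (k * t)) = 0.
Proof.
move=> r0 hk hz hd hB.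
have hk2 : cis (k * (2 * pi)) = 1.
  by move: hk; rewrite !inE => /orP[] /eqP ->; rewrite ?mul1r ?mulN1r ?cisN cis2pi ?invr1.
have k0 : (0 +i* k : R[i]) != 0.
  by rewrite eq_complex /= eqxx /=; move: hk; rewrite !inE => /orP[] /eqP ->;
    rewrite ?oppr_eq0 oner_eq0.
have rk0 : r%:C * (0 +i* k) != 0 :> R[i].
  by rewrite mulf_neq0// eq_complex /= eqxx andbT gt_eqF.
have E := cauchy_circle r0 hk2 hz hd hB.
have -> : (fun t => h (c + r%:C * cis (k * t)) * cis (k * t)) =
  (fun t => (r%:C * (0 +i* k))^-1 * (h (c + r%:C * cis (k * t)) *
     (r%:C * ((0 +i* k) * cis (k * t))))).
  by apply/funext => t; rewrite [r%:C * (_ * _)]mulrA mulrCA mulKf.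
set E1 := (fun t => h _ * _) in E *.
have int1 : cintg `[0, 2 * pi] E1.
  apply: cont_cintg => t _; apply: contCM.
    apply: (@contC_comp _ _ h (fun t => c + r%:C * cis (k * t))).
      exact: (cder1_cont (cder1D (cder1_cst c t) (cder1M (cder1_cst r%:C t) (cder1_cisl k t)))).
    apply: derivC_cont; apply: hd.
      by rewrite addrC addKr normcM normc_real normc_cis mulr1 gtr0_norm.
    apply/eqP => e; move: hz; rewrite -e addrC addKr normcM normc_real normc_cis.
    by rewrite mulr1 gtr0_norm// ltxx.
  apply: contCM; first exact: contC_cst.
  apply: contCM; first exact: contC_cst.
  exact: (cder1_cont (cder1_cisl k t)).
by rewrite cintegralZ// E mulr0.
Qed.

Lemma contC_circle (f : C -> C) (c : C) (r k t : R) :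
  {for c + r%:C * cis (k * t), continuous f} ->
  {for t, continuous (fun t => f (c + r%:C * cis (k * t)) : C)}.
Proof.
apply: (@contC_comp _ _ f (fun t => c + r%:C * cis (k * t))).
exact: (cder1_cont (cder1D (cder1_cst c t) (cder1M (cder1_cst r%:C t) (cder1_cisl k t)))).
Qed.

Lemma contC_cis (k t : R) : {for t, continuous (fun t => cis (k * t) : C)}.
Proof. exact: (cder1_cont (cder1_cisl k t)). Qed.

Lemma cintegral_cst (a b : R) (z : R[i]) : a <= b ->
  cintegral `[a, b] (fun=> z) = (b - a)%:C * z.
Proof.
move=> ab; rewrite /cintegral !Rintegral_seg_cst//; case: z => x y /=.
by rewrite /real_complex_def /GRing.mul /= !mul0r subr0 addr0 !(mulrC (b - a)).
Qed.

Let pi2 : 0 <= 2 * pi :> R. Proof. by rewrite mulr_ge0// pi_ge0. Qed.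

Lemma kernel_ne (c zeta : C) (r t : R) : 0 < r -> normc (zeta - c) < r ->
  c + r%:C * cis (1 * t) - zeta != 0.
Proof.
move=> r0 hz; apply/eqP => /eqP; rewrite subr_eq0 => /eqP e.
by move: hz; rewrite -e addrC addKr normcM normc_real normc_cis mulr1 gtr0_norm// ltxx.
Qed.

Lemma cont_bounded (h : C -> C) (z : C) : {for z, continuous h} ->
  exists B d : R, 0 < d /\ forall w : C, normc (w - z) < d -> normc (h w) <= B.
Proof.
move=> /cvgCP /(_ 1 ltr01) /nbhsCP[d d0 hd]; exists (normc (h z) + 1), d; split => // w.
move=> /hd h1; rewrite -(subKr (h z) (h w)) (le_trans (normcBD _ _))// lerD2l.
by rewrite normcB ltW// normcB.
Qed.

(** The kernel is 1 plus a function of 1 / (r cis t) that is holomorphic in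
    the disc in that variable; running the circle backwards kills it. *)
Lemma cauchy_kernel (c zeta : C) (r : R) : 0 < r -> normc (zeta - c) < r ->
  cintegral `[0, 2 * pi] (fun t => r%:C * cis (1 * t) / (c + r%:C * cis (1 * t) - zeta)) =
  (2 * pi)%:C.
Proof.
move=> r0 hz; pose a := (zeta - c) / r%:C.
have rc0 : r%:C != 0 :> R[i] by rewrite eq_complex /= eqxx andbT gt_eqF.
have na : normc a < 1.
  by rewrite /a normcM normcV normc_real gtr0_norm// ltr_pdivrMr// mul1r.
have ne w : normc w <= 1 -> 1 - a * w != 0.
  move=> hw; rewrite subr_eq0 eq_sym; apply/eqP => e.
  have : normc (a * w) < 1.
    rewrite normcM; have := normc_ge0 a; have := normc_ge0 w; nra.
  by rewrite e normc1 ltxx.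
pose h (w : C) : C := a / (1 - a * w).
have dh (w : C) : normc w <= 1 -> derivable h w 1.
  move=> hw; apply: derivableM => //; apply: derivableV; first exact: ne.
  by apply: derivableB => //; apply: derivableM.
have E : cintegral `[0, 2 * pi] (fun t => h (0 + 1%:C * cis (-1 * t)) * cis (-1 * t)) = 0.
  apply: (@cauchy_circle1 h 0 1 0 (-1)) => //; rewrite ?inE ?eqxx ?orbT//.
  - by rewrite subr0 normc0.
  - by move=> w; rewrite subr0 => hw _; apply: dh.
  - have [|B [d [d0 hd]]] := @cont_bounded h 0; first by apply: derivC_cont; apply: dh; rewrite normc0.
    by exists B, d; split => // w /andP[_ /hd].
have k1 t : r%:C * cis (1 * t) / (c + r%:C * cis (1 * t) - zeta) =
    1 + h (0 + 1%:C * cis (-1 * t)) * cis (-1 * t).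
  rewrite mul1r mulN1r add0r rmorph1 mul1r /h.
  have c0 := cis_neq0 t.
  have n1 := @ne (cis (- t)); rewrite normc_cis in n1; have := n1 (lexx _).
  have n2 := @kernel_ne c zeta r t r0 hz; rewrite mul1r in n2.
  by rewrite cisN /a => n3; apply: kernel_alg.
under eq_cintegral do rewrite k1.
have iH : cintg `[0, 2 * pi] (fun t => h (0 + 1%:C * cis (-1 * t)) * cis (-1 * t)).
  apply: cont_cintg => t _; apply: contCM; last exact: contC_cis.
  apply: contC_circle; apply: derivC_cont; apply: dh.
  by rewrite add0r normcM normc_real normc_cis normr1 mul1r.
rewrite cintegralD//; last by apply: cont_cintg => t _; exact: contC_cst.
by rewrite E addr0 cintegral_cst// subr0 mulr1.
Qed.

(** Apply [cauchy_circle1] to the difference quotient of f at zeta, which is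
    bounded near zeta. *)
Lemma cauchy_formula (f : C -> C) (c zeta : C) (r : R) :
  0 < r -> normc (zeta - c) < r ->
  (forall w : C, normc (w - c) <= r -> derivable f w 1) ->
  cintegral `[0, 2 * pi] (fun t => f (c + r%:C * cis (1 * t)) *
    (r%:C * cis (1 * t) / (c + r%:C * cis (1 * t) - zeta))) = (2 * pi)%:C * f zeta.
Proof.
move=> r0 hz hd.
pose h (w : C) : C := (f w - f zeta) / (w - zeta).
have dh (w : C) : normc (w - c) <= r -> w != zeta -> derivable h w 1.
  move=> hw wz; apply: derivableM; first by apply: derivableB => //; exact: hd.
  by apply: derivableV; [rewrite subr_eq0|apply: derivableB].
have E : cintegral `[0, 2 * pi] (fun t => h (c + r%:C * cis (1 * t)) * cis (1 * t)) = 0.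
  apply: (@cauchy_circle1 h c r zeta 1) => //; rewrite ?inE ?eqxx//.
  have [B hB] := (derivCP _ _).1 (hd zeta (ltW hz)).
    have [d d0 hdd] := hB 1 ltr01.
    exists (normc B + 1), d; split => // w /andP[w0 wd].
    have := hdd _ wd; rewrite [zeta + _]addrC subrK mul1r => h1.
    rewrite /h normcM normcV ler_pdivrMr// mulrDl mul1r -normcM.
    apply: le_trans (lerD (lexx _) h1).
    by rewrite -{1}(subrK (B * (w - zeta)) (f w - f zeta)) addrC normcD.
have ncr t : normc (c + r%:C * cis (1 * t) - c) = r.
  by rewrite addrC addKr normcM normc_real normc_cis mulr1 gtr0_norm.
have cf (t : R) : {for t, continuous (fun t : R => f (c + r%:C * cis (1 * t)) : C)}.
  by apply: contC_circle; apply: derivC_cont; apply: hd; rewrite ncr.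
have ccirc (t : R) : {for t, continuous (fun t : R => r%:C * cis (1 * t) : C)}.
  by apply: contCM; [exact: contC_cst|exact: contC_cis].
have ck (t : R) : {for t, continuous (fun t : R => r%:C * cis (1 * t) / (c + r%:C * cis (1 * t) - zeta) : C)}.
  apply: contCM; first exact: ccirc.
  apply: contCV; first exact: kernel_ne.
  apply: contCB; last exact: contC_cst.
  by apply: contCD; [exact: contC_cst|exact: ccirc].
have k1 t : f (c + r%:C * cis (1 * t)) *
    (r%:C * cis (1 * t) / (c + r%:C * cis (1 * t) - zeta)) =
    r%:C * (h (c + r%:C * cis (1 * t)) * cis (1 * t)) +
    f zeta * (r%:C * cis (1 * t) / (c + r%:C * cis (1 * t) - zeta)).
  have n2 := @kernel_ne c zeta r t r0 hz.
  by rewrite /h; apply: cauchy_alg.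
under eq_cintegral do rewrite k1.
have ik : cintg `[0, 2 * pi]
    (fun t => r%:C * cis (1 * t) / (c + r%:C * cis (1 * t) - zeta)).
  by apply: cont_cintg => t _; exact: ck.
have ih : cintg `[0, 2 * pi] (fun t => h (c + r%:C * cis (1 * t)) * cis (1 * t)).
  apply: cont_cintg => t _; apply: contCM; last exact: contC_cis.
  apply: contC_circle; apply: derivC_cont; apply: dh; first by rewrite ncr.
  by rewrite -subr_eq0; exact: kernel_ne.
rewrite cintegralD//; [|exact: cintgZ|exact: cintgZ].
by rewrite !cintegralZ// E mulr0 add0r cauchy_kernel// mulrC.
Qed.

End Cauchy.

(** * Identity theorems and holomorphy of limits *)

Section Holomorphic.
Variable R : realType.
Local Notation C := (R[i]^o).

Let pi2 : 0 <= 2 * pi :> R. Proof. by rewrite mulr_ge0// pi_ge0. Qed.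

Lemma circleE (c : C) (r t : R) : 0 < r -> normc (c + r%:C * cis (1 * t) - c) = r.
Proof.
by move=> r0; rewrite addrC addKr normcM normc_real normc_cis mulr1 gtr0_norm.
Qed.

Lemma circle_dist (c zeta : C) (r t : R) : 0 < r ->
  r - normc (zeta - c) <= normc (c + r%:C * cis (1 * t) - zeta).
Proof.
move=> r0; rewrite -{1}(circleE c t r0) lerBlDr.
by apply: le_trans (normcD _ _); rewrite addrA subrK.
Qed.

Lemma contC_inv_circle (c zeta : C) (r t : R) : 0 < r -> normc (zeta - c) < r ->
  {for t, continuous (fun t : R => (c + r%:C * cis (1 * t) - zeta)^-1 : C)}.
Proof.
move=> r0 hz; apply: contCV; first exact: kernel_ne.
apply: contCB; last exact: contC_cst.
apply: contCD; first exact: contC_cst.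
by apply: contCM; [exact: contC_cst|exact: contC_cis].
Qed.

Lemma contC_on_circle (f : C -> C) (c : C) (r : R) (t : R) : 0 < r ->
  (forall w : C, normc (w - c) <= r -> derivable f w 1) ->
  {for t, continuous (fun t : R => f (c + r%:C * cis (1 * t)) : C)}.
Proof.
by move=> r0 hd; apply: contC_circle; apply: derivC_cont; apply: hd; rewrite circleE.
Qed.

Lemma cauchy_bound (f : C -> C) (c zeta : C) (r M : R) :
  0 < r -> normc (zeta - c) < r ->
  (forall w : C, normc (w - c) <= r -> derivable f w 1) ->
  (forall t : R, 0 <= t <= 2 * pi -> normc (f (c + r%:C * cis (1 * t))) <= M) ->
  normc (f zeta) <= 2 * (M * (r / (r - normc (zeta - c)))).
Proof.
move=> r0 hz hd hM; have p0 : 0 < 2 * pi :> R by rewrite mulr_gt0// pi_gt0.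
have rz : 0 < r - normc (zeta - c) by rewrite subr_gt0.
rewrite -(ler_pM2r p0) -[X in _ <= _ * X]subr0.
rewrite -{1}(gtr0_norm p0) -normc_real -normcM mulrC -(cauchy_formula r0 hz hd).
apply: cintegral_seg_le => //.
  apply: cont_cintg => t _; apply: contCM; first exact: contC_on_circle.
  apply: contCM; last exact: contC_inv_circle.
  by apply: contCM; [exact: contC_cst|exact: contC_cis].
move=> t ht; rewrite normcM; apply: ler_pM; rewrite ?normc_ge0//; first exact: hM.
rewrite normcM normcV normcM normc_real normc_cis mulr1 gtr0_norm//.
rewrite ler_pM2l// lef_pV2 ?posrE//; first exact: circle_dist.
exact: lt_le_trans rz (circle_dist _ _ _ r0).
Qed.

Lemma circle_bounded (f : C -> C) (c : C) (r : R) : 0 < r ->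
  (forall w : C, normc (w - c) <= r -> derivable f w 1) ->
  exists2 M : R, 0 <= M &
    forall t : R, 0 <= t <= 2 * pi -> normc (f (c + r%:C * cis (1 * t))) <= M.
Proof.
move=> r0 hd.
have [|x _ hx] := @EVT_max R (fun t => normc (f (c + r%:C * cis (1 * t)))) 0 (2 * pi) pi2.
  apply: continuous_subspaceT => t.
  exact: (cvg_normc (@contC_on_circle f c r t r0 hd)).
exists (normc (f (c + r%:C * cis (1 * x)))); first exact: normc_ge0.
by move=> t ht; apply: hx; rewrite in_itv.
Qed.

Lemma derivableC_inv_pow (c w : C) n : w != c ->
  derivable (fun w : C => ((w - c) ^+ n)^-1 : C) w 1.
Proof.
move=> wc; apply: derivableV; first by rewrite expf_neq0// subr_eq0.
have d1 : derivable (fun w : C => w - c : C) w 1 by apply: derivableB.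
have := @derivableX _ _ _ n _ _ d1.
rewrite (_ : _ ^+ n = (fun w : C => (w - c) ^+ n : C))//.
by apply/funext => x; rewrite fctE.
Qed.

Lemma pow_lt_small (x e : R) : 0 <= x < 1 -> 0 < e -> exists n, x ^+ n < e.
Proof.
move=> /andP[x0 x1] e0.
have : (x ^+ n @[n --> \oo] --> (0 : R)) by apply: cvg_expr; rewrite ger0_norm.
move=> /cvgrPdist_lt/(_ e e0)[N _ hN]; exists N; move: (hN N (leqnn N)) => /=.
by rewrite sub0r normrN ger0_norm// exprn_ge0.
Qed.

(** f / (w - c)^n is holomorphic for every n. The Cauchy bound for it shows
    that |f z| is at most a constant times (|z - c| / r)^n. *)
Lemma disc_identity (f : C -> C) (c : C) (r0 r1 : R) : 0 < r0 ->
  (forall w, normc (w - c) < r0 -> f w = 0) ->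
  (forall w : C, normc (w - c) < r1 -> derivable f w 1) ->
  forall w, normc (w - c) < r1 -> f w = 0.
Proof.
move=> r00 f0 fd z hz.
have [zc|zc] := eqVneq z c; first by rewrite zc f0// subrr normc0.
have nz : 0 < normc (z - c) by rewrite normc_gt0 subr_eq0.
have [r zr rr1] : exists2 r, normc (z - c) < r & r < r1.
  by exists ((normc (z - c) + r1) / 2); lra.
have r_gt0 : 0 < r by lra.
have fdr (w : C) : normc (w - c) <= r -> derivable f w 1.
  by move=> hw; apply: fd; exact: le_lt_trans hw rr1.
have [M M0 hM] := circle_bounded r_gt0 fdr.
pose g n (w : C) : C := f w * ((w - c) ^+ n)^-1.
have gd n (w : C) : normc (w - c) <= r -> derivable (g n) w 1.
  move=> hw; case: (ltP (normc (w - c)) r0) => wr.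
    have : derivable (fun _ : C => 0 : C) w 1 by exact: derivable_cst.
    apply: near_eq_derivable; apply/nbhsCP.
    exists (r0 - normc (w - c)); first by rewrite subr_gt0.
    move=> y hy; rewrite /g f0 ?mul0r//.
    rewrite -(subrK w y) -addrA; apply: le_lt_trans (normcD _ _) _; lra.
  apply: derivableM; first exact: fdr.
  apply: derivableC_inv_pow; rewrite -subr_eq0 -normc_gt0; lra.
pose K := 2 * (M * (r / (r - normc (z - c)))).
have K0 : 0 <= K by rewrite !mulr_ge0// ?invr_ge0; lra.
pose x := normc (z - c) / r.
have x01 : 0 <= x < 1.
  by rewrite /x divr_ge0 ?normc_ge0 ?(ltW r_gt0)//= ltr_pdivrMr// mul1r.
have key n : normc (f z) <= K * x ^+ n.
  have := @cauchy_bound (g n) c z r (M / r ^+ n) r_gt0 zr (gd n) _.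
  have hb t : 0 <= t <= 2 * pi -> normc (g n (c + r%:C * cis (1 * t))) <= M / r ^+ n.
    move=> ht; rewrite /g normcM normcV normcX circleE// ler_pM2r ?hM//.
    by rewrite invr_gt0 exprn_gt0.
  move=> /(_ hb); rewrite /g normcM normcV normcX => h.
  have pn : 0 < normc (z - c) ^+ n by rewrite exprn_gt0.
  move: h; rewrite ler_pdivrMr// => /le_trans; apply.
  rewrite /K /x expr_div_n.
  move: ((r ^+ n)^-1) (normc (z - c) ^+ n) ((r - normc (z - c))^-1) => A P B.
  by rewrite le_eqVlt; apply/orP; left; apply/eqP; ring.
apply/eqP; rewrite -normc_eq0 eq_le normc_ge0 andbT.
apply/ler_addgt0Pr => e e0; rewrite add0r.
have K1 : 0 < K + 1 by lra.
have [n hn] := @pow_lt_small x (e / (K + 1)) x01 (divr_gt0 e0 K1).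
apply: le_trans (key n) _; move: hn; rewrite ltr_pdivlMr// => hn.
have : 0 <= x ^+ n by rewrite exprn_ge0//; case/andP: x01.
by move: (x ^+ n) hn => y; nra.
Qed.

Lemma quot_alg (F : fieldType) (x h : F) : x - h != 0 -> x != 0 ->
  x / (x - h) - x / x = h * (x - h)^-1.
Proof. by move=> a b; field; rewrite a b. Qed.

Lemma inv_alg (F : fieldType) (x h h' : F) : x - h != 0 -> x - h' != 0 ->
  (x - h)^-1 - (x - h')^-1 = (h - h') * ((x - h)^-1 * (x - h')^-1).
Proof. by move=> a b; field; rewrite a b. Qed.

Definition dquot (f : C -> C) (c h : C) : C := (f (c + h) - f c) / h.

(** By Cauchy's formula the quotient is a contour integral that is Lipschitz
    in h. Unlike differentiability, this survives limits and integration. *)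
Lemma dquot_lip (f : C -> C) (c : C) (r M : R) : 0 < r ->
  (forall w : C, normc (w - c) <= r -> derivable f w 1) ->
  (forall w : C, normc (w - c) <= r -> normc (f w) <= M) ->
  forall h h' : C, h != 0 -> h' != 0 -> normc h <= r / 2 -> normc h' <= r / 2 ->
  normc (dquot f c h - dquot f c h') <= 8 * M / r ^+ 2 * (normc h + normc h').
Proof.
move=> r0 hd hM h h' h0 h'0 hr h'r.
have M0 : 0 <= M.
  by apply: le_trans (normc_ge0 _) (hM c _); rewrite subrr normc0 ltW.
have p0 : 0 < 2 * pi :> R by rewrite mulr_gt0// pi_gt0.
have pc0 : (2 * pi)%:C != 0 :> R[i] by rewrite eq_complex /= eqxx andbT gt_eqF.
have lt_r k : normc k <= r / 2 -> normc (c + k - c) < r.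
  by rewrite addrC addKr => hk; apply: le_lt_trans hk _; lra.
have cr : normc (c - c) < r by rewrite subrr normc0.
pose w (t : R) : C := c + r%:C * cis (1 * t).
pose Q k := cintegral `[0, 2 * pi] (fun t => f (w t) * (w t - (c + k))^-1).
have cfw (t : R) : {for t, continuous (fun t : R => f (w t) : C)}.
  exact: contC_on_circle.
have cq k (t : R) : normc k <= r / 2 ->
    {for t, continuous (fun t : R => f (w t) * (w t - (c + k))^-1 : C)}.
  by move=> hk; apply: contCM; [exact: cfw|apply: contC_inv_circle => //; exact: lt_r].
have iq k : normc k <= r / 2 ->
    cintg `[0, 2 * pi] (fun t => f (w t) * (w t - (c + k))^-1).
  by move=> hk; apply: cont_cintg => t _; exact: cq.
have HQ k : k != 0 -> normc k <= r / 2 -> dquot f c k = (2 * pi)%:C^-1 * Q k.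
  move=> k0 hk; apply: (mulfI k0); rewrite /dquot mulrCA divff// mulr1.
  apply: (mulfI pc0); rewrite mulrBr -(cauchy_formula r0 (lt_r _ hk) hd).
  rewrite -(cauchy_formula r0 cr hd) -cintegralB//; last 2 first.
  - apply: cont_cintg => t _; apply: contCM; first exact: cfw.
    apply: contCM; last by apply: contC_inv_circle => //; exact: lt_r.
    by apply: contCM; [exact: contC_cst|exact: contC_cis].
  - apply: cont_cintg => t _; apply: contCM; first exact: cfw.
    apply: contCM; last exact: contC_inv_circle.
    by apply: contCM; [exact: contC_cst|exact: contC_cis].
  rewrite [RHS]mulrCA mulVKf// -cintegralZ//; last exact: iq.
  apply: eq_cintegral => t _; rewrite -mulrBr -/(w t).
  have e : r%:C * cis (1 * t) = w t - c by rewrite /w addrC addKr.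
  rewrite e opprD addrA quot_alg; first by rewrite mulrCA.
    rewrite -addrA -opprD; exact: (kernel_ne _ r0 (lt_r _ hk)).
  exact: (kernel_ne _ r0 cr).
rewrite !HQ// -mulrBr normcM normcV normc_real gtr0_norm// mulrC ler_pdivrMr//.
rewrite -[X in _ <= _ * X]subr0 -cintegralB//; [|exact: iq|exact: iq].
have -> : 8 * M / r ^+ 2 * (normc h + normc h') =
   2 * (M * ((normc h + normc h') * ((r / 2)^-1 * (r / 2)^-1))).
  by field; rewrite gt_eqF.
apply: cintegral_seg_le => //.
  by apply: cintgB => //; exact: iq.
have r2 : 0 < r / 2 by lra.
have low t k : normc k <= r / 2 -> r / 2 <= normc (w t - c - k).
  move=> hk; rewrite -addrA -opprD; apply: le_trans (circle_dist c (c + k) t r0).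
  rewrite [c + k]addrC addrK; lra.
have ne t k : normc k <= r / 2 -> w t - c - k != 0.
  by move=> hk; rewrite -normc_gt0; apply: lt_le_trans r2 (low _ _ hk).
move=> t _; rewrite -mulrBr !opprD !addrA inv_alg ?ne// 3!normcM.
apply: ler_pM; rewrite ?normc_ge0 ?mulr_ge0 ?normc_ge0//.
  by apply: hM; rewrite circleE.
apply: ler_pM; rewrite ?normc_ge0 ?mulr_ge0 ?normc_ge0//; first exact: normcBD.
by apply: ler_pM; rewrite ?normc_ge0// normcV lef_pV2 ?posrE// ?low// (lt_le_trans r2)// low.
Qed.

(** The difference quotients form a Cauchy filter. *)
Lemma derivable_dquot (f : C -> C) (c : C) (r K : R) : 0 < r ->
  (forall h h' : C, h != 0 -> h' != 0 -> normc h < r -> normc h' < r ->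
   normc (dquot f c h - dquot f c h') <= K * (normc h + normc h')) ->
  derivable f c 1.
Proof.
move=> r0 hK.
have dqE : (fun h : C => h^-1 *: ((f \o shift c) (h *: (1 : C)) - f c)) = dquot f c.
  by apply/funext => h; rewrite /dquot /= mulrC /GRing.scale /= mulr1 [h + c]addrC.
have K1 : 0 < `|K| + 1 by rewrite ltr_wpDl.
have key (p : C -> R) : (forall x y, `|p x - p y| <= normc (x - y)) ->
    cvg (p (dquot f c h) @[h --> (0 : C)^']).
  move=> hp; apply/cauchy_cvgP; apply: cauchy_exP => e e0.
  pose d := Num.min r (e / (2 * (`|K| + 1))).
  have d0 : 0 < d by rewrite lt_min r0 divr_gt0// mulr_gt0.
  have dr : d <= r by rewrite ge_min lexx.
  have de : d * (2 * (`|K| + 1)) <= e.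
    by rewrite -ler_pdivlMr ?mulr_gt0// ge_min lexx orbT.
  pose h0 : C := (d / 2)%:C.
  have nh0 : normc h0 = d / 2 by rewrite normc_real gtr0_norm// divr_gt0.
  have h00 : h0 != 0 by rewrite -normc_gt0 nh0 divr_gt0.
  exists (p (dquot f c h0)); apply/nbhsCP; exists (d / 2); first by rewrite divr_gt0.
  move=> h; rewrite subr0 => hd hne /=; rewrite /ball /=.
  apply: le_lt_trans (hp _ _) _.
  apply: le_lt_trans (hK _ _ h00 hne _ _) _; [rewrite nh0; lra|lra|].
  rewrite nh0; have := ler_norm K; have := normc_ge0 h; move: (normc h) hd => y hy y0 hk.
  have : 0 <= `|K| by []. nra.
have cRe := key (@complex.Re R) (fun x y => _).
have {}cRe : cvg (complex.Re (dquot f c h) @[h --> (0 : C)^']).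
  by apply: cRe => x y; rewrite -raddfB; exact: Re_le_normc.
have cIm : cvg (complex.Im (dquot f c h) @[h --> (0 : C)^']).
  by apply: key => x y; rewrite -raddfB; exact: Im_le_normc.
rewrite /derivable dqE.
have /cvg_ex[/= a ha] := cRe; have /cvg_ex[/= b hb] := cIm.
apply/cvg_ex; exists (a +i* b : C).
have -> : dquot f c = (fun h => complex.Re (dquot f c h) +i* complex.Im (dquot f c h) : C).
  by apply/funext => h; case: (dquot f c h).
exact: (cvg_Complex ha hb).
Qed.

(** The Lipschitz bound on difference quotients is uniform in n, hence holds
    for the limit. *)
Lemma derivable_lim (F : nat -> C -> C) (f : C -> C) (c : C) (r M : R) : 0 < r ->
  (forall n (w : C), normc (w - c) <= r -> derivable (F n) w 1) ->
  (forall n w, normc (w - c) <= r -> normc (F n w) <= M) ->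
  (forall w, normc (w - c) <= r -> F n w @[n --> \oo] --> f w) ->
  derivable f c 1.
Proof.
move=> r0 hd hM hl; have r2 : 0 < r / 2 by lra.
apply: (@derivable_dquot f c (r / 2) (8 * M / r ^+ 2) r2) => h h' h0 h'0 hr h'r.
have lim k : normc k < r / 2 -> dquot (F n) c k @[n --> \oo] --> dquot f c k.
  move=> hk; apply: cvgM; last exact: cvg_cst.
  apply: cvgB; apply: hl; first by rewrite addrC addKr; lra.
  by rewrite subrr normc0 ltW.
have hc : normc (dquot (F n) c h - dquot (F n) c h') @[n --> \oo] -->
    normc (dquot f c h - dquot f c h') by exact: cvg_normc (cvgB (lim _ hr) (lim _ h'r)).
rewrite -(cvg_lim (@norm_hausdorff _ _) hc); apply: limr_le; first exact: cvgP hc.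
apply: nearW => n.
exact: (dquot_lip r0 (hd n) (hM n) h0 h'0 (ltW hr) (ltW h'r)).
Qed.

(** The Lipschitz bound on difference quotients holds pointwise with w as
    the bound of the family, and is then integrated. *)
Lemma derivable_cintegral (D : set (measurableTypeR R)) (phi : C -> R -> C) (w : R -> R)
    (c : C) (r : R) : 0 < r -> measurable D ->
  (@lebesgue_measure R).-integrable D (EFin \o w) ->
  (forall t : C, normc (t - c) <= r -> cintg D (phi t)) ->
  (forall (t : C) x, normc (t - c) <= r -> D x -> normc (phi t x) <= w x) ->
  (forall (t : C) x, normc (t - c) <= r -> D x -> derivable (phi^~ x) t 1) ->
  derivable (fun t : C => cintegral D (phi t) : C) c 1.
Proof.
move=> r0 mD iw ic hM hd; have r2 : 0 < r / 2 by lra.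
pose W := \int[@lebesgue_measure R]_(x in D) w x.
apply: (@derivable_dquot _ c (r / 2) (16 / r ^+ 2 * W) r2) => h h' h0 h'0 hr h'r.
have icc : cintg D (phi c) by apply: ic; rewrite subrr normc0 ltW.
have ich k : normc k < r / 2 -> cintg D (phi (c + k)).
  by move=> hk; apply: ic; rewrite addrC addKr; lra.
have idq k : normc k < r / 2 -> cintg D (fun x => k^-1 * (phi (c + k) x - phi c x)).
  by move=> hk; apply: cintgZ => //; apply: cintgB => //; exact: ich.
have E k : normc k < r / 2 -> dquot (fun t : C => cintegral D (phi t) : C) c k =
    cintegral D (fun x => k^-1 * (phi (c + k) x - phi c x)).
  move=> hk; rewrite /dquot -cintegralB//; last exact: ich.
  by rewrite mulrC -cintegralZ//; apply: cintgB => //; exact: ich.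
rewrite !E// -cintegralB//; [|exact: idq|exact: idq].
have -> : 16 / r ^+ 2 * W * (normc h + normc h') =
    2 * (8 / r ^+ 2 * (normc h + normc h') * W) by ring.
rewrite -RintegralZl//; apply: cintegral_le => //.
- by apply: cintgB => //; exact: idq.
- by have := integrableZl mD (8 / r ^+ 2 * (normc h + normc h')) iw.
move=> x Dx; have hdx (t : C) : normc (t - c) <= r -> derivable (phi^~ x) t 1.
  by move=> ht; exact: hd.
have hMx (t : C) : normc (t - c) <= r -> normc (phi t x) <= w x.
  by move=> ht; exact: hM.
have := dquot_lip r0 hdx hMx h0 h'0 (ltW hr) (ltW h'r).
by rewrite /dquot ![_ / h]mulrC ![_ / h']mulrC => /le_trans; apply; rewrite le_eqVlt;
  apply/orP; left; apply/eqP; ring.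
Qed.

(** Chains [disc_identity] along discs of radius dl, starting at t1. *)
Lemma segment_identity (f : C -> C) (t0 t1 : C) (dl e : R) : 0 < dl -> 0 < e ->
  (forall (s : R) (w : C), 0 <= s <= 1 ->
     normc (w - (t0 + s%:C * (t1 - t0))) < dl -> derivable f w 1) ->
  (forall w : C, normc (w - t1) < e -> f w = 0) -> f t0 = 0.
Proof.
move=> dl0 e0 hd h1.
pose n := (Num.truncn (normc (t1 - t0) / dl)).+1.
have n0 : 0 < n%:R :> R by rewrite ltr0n.
have hn : normc (t1 - t0) / n%:R < dl.
  rewrite ltr_pdivrMr// mulrC -ltr_pdivrMr//; exact: Num.Theory.truncnS_gt.
pose x k : C := t0 + (1 - k%:R / n%:R)%:C * (t1 - t0).
have x0 : x 0%N = t1 by rewrite /x mul0r subr0 mul1r addrC subrK.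
have xn : x n = t0 by rewrite /x divff ?gt_eqF// subrr mul0r addr0.
have step k : normc (x k - x k.+1) < dl.
  have -> : x k - x k.+1 = (n%:R^-1)%:C * (t1 - t0).
    rewrite /x opprD addrACA subrr add0r -mulrBl -rmorphB; congr (_%:C * _).
    by rewrite -natr1; ring.
  by rewrite normcM normc_real ger0_norm ?invr_ge0// mulrC.
have s01 k : (k <= n)%N -> 0 <= 1 - (k%:R / n%:R : R) <= 1.
  move=> kn; rewrite subr_ge0 ler_pdivrMr// mul1r ler_nat kn /=.
  by rewrite gerBl divr_ge0.
have H k : (k <= n)%N -> forall w : C, normc (w - x k) < dl -> f w = 0.
  elim: k => [_|k ih kn].
    apply: (@disc_identity f (x 0%N) e dl e0); first by rewrite x0.
    by move=> w; apply: (hd _ w (s01 0%N _)).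
  apply: (@disc_identity f (x k.+1) (dl - normc (x k - x k.+1)) dl).
  - by rewrite subr_gt0.
  - move=> w hw; apply: (ih (ltnW kn)).
    rewrite -(subrK (x k.+1) w) -addrA; apply: le_lt_trans (normcD _ _) _.
    rewrite [normc (x k.+1 - _)]normcB; lra.
  - by move=> w; apply: (hd _ w (s01 _ kn)).
by apply: (H n (leqnn n)); rewrite xn subrr normc0.
Qed.

Lemma not_ge0_open (z : R[i]) : ~ (0 <= z) ->
  exists2 e : R, 0 < e & forall w : R[i], normc (w - z) < e -> ~ (0 <= w).
Proof.
move=> hz; have h (w : R[i]) : 0 <= w -> complex.Im w = 0 /\ 0 <= complex.Re w.
  by rewrite lecE => /andP[/eqP].
have [im0|im0] := eqVneq (complex.Im z) 0.
  have re0 : complex.Re z < 0.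
    by rewrite ltNge; apply/negP => re0; apply: hz; rewrite lecE /= im0 eqxx.
  exists (- complex.Re z) => [|w hw /h[_ w0]]; first by rewrite oppr_gt0.
  have := le_lt_trans (Re_le_normc _) hw; rewrite raddfB /= => h1.
  have := le_lt_trans (ler_norm _) h1; lra.
exists `|complex.Im z| => [|w hw /h[w0 _]]; first by rewrite normr_gt0.
have := le_lt_trans (Im_le_normc _) hw; rewrite raddfB /= w0 sub0r normrN.
by rewrite ltxx.
Qed.

(** Every excluded value met below (a nonpositive number, another a_i, a value
    that makes the product a power of q) has the form x / v with x >= 0 and v one
    of finitely many numbers. Excluding the whole rays costs nothing, because
    they are invariant under scaling by positive numbers. *)
Definition off_rays (vs : seq R[i]) (t : R[i]) := forall v, v \in vs -> ~ (0 <= t * v).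

Lemma off_rays_open vs (t : R[i]) : off_rays vs t ->
  exists2 e : R, 0 < e & forall w, normc (w - t) < e -> off_rays vs w.
Proof.
elim: vs => [_|v vs ih h]; first by exists 1.
have [|e1 e10 h1] := ih; first by move=> x xv; apply: h; rewrite inE xv orbT.
have [|e2 e20 h2] := @not_ge0_open (t * v); first by apply: h; rewrite inE eqxx.
have n1 : 0 < normc v + 1 by have := normc_ge0 v; lra.
exists (Num.min e1 (e2 / (normc v + 1))); first by rewrite lt_min e10 divr_gt0.
move=> w; rewrite lt_min => /andP[w1 w2] x; rewrite inE => /orP[/eqP ->|]; last exact: h1.
apply: h2; rewrite -mulrBl normcM; move: w2; rewrite ltr_pdivlMr// => w2.
apply: le_lt_trans w2; apply: ler_wpM2l; [exact: normc_ge0|lra].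
Qed.

Lemma off_raysZ vs (t : R[i]) (s : R) : 0 < s -> off_rays vs t -> off_rays vs (s%:C * t).
Proof.
move=> s0 h v /h; rewrite -mulrA; apply: contra_not.
by rewrite pmulr_rge0// ltcR.
Qed.

(** A ray is hit by t (1 + i x) for one value of x at most, so small positive
    x avoid it. *)
Lemma off_rays_near vs (t : R[i]) : t != 0 -> (forall v, v \in vs -> v != 0) ->
  exists2 e : R, 0 < e & forall x, 0 < x < e -> off_rays vs (t * (1 +i* x)).
Proof.
move=> t0; elim: vs => [_|v vs ih h]; first by exists 1.
have [|e1 e10 h1] := ih; first by move=> x xv; apply: h; rewrite inE xv orbT.
have v0 : v != 0 by apply: h; rewrite inE eqxx.
have [e2 e20 h2] : exists2 e : R, 0 < e &
    forall x, 0 < x < e -> complex.Im (t * v * (1 +i* x)) != 0.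
  have : t * v != 0 by rewrite mulf_neq0.
  case: (t * v) => a b; rewrite eq_complex /= => ab.
  have [b0|b0] := eqVneq b 0.
    exists 1 => // x /andP[x0 _]; rewrite b0 mul0r addr0 mulf_neq0 ?(gt_eqF x0)//.
    by move: ab; rewrite b0 eqxx andbT.
  have a1 : 0 < `|a| + 1 by rewrite ltr_wpDl.
  exists (`|b| / (`|a| + 1)); first by rewrite divr_gt0// normr_gt0.
  move=> x /andP[x0]; rewrite ltr_pdivlMr// mulr1 => hx.
  apply/eqP => e; have : `|b| = `|a| * x.
    by rewrite -[x in RHS]gtr0_norm// -normrM -normrN; congr `|_|; lra.
  lra.
exists (Num.min e1 e2); first by rewrite lt_min e10.
move=> x /andP[x0]; rewrite lt_min => /andP[x1 x2] y.
rewrite inE => /orP[/eqP ->|]; last by apply: h1; rewrite x0.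
rewrite mulrAC lecE => /andP[/eqP h3 _]; have := h2 x; rewrite x0 x2 => /(_ isT).
by rewrite h3 eqxx.
Qed.

Lemma real_affine (s S : R) (t : R[i]) :
  t + s%:C * (S%:C * t - t) = (1 + s * (S - 1))%:C * t.
Proof.
by case: t => a b; apply/eqP; rewrite eq_complex /=; apply/andP; split; apply/eqP; ring.
Qed.

(** Off the excluded rays, t is joined radially to a point of modulus
    close to 1. A point t0 on an excluded ray where f is differentiable is a limit
    of the points t0 (1 + i x). *)
Lemma ray_identity (f : C -> C) (vs : seq R[i]) (r0 d : R) (t0 : C) :
  (forall v, v \in vs -> v != 0) -> 0 <= r0 -> d < 1 ->
  (forall t : C, r0 < normc t < 1 -> off_rays vs t -> derivable f t 1) ->
  (forall t : C, d < normc t < 1 -> off_rays vs t -> f t = 0) ->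
  r0 < normc t0 < 1 -> derivable f t0 1 -> f t0 = 0.
Proof.
move=> vs0 r00 d1 hd hz ht0 dt0.
have good (t : C) : r0 < normc t < 1 -> off_rays vs t -> f t = 0.
  move=> /andP[rt t1] ot; have nt : 0 < normc t by lra.
  (* The radial segment ends at modulus m, beyond both t and d. *)
  pose m := Num.max (normc t) ((Num.max d 0 + 1) / 2).
  have md : d < m.
    rewrite /m lt_max; apply/orP; right; have : d <= Num.max d 0 by rewrite le_max lexx.
    lra.
  have m1 : m < 1.
    rewrite /m gt_max t1 /=; have : Num.max d 0 < 1 by rewrite gt_max d1 ltr01.
    lra.
  have tm : normc t <= m by rewrite /m le_max lexx.
  pose S := m / normc t; have S1 : 1 <= S by rewrite /S ler_pdivlMr// mul1r.
  have [e1 e10 he1] := off_rays_open ot.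
  pose dl := Num.min e1 (Num.min (normc t - r0) (1 - m)).
  have dl0 : 0 < dl by rewrite !lt_min e10 !subr_gt0 rt.
  have dl1 : dl <= e1 by rewrite ge_min lexx.
  have dl2 : dl <= normc t - r0 by rewrite !ge_min lexx !orbT.
  have dl3 : dl <= 1 - m by rewrite !ge_min lexx !orbT.
  have ray (sg : R) (w : C) : 1 <= sg <= S -> normc (w - sg%:C * t) < dl ->
      r0 < normc w < 1 /\ off_rays vs w.
    move=> /andP[sg1 sgS] hw; have sg0 : 0 < sg by lra.
    have nsg : normc (sg%:C * t) = sg * normc t by rewrite normcM normc_real gtr0_norm.
    have b1 : normc t <= sg * normc t by rewrite ler_peMl// ltW.
    have b2 : sg * normc t <= m by rewrite -ler_pdivlMr.
    have := le_lt_trans (ler_dist_normc _ _) hw; rewrite nsg ltr_norml => /andP[w1 w2].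
    split; first by apply/andP; split; lra.
    have -> : w = sg%:C * ((sg^-1)%:C * w).
      by rewrite mulrA -rmorphM mulfV ?gt_eqF// rmorph1 mul1r.
    apply: off_raysZ => //; apply: he1.
    have -> : (sg^-1)%:C * w - t = (sg^-1)%:C * (w - sg%:C * t).
      by rewrite mulrBr mulrA -rmorphM mulVf ?gt_eqF// rmorph1 mul1r.
    rewrite normcM normc_real ger0_norm ?invr_ge0 ?ltW//.
    apply: le_lt_trans (lt_le_trans hw dl1).
    by rewrite ler_piMl ?normc_ge0// invf_le1.
  have S1' : 1 <= S <= S by rewrite S1 lexx.
  pose e2 := Num.min dl (m - d).
  have e20 : 0 < e2 by rewrite lt_min dl0 subr_gt0.
  apply: (@segment_identity f t (S%:C * t) dl e2 dl0 e20).
    move=> s w /andP[s0 s1] hw.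
    have hs : 1 <= 1 + s * (S - 1) <= S.
      by apply/andP; split; [rewrite lerDl mulr_ge0// subr_ge0|nra].
    have [] := ray (1 + s * (S - 1)) w hs; last by move=> *; apply: hd.
    move: hw; congr (normc (_ - _) < _).
    exact: real_affine.
  move=> w; rewrite lt_min => /andP[w1 w2].
  have [/andP[w3 w4] w5] := ray S w S1' w1; apply: hz => //.
  rewrite w4 andbT; have := le_lt_trans (ler_dist_normc _ _) w2.
  have -> : normc (S%:C * t) = m.
    by rewrite normcM normc_real ger0_norm ?(le_trans _ S1)// /S divfK// gt_eqF.
  by rewrite ltr_norml => /andP[w6 w7]; lra.
have /andP[rt t1] := ht0; have nt : 0 < normc t0 by lra.
have t00 : t0 != 0 by rewrite -normc_gt0.
apply/eqP; rewrite -normc_eq0 eq_le normc_ge0 andbT; apply/ler_addgt0Pr => e e0.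
rewrite add0r.
have /cvgCP/(_ e e0)/nbhsCP[d2 d20 hd2] := derivC_cont dt0.
have [e1 e10 he1] := off_rays_near t00 vs0.
(* Half the bounds, because nearness is strict below. *)
pose x := Num.min (e1 / 2) (Num.min (d2 / 2) (Num.min ((normc t0 - r0) / 2) ((1 - normc t0) / 2))).
have x0 : 0 < x by rewrite !lt_min !divr_gt0// subr_gt0.
have x1 : x <= e1 / 2 by rewrite ge_min lexx.
have x2 : x <= d2 / 2 by rewrite !ge_min lexx !orbT.
have x3 : x <= (normc t0 - r0) / 2 by rewrite !ge_min lexx !orbT.
have x4 : x <= (1 - normc t0) / 2 by rewrite !ge_min lexx !orbT.
pose t := t0 * (1 +i* x).
have nd : normc (t - t0) <= x.
  have -> : t - t0 = t0 * (0 +i* x).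
    rewrite /t -{2}[t0]mulr1 -mulrBr; congr (_ * _).
    by apply/eqP; rewrite eq_complex /= subrr subr0 !eqxx.
  by rewrite normcM normc_i gtr0_norm// ler_piMl// ltW.
have ft : f t = 0.
  apply: good; last by apply: he1; rewrite x0; lra.
  have := le_trans (ler_dist_normc _ _) nd; rewrite ler_norml => /andP[h1 h2].
  by apply/andP; split; lra.
have := hd2 t; rewrite ft subr0 => /(_ _)/ltW; apply.
by apply: le_lt_trans nd _; lra.
Qed.

End Holomorphic.

(** * The infinite q-Pochhammer symbol *)

Section QPochhammer.
Variable R : realType.
Local Notation C := (R[i]^o).
Variable q : R[i].
Hypothesis q1 : normc q < 1.

Definition qprod n (x : R[i]) : R[i] := \prod_(k < n) (1 - x * q ^+ k).

Lemma qprodSl n x : qprod n.+1 x = (1 - x) * qprod n (x * q).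
Proof.
rewrite /qprod big_ord_recl expr0 mulr1; congr (_ * _).
by apply: eq_bigr => i _; rewrite lift0 exprS mulrA.
Qed.

Lemma qprodSr n x : qprod n.+1 x = qprod n x * (1 - x * q ^+ n).
Proof. by rewrite /qprod big_ord_recr. Qed.

Let q0 : 0 <= normc q. Proof. exact: normc_ge0. Qed.

(** Bounds the product of the 1 + X |q|^k. *)
Definition qbound (X : R) := expR (X / (1 - normc q)).

Lemma qprod_bound n x X : normc x <= X -> normc (qprod n x) <= qbound X.
Proof.
move=> xX; have X0 : 0 <= X by apply: le_trans xX; exact: normc_ge0.
have d0 : 0 < 1 - normc q by rewrite subr_gt0.
suff h : normc (qprod n x) <= expR (X * (1 - normc q ^+ n) / (1 - normc q)).
  apply: le_trans h _; rewrite ler_expR ler_pM2r ?invr_gt0//.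
  by rewrite ler_piMr// gerBl exprn_ge0.
elim: n => [|n ih].
  by rewrite /qprod big_ord0 normc1 expr0 subrr mulr0 mul0r expR0.
rewrite qprodSr normcM.
have -> : X * (1 - normc q ^+ n.+1) / (1 - normc q) =
    X * (1 - normc q ^+ n) / (1 - normc q) + X * normc q ^+ n.
  by rewrite exprS; field; rewrite gt_eqF.
rewrite expRD; apply: ler_pM; rewrite ?normc_ge0//.
apply: le_trans (expR_ge1Dx _); apply: le_trans (normcBD _ _) _.
by rewrite normc1 lerD2l normcM normcX ler_wpM2r// exprn_ge0.
Qed.

Lemma qprod_cauchy n m x :
  normc (qprod (n + m)%N x - qprod n x) <=
  qbound (normc x) * normc x / (1 - normc q) * normc q ^+ n.
Proof.
have d0 : 0 < 1 - normc q by rewrite subr_gt0.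
have B0 : 0 <= qbound (normc x) by exact: expR_ge0.
suff h : normc (qprod (n + m)%N x - qprod n x) <=
    qbound (normc x) * normc x / (1 - normc q) * (normc q ^+ n - normc q ^+ (n + m)%N).
  apply: le_trans h _; apply: ler_wpM2l; last by rewrite gerBl exprn_ge0.
  by rewrite !mulr_ge0 ?normc_ge0// invr_ge0 ltW.
elim: m => [|m ih]; first by rewrite addn0 !subrr normc0 mulr0.
rewrite addnS qprodSr.
have -> : qprod (n + m) x * (1 - x * q ^+ (n + m)) - qprod n x =
   (qprod (n + m) x - qprod n x) - qprod (n + m) x * (x * q ^+ (n + m)) by ring.
apply: le_trans (normcBD _ _) _.
have -> : qbound (normc x) * normc x / (1 - normc q) *
    (normc q ^+ n - normc q ^+ (n + m).+1) =
    qbound (normc x) * normc x / (1 - normc q) * (normc q ^+ n - normc q ^+ (n + m)) +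
    qbound (normc x) * (normc x * normc q ^+ (n + m)).
  by rewrite (exprS (normc q)); field; rewrite gt_eqF.
apply: lerD => //; rewrite !normcM normcX; apply: ler_wpM2r.
  by rewrite mulr_ge0 ?normc_ge0// exprn_ge0.
exact: qprod_bound.
Qed.

Lemma qprod_cvg x : (qprod n x : C) @[n --> \oo] --> (qpoch x q : C).
Proof.
suff : cvg ((qprod n x : C) @[n --> \oo]) by [].
set K := qbound (normc x) * normc x / (1 - normc q).
have K0 : 0 <= K.
  by rewrite !mulr_ge0 ?normc_ge0 ?expR_ge0// invr_ge0 ltW// subr_gt0.
have key (p : C -> R) : (forall x y, `|p x - p y| <= normc (x - y)) ->
    cvg (p (qprod n x) @[n --> \oo]).
  move=> hp; apply/cauchy_cvgP; apply: cauchy_exP => e e0.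
  have K1 : 0 < K + 1 by lra.
  have [|n hn] := @pow_lt_small R (normc q) (e / (K + 1)) _ (divr_gt0 e0 K1).
    by rewrite q0.
  exists (p (qprod n x)); exists n => // m /= nm; rewrite /ball /=.
  apply: le_lt_trans (hp _ _) _; rewrite normcB -(subnKC nm).
  apply: le_lt_trans (qprod_cauchy _ _ _) _; rewrite -/K.
  move: hn; rewrite ltr_pdivlMr// => hn.
  have : 0 <= normc q ^+ n by rewrite exprn_ge0.
  by move: (normc q ^+ n) hn => y; nra.
have cRe : cvg (complex.Re (qprod n x) @[n --> \oo]).
  by apply: (key (@complex.Re R)) => y z; rewrite -raddfB; exact: Re_le_normc.
have cIm : cvg (complex.Im (qprod n x) @[n --> \oo]).
  by apply: (key (@complex.Im R)) => y z; rewrite -raddfB; exact: Im_le_normc.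
have /cvg_ex[/= a ha] := cRe; have /cvg_ex[/= b hb] := cIm.
apply/cvg_ex; exists (a +i* b : C).
have -> : (fun n => qprod n x : C) =
    (fun n => complex.Re (qprod n x) +i* complex.Im (qprod n x) : C).
  by apply/funext => n; case: (qprod n x).
exact: (cvg_Complex ha hb).
Qed.

Lemma qpochS x : qpoch x q = (1 - x) * qpoch (x * q) q.
Proof.
have h1 : (qprod n.+1 x : C) @[n --> \oo] --> (qpoch x q : C).
  by have := @qprod_cvg x; rewrite -cvg_shiftS.
have h2 : ((1 - x) * qprod n (x * q) : C) @[n --> \oo] --> ((1 - x) * qpoch (x * q) q : C).
  by apply: cvgM; [exact: cvg_cst|exact: qprod_cvg].
apply: (cvg_unique (@norm_hausdorff _ C) h1) => /=.
by rewrite (_ : (fun n => _) = (fun n => (1 - x) * qprod n (x * q)))//;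
  apply/funext => n; rewrite qprodSl.
Qed.

Lemma qpoch_iter n x : qpoch x q = qprod n x * qpoch (x * q ^+ n) q.
Proof.
elim: n => [|n ih]; first by rewrite /qprod big_ord0 mul1r expr0 mulr1.
by rewrite ih qpochS qprodSr -!mulrA -exprSr.
Qed.

Lemma derivable_qprod n (x : C) : derivable (qprod n : C -> C) x 1.
Proof.
elim: n => [|n ih].
  rewrite (_ : qprod 0 = fun=> 1); first exact: derivable_cst.
  by apply/funext => y; rewrite /qprod big_ord0.
rewrite (_ : qprod n.+1 = fun y => qprod n y * (1 - y * q ^+ n)).
  apply: derivableM; first exact: ih.
  apply: derivableB; first exact: derivable_cst.
  by apply: derivableM; [exact: derivable_id|exact: derivable_cst].
by apply/funext => y; rewrite qprodSr.
Qed.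

Lemma derivable_qpoch (x : C) : derivable (fun x : C => qpoch x q : C) x 1.
Proof.
apply: (@derivable_lim R (fun n => qprod n : C -> C) _ x 1 (qbound (normc x + 1)) ltr01).
- by move=> n w _; exact: derivable_qprod.
- move=> n w hw; apply: qprod_bound; rewrite -(subrK x w) addrC.
  by apply: le_trans (normcD _ _) _; rewrite lerD2l.
- by move=> w _; exact: qprod_cvg.
Qed.

Lemma small_arith (K : realFieldType) (u v y a b : K) : 0 <= u -> u <= (1 - v) / 2 ->
  0 <= v -> 0 <= y -> y <= 1 -> 1 - 2^-1 * (1 - y) <= a -> 1 - u * y <= b ->
  1 - 2^-1 * (1 - v * y) <= a * b.
Proof.
move=> u0 uv v0 y0 y1 ha hb.
have w0 : 0 <= u * y by rewrite mulr_ge0.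
have w1 : u * y <= (1 - v) / 2 * y by rewrite ler_wpM2r.
have vy : 0 <= v * y by rewrite mulr_ge0.
have w2 : u * y <= 2^-1 by lra.
have wy : 0 <= (1 - y) * (u * y) by rewrite mulr_ge0// subr_ge0.
have p1 : 0 <= (a - (1 - 2^-1 * (1 - y))) * b by rewrite mulr_ge0//; lra.
have p2 : 0 <= (1 - 2^-1 * (1 - y)) * (b - (1 - u * y)) by rewrite mulr_ge0//; lra.
lra.
Qed.

(** For |x| <= (1 - |q|) / 2 the partial products stay above 1/2, by
    induction with the slack |q|^n / 2. *)
Lemma qpoch_small x : normc x <= (1 - normc q) / 2 -> 2^-1 <= normc (qpoch x q).
Proof.
move=> hx; have d0 : 0 < 1 - normc q by rewrite subr_gt0.
have h n : 1 - 2^-1 * (1 - normc q ^+ n) <= normc (qprod n x).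
  elim: n => [|n ih].
    by rewrite /qprod big_ord0 normc1 expr0 subrr mulr0 subr0.
  rewrite qprodSr normcM.
  have h1 : 1 - normc x * normc q ^+ n <= normc (1 - x * q ^+ n).
    rewrite -{1}normc1 -normcX -normcM; apply: le_trans (ler_norm _) _.
    exact: ler_dist_normc.
  have qn0 : 0 <= normc q ^+ n by rewrite exprn_ge0.
  have qn1 : normc q ^+ n <= 1 by rewrite exprn_ile1// ltW.
  rewrite exprS; apply: (@small_arith R (normc x) (normc q) (normc q ^+ n)) => //.
  exact: normc_ge0.
have hc := cvg_normc (@qprod_cvg x).
have {}hc : normc (qprod n x) @[n --> \oo] --> normc (qpoch x q) by exact: hc.
rewrite -(cvg_lim (@norm_hausdorff _ _) hc); apply: limr_ge; first exact: cvgP hc.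
apply: nearW => n; apply: le_trans (h n).
have : 0 <= normc q ^+ n by rewrite exprn_ge0.
lra.
Qed.

Lemma qpow_small (X e : R) : 0 < e -> exists n, forall x, normc x <= X -> normc (x * q ^+ n) <= e.
Proof.
move=> e0; have X1 : 0 < `|X| + 1 by rewrite ltr_wpDl.
have [|n hn] := @pow_lt_small R (normc q) (e / (`|X| + 1)) _ (divr_gt0 e0 X1).
  by rewrite q0.
exists n => x hx; rewrite normcM normcX.
move: hn; rewrite ltr_pdivlMr// => hn.
have : 0 <= normc q ^+ n by rewrite exprn_ge0.
have := ler_norm X; have := normc_ge0 x.
by move: (normc q ^+ n) hn => y; nra.
Qed.

(** Split off the finitely many factors with |x q^k| not small; the remaining
    product is bounded below by [qpoch_small]. *)
Lemma qpoch_lower (X sg : R) : 0 < sg -> exists2 e : R, 0 < e &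
  forall x, normc x <= X -> (forall k, sg <= normc (1 - x * q ^+ k)) ->
  e <= normc (qpoch x q).
Proof.
move=> sg0; have d0 : 0 < (1 - normc q) / 2 by rewrite divr_gt0// subr_gt0.
have [n hn] := qpow_small X d0.
exists (sg ^+ n * 2^-1); first by rewrite mulr_gt0// exprn_gt0.
move=> x xX hx; rewrite (qpoch_iter n) normcM; apply: ler_pM.
- by rewrite exprn_ge0// ltW.
- by rewrite invr_ge0.
- rewrite /qprod normc_prod -{1}(card_ord n) -prodr_const.
  by apply: ler_prod => i _; rewrite (ltW sg0) hx.
- by apply: qpoch_small; exact: hn.
Qed.

Lemma qpoch_neq0 x : (forall k, 1 - x * q ^+ k != 0) -> qpoch x q != 0.
Proof.
move=> hx; have d0 : 0 < (1 - normc q) / 2 by rewrite divr_gt0// subr_gt0.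
have [n hn] := qpow_small (normc x) d0.
rewrite (qpoch_iter n) mulf_neq0//; first by apply/prodf_neq0 => i _.
by rewrite -normc_gt0; apply: lt_le_trans (qpoch_small (hn _ (lexx _))); rewrite invr_gt0.
Qed.

Lemma qpoch_neq0_lt1 x : normc x < 1 -> qpoch x q != 0.
Proof.
move=> x1; apply: qpoch_neq0 => k; rewrite subr_eq0; apply/eqP => e.
have : normc (x * q ^+ k) < 1.
  rewrite normcM normcX; apply: le_lt_trans x1.
  by rewrite ler_piMr ?normc_ge0// exprn_ile1// ltW.
by rewrite -e normc1 ltxx.
Qed.

End QPochhammer.

(** * The contour functional and the shift of the contour *)

Section Scaling.
Variable R : realType.
Local Notation mu := (@lebesgue_measure R).

Lemma Rintegral_scale (h : R -> R) (c : R) : 0 < c ->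
  (forall x, c <= x -> {for x, continuous h}) ->
  \int[mu]_(x in `[c, +oo[) h x = \int[mu]_(x in `[1, +oo[) (h (c * x) * c).
Proof.
move=> c0 hc; pose F (x : R) := c * x.
have dF (x : R) : is_derive x 1 F c.
  by apply: is_derive_eq (is_deriveZ c (is_derive_id x 1)) _; rewrite /GRing.scale /= mulr1.
have F'E : F^`()%classic = fun=> c.
  by apply/funext => x; rewrite derive1E; have [] := dF x.
have cF (x : R) : {for x, continuous F}.
  by apply: derivR_cont; have [] := dF x.
have key (G : R -> R) : (forall x, c <= x -> {for x, continuous G}) ->
    (forall x, 0 <= G x) ->
    (\int[mu]_(x in `[c, +oo[) (G x)%:E)%E =
    (\int[mu]_(x in `[1%R, +oo[) (G (c * x) * c)%R%:E)%E.
  move=> cG G0; have F1 : F 1 = c by rewrite /F mulr1.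
  rewrite -{1}F1 (@increasing_ge0_integration_by_substitutiony R F G 1).
  - by apply: eq_integral => x _; rewrite F'E.
  - by move=> x y _ _; rewrite /F ltr_pM2l.
  - by rewrite F'E => x _; exact: cvg_cst.
  - by rewrite F'E; exact: is_cvg_cst.
  - by rewrite F'E; exact: is_cvg_cst.
  - split; first by move=> x _; have [] := dF x.
    by apply: cvg_at_right_filter; exact: cF.
  - apply/cvgryPge => A; exists (A / c); split; first exact: num_real.
    by move=> x /ltW; rewrite ler_pdivrMr// mulrC.
  - rewrite F1; apply: continuous_in_subspaceT => x; rewrite inE /= in_itv /= andbT.
    exact: cG.
  - by move=> x _; exact: G0.
rewrite /Rintegral; congr fine; rewrite [LHS]integralE [RHS]integralE.
have cp : (forall x, c <= x -> {for x, continuous (fun x => Num.max (h x) 0)}).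
  move=> x cx; apply: (@continuous_max _ _ h (fun=> 0)); first exact: hc.
  exact: cst_continuous.
have cn : (forall x, c <= x -> {for x, continuous (fun x => Num.max (- h x) 0)}).
  move=> x cx; apply: (@continuous_max _ _ (fun x => - h x) (fun=> 0)).
    by apply: continuousN; exact: hc.
  exact: cst_continuous.
have p0 (g : R -> R) x : 0 <= Num.max (g x) 0 by rewrite le_max lexx orbT.
congr (_ - _)%E.
  transitivity (\int[mu]_(x in `[c, +oo[) (Num.max (h x) 0)%:E)%E.
    by apply: eq_integral => x _; rewrite funeposE /= -EFin_max.
  rewrite (key _ cp (p0 h)); apply: eq_integral => x _; rewrite funeposE /= -EFin_max.
  by congr (_%:E); rewrite maxr_pMl ?mul0r// ltW.
transitivity (\int[mu]_(x in `[c, +oo[) (Num.max (- h x) 0)%:E)%E.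
  by apply: eq_integral => x _; rewrite funenegE /= -EFin_max.
rewrite (key _ cn (p0 (fun x => - h x))); apply: eq_integral => x _.
rewrite funenegE /= -EFin_max.
by congr (_%:E); rewrite maxr_pMl ?mul0r ?mulNr// ltW.
Qed.

Lemma cintegral_scale (h : R -> R[i]) (c : R) : 0 < c ->
  (forall x, c <= x -> {for x, continuous (h : R -> R[i]^o)}) ->
  cintegral `[c, +oo[ h = cintegral `[1, +oo[ (fun x => c%:C * h (c * x)).
Proof.
move=> c0 hc; rewrite /cintegral.
rewrite (@Rintegral_scale (fun x => complex.Re (h x)) c c0); last first.
  by move=> x /hc hx; exact: (cvg_Re hx).
rewrite (@Rintegral_scale (fun x => complex.Im (h x)) c c0); last first.
  by move=> x /hc hx; exact: (cvg_Im hx).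
congr (_ +i* _); apply: eq_Rintegral => x _; case: (h (c * x)) => a b /=; ring.
Qed.

End Scaling.

Section Contour.
Variable R : realType.
Local Notation C := (R[i]^o).
Local Notation mu := (@lebesgue_measure R).

(** The square root of e^(i t) on the principal branch. *)
Definition upt (t : R) : R[i] := cos (t / 2) +i* sin (t / 2).
(** Jump of f across the cut, with the factor of dz / z = dr / r. *)
Definition tailf (f : R[i] -> R[i]) (r : R) : R[i] :=
  (f (0 +i* Num.sqrt r) - f (0 +i* - Num.sqrt r)) * (r^-1)%:C.

(** The contour integral with an arbitrary function of u = z^(1/2) as integrand. *)
Definition cfun (N : nat) (f : R[i] -> R[i]) : R[i] :=
  (2 * pi)^-1%:C * cintegral `[- pi, pi] (fun t => f (upt t)) +
  (if odd N then (0 +i* (2 * pi))^-1 * cintegral `[1, +oo[ (tailf f) else 0).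

Definition contour_cintg (N : nat) (f : R[i] -> R[i]) :=
  cintg `[- pi, pi] (fun t => f (upt t)) /\ (odd N -> cintg `[1, +oo[ (tailf f)).

Lemma contour_integralE N q a : contour_integral N q a = cfun N (Phi N q a).
Proof.
by rewrite /contour_integral /cfun; case: odd; rewrite // addr0.
Qed.

Lemma tailfZ c f r : tailf (fun u => c * f u) r = c * tailf f r.
Proof. by rewrite /tailf; ring. Qed.

Lemma tailfD f g r : tailf (fun u => f u + g u) r = tailf f r + tailf g r.
Proof. by rewrite /tailf; ring. Qed.

Lemma admZ N c f : contour_cintg N f -> contour_cintg N (fun u => c * f u).
Proof.
move=> [f1 f2]; split; first exact: cintgZ.
move=> /f2 hf; apply: (@eq_cintg _ _ (fun r => c * tailf f r)) => //.
  by move=> r _; rewrite tailfZ.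
exact: cintgZ.
Qed.

Lemma admD N f g : contour_cintg N f -> contour_cintg N g -> contour_cintg N (fun u => f u + g u).
Proof.
move=> [f1 f2] [g1 g2]; split; first exact: cintgD.
move=> oN; apply: (@eq_cintg _ _ (fun r => tailf f r + tailf g r)) => //.
  by move=> r _; rewrite tailfD.
by apply: cintgD => //; [exact: f2|exact: g2].
Qed.

Lemma adm_eq N f g : (forall t, f (upt t) = g (upt t)) ->
  (odd N -> forall r, 1 <= r -> tailf f r = tailf g r) -> contour_cintg N f -> contour_cintg N g.
Proof.
move=> h1 h2 [f1 f2]; split.
  by apply: eq_cintg f1 => // t _; rewrite h1.
move=> oN; apply: eq_cintg (f2 oN) => // r; rewrite inE /= in_itv /= andbT; exact: h2.
Qed.

Lemma cfun_eq N f g : (forall t, f (upt t) = g (upt t)) ->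
  (odd N -> forall r, 1 <= r -> tailf f r = tailf g r) -> cfun N f = cfun N g.
Proof.
move=> h1 h2; rewrite /cfun; congr (_ * _ + _).
  by apply: eq_cintegral => t _; rewrite h1.
case: ifP => // oN; congr (_ * _); apply: eq_cintegral => r.
by rewrite inE /= in_itv /= andbT; exact: h2.
Qed.

Lemma cfunZ N c f : contour_cintg N f -> cfun N (fun u => c * f u) = c * cfun N f.
Proof.
move=> [f1 f2]; rewrite /cfun cintegralZ//; case: ifP => oN; last by ring.
rewrite (@eq_cintegral _ _ (tailf (fun u => c * f u)) (fun r => c * tailf f r)).
  by rewrite cintegralZ//; [ring|exact: f2].
by move=> r _; rewrite tailfZ.
Qed.

Lemma cfunD N f g : contour_cintg N f -> contour_cintg N g ->
  cfun N (fun u => f u + g u) = cfun N f + cfun N g.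
Proof.
move=> [f1 f2] [g1 g2]; rewrite /cfun cintegralD//; case: ifP => oN; last by ring.
rewrite (@eq_cintegral _ _ (tailf (fun u => f u + g u)) (fun r => tailf f r + tailf g r)).
  by rewrite cintegralD//; [ring|exact: f2|exact: g2].
by move=> r _; rewrite tailfD.
Qed.

Lemma adm0 N : contour_cintg N (fun=> 0).
Proof.
have h D : cintg D (fun _ : R => 0 : R[i]) by split; apply: (@integrable0 _ _ _ mu D).
split; first exact: h.
by move=> _; apply: eq_cintg (h _) => // r _; rewrite /tailf subrr mul0r.
Qed.

Lemma cfun0 N : cfun N (fun=> 0) = 0.
Proof.
have -> : (fun _ : R[i] => 0 : R[i]) = (fun u => 0 * (fun=> 0) u).
  by apply/funext => u; rewrite mul0r.
by rewrite cfunZ ?mul0r//; exact: adm0.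
Qed.

Lemma adm_sum N (I : Type) (s : seq I) (P : pred I) (f : I -> R[i] -> R[i]) :
  (forall i, P i -> contour_cintg N (f i)) -> contour_cintg N (fun u => \sum_(i <- s | P i) f i u).
Proof.
move=> h; elim: s => [|i s ih].
  rewrite (_ : (fun u => _) = fun=> 0); first exact: adm0.
  by apply/funext => u; rewrite big_nil.
case: (boolP (P i)) => Pi.
  rewrite (_ : (fun u => _) = (fun u => f i u + \sum_(j <- s | P j) f j u)).
    by apply: admD => //; exact: h.
  by apply/funext => u; rewrite big_cons Pi.
rewrite (_ : (fun u => _) = (fun u => \sum_(j <- s | P j) f j u))//.
by apply/funext => u; rewrite big_cons (negPf Pi).
Qed.

Lemma cfun_sum N (I : Type) (s : seq I) (P : pred I) (f : I -> R[i] -> R[i]) :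
  (forall i, P i -> contour_cintg N (f i)) ->
  cfun N (fun u => \sum_(i <- s | P i) f i u) = \sum_(i <- s | P i) cfun N (f i).
Proof.
move=> h; elim: s => [|i s ih].
  rewrite big_nil -[RHS](cfun0 N); congr (cfun N _).
  by apply/funext => u; rewrite big_nil.
rewrite big_cons; case: (boolP (P i)) => Pi.
  rewrite -ih -cfunD; [|exact: h|exact: adm_sum].
  by congr (cfun N _); apply/funext => u; rewrite big_cons Pi.
rewrite -ih; congr (cfun N _).
by apply/funext => u; rewrite big_cons (negPf Pi).
Qed.

Lemma halfC : 2^-1 = (2^-1)%:C :> R[i].
Proof. by rewrite fmorphV rmorph_nat. Qed.

Lemma uptE t : upt t = cis (2^-1 * t).
Proof. by rewrite /upt /cis mulrC. Qed.

Lemma cis_pihalf : cis (2^-1 * pi) = 0 +i* 1 :> R[i].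
Proof. by rewrite mulrC /cis cos_pihalf sin_pihalf. Qed.

Lemma cis_Npihalf : cis (2^-1 * - pi) = 0 +i* (- 1) :> R[i].
Proof. by rewrite mulrN mulrC /cis cosN sinN cos_pihalf sin_pihalf. Qed.

Lemma tailf_cont (f : C -> C) (r : R) : 0 < r ->
  derivable f (0 +i* Num.sqrt r) 1 -> derivable f (0 +i* - Num.sqrt r) 1 ->
  {for r, continuous (tailf f : R -> C)}.
Proof.
move=> r0 d1 d2.
have dr : cder1 (fun r => (Num.sqrt r)%:C) r ((2 * Num.sqrt r)^-1)%:C.
  by split => /=; [exact: is_derive1_sqrt|exact: is_derive_cst].
have ci (k : R) (p : R -> C) : (forall x, p x = (0 +i* k) * (Num.sqrt x)%:C) ->
    {for r, continuous p}.
  move=> hp; rewrite (_ : p = (fun r => (0 +i* k) * (Num.sqrt r)%:C)).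
    by apply: contCM; [exact: contC_cst|exact: (cder1_cont dr)].
  exact/funext.
have ek (k x : R) : 0 +i* (k * Num.sqrt x) = (0 +i* k) * (Num.sqrt x)%:C.
  by apply/eqP; rewrite eq_complex /=; apply/andP; split; apply/eqP; ring.
rewrite /tailf; apply: contCM.
  apply: contCB.
    apply: (@contC_comp _ _ f (fun r => 0 +i* Num.sqrt r)); last exact: derivC_cont.
    by apply: (ci 1) => x; rewrite -ek mul1r.
  apply: (@contC_comp _ _ f (fun r => 0 +i* - Num.sqrt r)); last exact: derivC_cont.
  by apply: (ci (-1)) => x; rewrite -ek mulN1r.
have -> : (fun r => (r^-1)%:C : C) = (fun r => (r%:C)^-1).
  by apply/funext => x; rewrite fmorphV.
apply: contCV; first by rewrite eq_complex /= eqxx andbT gt_eqF.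
by apply: (@cder1_cont _ _ _ 1); split => /=; [exact: is_derive_id|exact: is_derive_cst].
Qed.

Variables (N : nat) (q sg : R[i]) (f : C -> C).
Hypothesis sgq : sg ^+ 2 = q.
Hypothesis q0 : q != 0.
Hypothesis q1 : normc q < 1.
Hypothesis sg_odd : odd N -> exists2 s : R, 0 < s & sg = s%:C.
Hypothesis fd : forall u : C, normc q <= normc u ^+ 2 <= 1 -> derivable f u 1.
Hypothesis f_even : ~~ odd N -> forall u, f (- u) = f u.

Let rho := normc q.
Let rho0 : 0 < rho. Proof. by rewrite normc_gt0. Qed.

Let M (c : R[i]) := cintegral `[- pi, pi] (fun t => f (c * upt t)).

(** Goursat's theorem on the half annulus between |u| = sqrt |q| and |u| = 1 with
    Re u >= 0: its two straight sides are the piece of the tail between rho and 1. *)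
Lemma half_circle_radial :
  M 1 - M (Num.sqrt rho)%:C = (0 +i* 1)^-1 * cintegral `[rho, 1] (tailf f).
Proof.
have pi0 : - pi <= pi :> R by rewrite lerNl -subr_ge0 opprK addr_ge0// pi_ge0.
have s0 : 0 < Num.sqrt rho by rewrite sqrtr_gt0.
pose g (u : C) : C := f u / u.
pose z (r t : R) : R[i] := (Num.sqrt r)%:C * cis (2^-1 * t).
pose zs (r t : R) : R[i] := ((2 * Num.sqrt r)^-1)%:C * cis (2^-1 * t).
pose zt (r t : R) : R[i] := (Num.sqrt r)%:C * ((0 +i* 2^-1) * cis (2^-1 * t)).
have sqr_gt0 r : rho <= r -> 0 < Num.sqrt r.
  by move=> h; rewrite sqrtr_gt0 (lt_le_trans rho0).
have ds (r t : R) : rho <= r -> cder1 (fun r => z r t) r (zs r t).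
  move=> hr; have dr : cder1 (fun r => (Num.sqrt r)%:C) r ((2 * Num.sqrt r)^-1)%:C.
    split => /=; last exact: is_derive_cst.
    by apply: is_derive1_sqrt; exact: lt_le_trans hr.
  by apply: cder1_eq (cder1M dr (cder1_cst _ _)) _; rewrite mulr0 addr0.
have dt (r t : R) : cder1 (fun t => z r t) t (zt r t).
  by apply: cder1_eq (cder1M (cder1_cst _ _) (cder1_cisl _ _)) _; rewrite mul0r add0r.
have nz r t : 0 <= r -> normc (z r t) ^+ 2 = r.
  by move=> r0; rewrite /z normcM normc_cis mulr1 normc_real real_normK ?num_real// sqr_sqrtr.
have z0 r t : rho <= r -> z r t != 0.
  move=> hr; rewrite /z mulf_neq0 ?cis_neq0//.
  by rewrite eq_complex /= eqxx andbT gt_eqF// sqr_gt0.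
have dg r t : rho <= r <= 1 -> derivable g (z r t) 1.
  move=> /andP[h1 h2]; apply: derivableM; last first.
    by apply: derivableV; [exact: z0|exact: derivable_id].
  by apply: fd; rewrite nz ?h1//; exact: le_trans (ltW rho0) h1.
have G : cintegral `[- pi, pi] (fun t => g (z 1 t) * zt 1 t) -
      cintegral `[- pi, pi] (fun t => g (z rho t) * zt rho t) =
      cintegral `[rho, 1] (fun r => g (z r pi) * zs r pi) -
      cintegral `[rho, 1] (fun r => g (z r (- pi)) * zs r (- pi)).
  apply: (@goursat R z zs zt rho 1 (- pi) pi ((2 * Num.sqrt rho)^-1 + 1)) => //.
  - by move=> r t /andP[h _] _; exact: ds.
  - move=> r t /andP[h _] _.
    have dr : cder1 (fun r => (Num.sqrt r)%:C) r ((2 * Num.sqrt r)^-1)%:C.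
      split => /=; last exact: is_derive_cst.
      by apply: is_derive1_sqrt; exact: lt_le_trans h.
    have -> : (fun s => zs s t : C) =
        (fun s => (2 * (Num.sqrt s)%:C)^-1 * cis (2^-1 * t) : C).
      apply/funext => s; rewrite /zs; congr (_ * _).
      by rewrite fmorphV rmorphM rmorph_nat.
    apply: contCM; last exact: contC_cst.
    apply: contCV.
      rewrite mulf_neq0 ?pnatr_eq0// eq_complex /= eqxx andbT gt_eqF//.
      exact: sqr_gt0.
    by apply: contCM; [exact: contC_cst|exact: (cder1_cont dr)].
  - move=> r t _ _; apply: contCM; first exact: contC_cst.
    by apply: contCM; [exact: contC_cst|exact: contC_cis].
  - move=> r t /andP[h1 h2] _; rewrite normcM normc_cis mulr1 normc_real ger0_norm; last first.
      by rewrite invr_ge0 mulr_ge0// sqrtr_ge0.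
    rewrite -[leLHS]addr0 lerD// lef_pV2 ?posrE ?mulr_gt0 ?sqr_gt0//.
    by rewrite ler_pM2l// ler_wsqrtr.
  - move=> r t /andP[h1 h2] _; rewrite 2!normcM normc_cis normc_i normc_real !ger0_norm ?sqrtr_ge0//.
    rewrite -[leLHS]add0r lerD ?invr_ge0 ?mulr_ge0 ?sqrtr_ge0//.
    have : Num.sqrt r <= 1 by rewrite -[leRHS]sqrtr1 ler_wsqrtr.
    by have := sqrtr_ge0 r; lra.
  - by move=> r t h _; exact: dg.
  - exact: ltW.
have E1 r : rho <= r -> (fun t => g (z r t) * zt r t) =
    (fun t => (0 +i* 2^-1) * f ((Num.sqrt r)%:C * upt t)).
  move=> hr; apply/funext => t; rewrite uptE -/(z r t).
  rewrite -[f (z r t)](divfK (z0 r t hr)) -/(g (z r t)) [LHS]mulrCA /zt.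
  by rewrite [z r t in RHS]/z; ring.
have cM r : rho <= r <= 1 -> cintg `[- pi, pi] (fun t => f ((Num.sqrt r)%:C * upt t)).
  move=> /andP[h1 h2]; apply: cont_cintg => t _.
  have -> : (fun t => f ((Num.sqrt r)%:C * upt t) : C) = (fun t => f (z r t)).
    by apply/funext => x; rewrite uptE.
  apply: (@contC_comp _ _ f (fun t => z r t)); first exact: (cder1_cont (dt r t)).
  by apply: derivC_cont; apply: fd; rewrite nz ?h1//; exact: le_trans (ltW rho0) h1.
have E2 : cintegral `[rho, 1] (fun r => g (z r pi) * zs r pi) -
    cintegral `[rho, 1] (fun r => g (z r (- pi)) * zs r (- pi)) =
    2^-1 * cintegral `[rho, 1] (tailf f).
  have zp r : z r pi = 0 +i* Num.sqrt r.
    rewrite /z cis_pihalf; apply/eqP; rewrite eq_complex /=.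
    by apply/andP; split; apply/eqP; ring.
  have zm r : z r (- pi) = 0 +i* - Num.sqrt r.
    rewrite /z cis_Npihalf; apply/eqP; rewrite eq_complex /=.
    by apply/andP; split; apply/eqP; ring.
  have cz (t r : R) : rho <= r <= 1 -> {for r, continuous (fun r => g (z r t) * zs r t : C)}.
    move=> hr; have /andP[h1 h2] := hr; apply: contCM.
      apply: (@contC_comp _ _ g (fun r => z r t)); first exact: (cder1_cont (ds r t h1)).
      by apply: derivC_cont; exact: dg.
    have dr : cder1 (fun r => (Num.sqrt r)%:C) r ((2 * Num.sqrt r)^-1)%:C.
      split => /=; last exact: is_derive_cst.
      by apply: is_derive1_sqrt; exact: lt_le_trans h1.
    have -> : (fun s => zs s t : C) =
        (fun s => (2 * (Num.sqrt s)%:C)^-1 * cis (2^-1 * t) : C).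
      apply/funext => s; rewrite /zs; congr (_ * _).
      by rewrite fmorphV rmorphM rmorph_nat.
    apply: contCM; last exact: contC_cst.
    apply: contCV.
      rewrite mulf_neq0 ?pnatr_eq0// eq_complex /= eqxx andbT gt_eqF//.
      exact: sqr_gt0.
    by apply: contCM; [exact: contC_cst|exact: (cder1_cont dr)].
  have ez t r : rho <= r -> g (z r t) * zs r t = 2^-1 * (f (z r t) * (r^-1)%:C).
    move=> h; rewrite /g -mulrA [RHS]mulrCA; congr (_ * _).
    rewrite /z /zs; have sr := sqr_gt0 r h.
    have r0 : 0 < r by exact: lt_le_trans h.
    have e1 : (Num.sqrt r)^-1 * (2 * Num.sqrt r)^-1 = 2^-1 * r^-1.
      by rewrite invfM mulrCA -invfM -expr2 sqr_sqrtr// ltW.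
    rewrite invfM mulrACA mulVf ?cis_neq0// mulr1 halfC -fmorphV.
    by rewrite -[LHS]rmorphM -[RHS]rmorphM e1.
  rewrite -cintegralB//; last 2 first.
  - by apply: cont_cintg => r hr; exact: cz.
  - by apply: cont_cintg => r hr; exact: cz.
  rewrite -cintegralZ//; last first.
    apply: (@eq_cintg _ _ (fun r => 2 * (g (z r pi) * zs r pi - g (z r (- pi)) * zs r (- pi)))) => //.
      move=> r; rewrite inE /= in_itv /= => /andP[h1 h2]; rewrite !ez// zp zm /tailf -mulrBr.
      by rewrite mulrA mulfV ?pnatr_eq0// mul1r mulrBl.
    by apply: cintgZ => //; apply: cintgB => //; apply: cont_cintg => r hr; exact: cz.
  apply: eq_cintegral => r; rewrite inE /= in_itv /= => /andP[h1 h2].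
  by rewrite !ez// zp zm /tailf -mulrBr mulrBl.
move: G; rewrite E2 !E1// ?(ltW q1)// !cintegralZ//; last 2 first.
- by apply: cM; rewrite lexx ltW.
- by apply: cM; rewrite lexx andbT ltW.
rewrite -mulrBr sqrtr1 => G.
have i2 : (0 +i* 2^-1 : R[i]) != 0 by rewrite eq_complex /= eqxx /= invr_eq0 pnatr_eq0.
apply: (mulfI i2); rewrite /M -[1 in X in X - _](rmorph1 (real_complex R)) G mulrA.
congr (_ * _); have -> : (0 +i* 2^-1 : R[i]) = 2^-1 * (0 +i* 1).
  by rewrite halfC; apply/eqP; rewrite eq_complex /=; apply/andP; split; apply/eqP; ring.
by rewrite mulfK// eq_complex /= eqxx /= oner_eq0.
Qed.

Lemma polar (w : R[i]) : normc w = 1 -> exists2 t : R, 0 <= t & w = cis t.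
Proof.
case: w => x y nxy; have xy : x ^+ 2 + y ^+ 2 = 1.
  have := congr1 (fun r => r ^+ 2) nxy; rewrite /normc sqr_sqrtr ?expr1n//.
  by rewrite addr_ge0// sqr_ge0.
have x1 : -1 <= x <= 1.
  rewrite -ler_norml -(@ler_pXn2r _ 2)// ?nnegrE// expr1n real_normK ?num_real//.
  by rewrite -xy lerDl sqr_ge0.
have sx : sin (acos x) = `|y|.
  by rewrite sin_acos// -xy addrC addKr sqrtr_sqr.
have cx : cos (acos x) = x by rewrite acosK// in_itv.
have [y0|y0] := leP 0 y.
  by exists (acos x); [exact: acos_ge0|rewrite /cis cx sx ger0_norm].
exists (pi *+ 2 - acos x).
  by rewrite subr_ge0 (le_trans (acos_lepi x1))// mulr2n lerDl pi_ge0.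
rewrite /cis cosB sinB cos2pi sin2pi !mul1r !mul0r addr0 sub0r cx sx.
by rewrite ltr0_norm// opprK.
Qed.

(** For N even, f is a function of z, so that turning u by a fixed angle does
    not change its integral over the half circle. *)
Lemma half_circle_rotation : ~~ odd N -> M (Num.sqrt rho)%:C = M sg.
Proof.
move=> evN; have pi0 : - pi <= pi :> R by rewrite lerNl -subr_ge0 opprK addr_ge0// pi_ge0.
set s0 := Num.sqrt rho; have s00 : 0 < s0 by rewrite sqrtr_gt0.
have sc0 : s0%:C != 0 :> R[i] by rewrite eq_complex /= eqxx andbT gt_eqF.
have nsg : normc sg = s0.
  have : normc sg ^+ 2 = rho by rewrite -normcX sgq.
  by move=> /(congr1 Num.sqrt); rewrite sqrtr_sqr ger0_norm// normc_ge0.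
have [|tau tau0 htau] := @polar (sg / s0%:C).
  by rewrite normcM normcV nsg normc_real gtr0_norm// divff// gt_eqF.
have sgE : sg = s0%:C * cis tau by rewrite -htau mulrC divfK.
pose g (u : C) : C := f u / u.
pose z (s t : R) : R[i] := s0%:C * cis (2^-1 * t + s).
pose zs (s t : R) : R[i] := s0%:C * ((0 +i* 1) * cis (1 * s + 2^-1 * t)).
pose zt (s t : R) : R[i] := s0%:C * ((0 +i* 2^-1) * cis (2^-1 * t + s)).
have nz s t : normc (z s t) = s0 by rewrite /z normcM normc_cis mulr1 normc_real gtr0_norm.
have zE s t : z s t = s0%:C * cis (1 * s + 2^-1 * t) by rewrite /z mul1r addrC.
have ds (s t : R) : cder1 (fun s => z s t) s (zs s t).
  rewrite (_ : (fun s => z s t) = fun s => s0%:C * cis (1 * s + 2^-1 * t)).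
    by apply: cder1_eq (cder1M (cder1_cst _ _) (cder1_cis _ _ _)) _; rewrite mul0r add0r.
  by apply/funext => x; rewrite zE.
have dt (s t : R) : cder1 (fun t => z s t) t (zt s t).
  by apply: cder1_eq (cder1M (cder1_cst _ _) (cder1_cis _ _ _)) _; rewrite mul0r add0r.
have z0 s t : z s t != 0 by rewrite mulf_neq0 ?cis_neq0.
have fdz s t : derivable f (z s t) 1.
  by apply: fd; rewrite nz sqr_sqrtr ?(ltW rho0)// lexx ltW.
have dg s t : derivable g (z s t) 1.
  apply: derivableM; first exact: fdz.
  by apply: derivableV; [exact: z0|exact: derivable_id].
have G : cintegral `[- pi, pi] (fun t => g (z tau t) * zt tau t) -
      cintegral `[- pi, pi] (fun t => g (z 0 t) * zt 0 t) =
      cintegral `[0, tau] (fun s => g (z s pi) * zs s pi) -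
      cintegral `[0, tau] (fun s => g (z s (- pi)) * zs s (- pi)).
  apply: (@goursat R z zs zt 0 tau (- pi) pi s0
    (fun s t _ _ => ds s t) (fun s t _ _ => dt s t) _ _ _ _ g _ tau0 pi0).
  - move=> s t _ _; apply: contCM; first exact: contC_cst.
    apply: contCM; first exact: contC_cst.
    exact: (cder1_cont (cder1_cis _ _ _)).
  - move=> s t _ _; apply: contCM; first exact: contC_cst.
    apply: contCM; first exact: contC_cst.
    exact: (cder1_cont (cder1_cis _ _ _)).
  - move=> s t _ _; rewrite 2!normcM normc_cis normc_i normc_real normr1 !mulr1.
    by rewrite gtr0_norm.
  - move=> s t _ _; rewrite 2!normcM normc_cis normc_i normc_real mulr1.
    by rewrite !gtr0_norm ?invr_gt0// ler_piMr ?(ltW s00)// invf_le1// ler1n.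
  - by move=> s t _ _; exact: dg.
have E1 s : (fun t => g (z s t) * zt s t) =
    (fun t => (0 +i* 2^-1) * f (s0%:C * cis s * upt t)).
  apply/funext => t; rewrite uptE; have -> : s0%:C * cis s * cis (2^-1 * t) = z s t.
    by rewrite /z cisD [cis (_ * _) * _]mulrC mulrA.
  rewrite -[in RHS](divfK (z0 s t) (f (z s t))) -/(g (z s t)) /zt.
  by rewrite [in RHS]/z; ring.
have cM s : cintg `[- pi, pi] (fun t => f (s0%:C * cis s * upt t)).
  apply: cont_cintg => t _.
  have -> : (fun t => f (s0%:C * cis s * upt t) : C) = (fun t => f (z s t)).
    by apply/funext => x; rewrite uptE /z cisD [cis (_ * x) * _]mulrC mulrA.
  apply: (@contC_comp _ _ f (fun t => z s t)); first exact: (cder1_cont (dt s t)).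
  by apply: derivC_cont; exact: fdz.
have zpi s : z s pi = - z s (- pi).
  rewrite /z !cisD cis_pihalf cis_Npihalf -mulrN -mulNr; congr (_ * (_ * _)).
  by apply/eqP; rewrite eq_complex /= oppr0 opprK !eqxx.
have E2 : (fun s => g (z s pi) * zs s pi) = (fun s => g (z s (- pi)) * zs s (- pi)).
  apply/funext => s; have e t : zs s t = (0 +i* 1) * z s t.
    by rewrite zE /zs mulrCA.
  rewrite !e [LHS]mulrCA [RHS]mulrCA; congr (_ * _).
  by rewrite /g !divfK// zpi f_even.
move: G; rewrite E2 subrr !E1 !cintegralZ// -mulrBr cis0 mulr1 -sgE => /eqP.
rewrite mulf_eq0 subr_eq0 eq_complex /= eqxx /= invr_eq0 pnatr_eq0 /= => /eqP h.
by rewrite /M h.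
Qed.

Hypothesis ftail : odd N -> forall r, 1 <= r ->
  derivable f (0 +i* Num.sqrt r) 1 /\ derivable f (0 +i* - Num.sqrt r) 1.

(** By scaling, the integral of f (sg u) is that of f over the image of the
    contour, and f is holomorphic between the two. *)
Lemma cfun_shift : (odd N -> cintg `[1, +oo[ (tailf f)) ->
  cfun N f = cfun N (fun u => f (sg * u)).
Proof.
move=> itail; rewrite /cfun.
have -> : cintegral `[- pi, pi] (fun t => f (upt t)) = M 1.
  by apply: eq_cintegral => t _; rewrite mul1r.
rewrite -/(M sg); have HR := half_circle_radial.
have [oN|evN] := boolP (odd N); last first.
  congr (_ * _ + _); rewrite -half_circle_rotation//.
  apply/eqP; rewrite -subr_eq0 HR mulf_eq0; apply/orP; right.
  rewrite (@eq_cintegral _ _ _ (fun=> 0)).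
    by rewrite /cintegral /= /Rintegral integral0 /=.
  move=> r _; rewrite /tailf (_ : 0 +i* - Num.sqrt r = - (0 +i* Num.sqrt r)).
    by rewrite f_even// subrr mul0r.
  by apply/eqP; rewrite eq_complex /= oppr0 !eqxx.
have [s s0 sE] := sg_odd oN.
have sq : s = Num.sqrt rho.
  have : normc sg ^+ 2 = rho by rewrite -normcX sgq.
  rewrite sE normc_real gtr0_norm// => /(congr1 Num.sqrt).
  by rewrite sqrtr_sqr gtr0_norm.
have s2 : s ^+ 2 = rho by rewrite sq sqr_sqrtr// ltW.
rewrite sE -sq in HR *; rewrite -/(M s%:C).
have cont (r : R) : rho <= r -> {for r, continuous (tailf f : R -> C)}.
  move=> hr; have r0 : 0 < r by exact: lt_le_trans hr.
  have [d1 d2] : derivable f (0 +i* Num.sqrt r) 1 /\ derivable f (0 +i* - Num.sqrt r) 1.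
    have [r1|r1] := leP r 1; last by apply: ftail => //; exact: ltW.
    by split; apply: fd; rewrite normc_i ?normrN real_normK ?num_real// sqr_sqrtr ?(ltW r0)// r1 andbT;
      exact: hr.
  exact: tailf_cont.
have split_tail : cintegral `[rho, +oo[ (tailf f) =
    cintegral `[rho, 1] (tailf f) + cintegral `[1, +oo[ (tailf f).
  have seg : cintg `[rho, 1] (tailf f).
    by apply: cont_cintg => r /andP[h _]; exact: cont.
  have [i1 i2] := seg; have [j1 j2] := itail oN.
  have U : `[rho, +oo[%classic = `[rho, 1[%classic `|` `[1, +oo[%classic :> set R.
    apply/seteqP; split => x /=; rewrite !in_itv /= ?andbT.
      by move=> h; case: (ltP x 1) => h2; [left; rewrite h|right].
    by move=> [/andP[]//|h]; rewrite (le_trans _ h)// ltW.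
  have UD : [disjoint (`[rho, 1[%classic : set R) & `[1, +oo[%classic].
    apply/disj_setPS => x [/=]; rewrite !in_itv /= andbT => /andP[_ h1] h2.
    by move: (lt_le_trans h1 h2); rewrite ltxx.
  have key (h : R -> R) : mu.-integrable `[rho, 1] (EFin \o h) ->
      mu.-integrable `[1, +oo[ (EFin \o h) ->
      \int[mu]_(x in `[rho, +oo[) h x =
      \int[mu]_(x in `[rho, 1]) h x + \int[mu]_(x in `[1, +oo[) h x.
    move=> h1 h2; have h3 : mu.-integrable `[rho, +oo[ (EFin \o h).
      have h1' : mu.-integrable `[rho, 1[ (EFin \o h).
        by apply: integrableS h1 => //; exact: subset_itv_co_cc.
      apply/integrableP; split.
        rewrite U; apply/measurable_funU => //.
        by split; [exact: measurable_int h1'|exact: measurable_int h2].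
      rewrite U ge0_integral_setU//; last first.
        apply/measurable_funU => //.
        by split; [exact: (measurable_int _ (integrable_abse h1'))|
          exact: (measurable_int _ (integrable_abse h2))].
      by apply: lte_add_pinfty; [case/integrableP: h1'|case/integrableP: h2].
    have := @Rintegral_itvB R h (BLeft rho) +oo%O 1 h3.
    rewrite !bnd_simp => /(_ (ltW q1) isT) e.
    rewrite Rintegral_itv_obnd_cbnd in e; first by rewrite -e addrC subrK.
    apply: integrableS h3 => //; apply: subset_itvr; rewrite bnd_simp.
    exact: ltW.
  by rewrite /cintegral !key.
have scale : cintegral `[1, +oo[ (tailf (fun u => f (s%:C * u))) =
    cintegral `[rho, +oo[ (tailf f).
  rewrite (cintegral_scale rho0 cont); apply: eq_cintegral => r.
  rewrite inE /= in_itv /= andbT => r1; rewrite /tailf.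
  have sr : Num.sqrt (rho * r) = s * Num.sqrt r by rewrite sqrtrM ?(ltW rho0)// -sq.
  have -> : s%:C * (0 +i* Num.sqrt r) = 0 +i* Num.sqrt (rho * r).
    rewrite sr; apply/eqP; rewrite eq_complex /=.
    by apply/andP; split; apply/eqP; ring.
  have -> : s%:C * (0 +i* - Num.sqrt r) = 0 +i* - Num.sqrt (rho * r).
    rewrite sr; apply/eqP; rewrite eq_complex /=.
    by apply/andP; split; apply/eqP; ring.
  rewrite mulrCA -rmorphM; congr (_ * _%:C).
  by rewrite invfM mulrA mulfV ?mul1r// gt_eqF.
have M1 : M 1 = M s%:C + (0 +i* 1)^-1 * cintegral `[rho, 1] (tailf f).
  by rewrite -HR addrC subrK.
have BE : (0 +i* (2 * pi))^-1 = (2 * pi)^-1%:C * (0 +i* 1)^-1 :> R[i].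
  rewrite fmorphV -invfM; congr (_^-1).
  by apply/eqP; rewrite eq_complex /=; apply/andP; split; apply/eqP; ring.
by rewrite scale split_tail M1 BE; ring.
Qed.

End Contour.

(** * Integrands that agree almost everywhere *)

Section AlmostEverywhere.
Variable R : realType.
Local Notation mu := (@lebesgue_measure R).
Implicit Types (D B : set (measurableTypeR R)).

Lemma integrable_off_countable D B (h k : measurableTypeR R -> R) : measurable D -> countable B ->
  (forall x, D x -> ~ B x -> h x = k x) -> mu.-integrable D (EFin \o k) ->
  mu.-integrable D (EFin \o h) /\
  \int[mu]_(x in D) h x = \int[mu]_(x in D) k x.
Proof.
move=> mD cB hk ik.
have mC (A : set (measurableTypeR R)) : countable A -> measurable A.
  by move=> cA; apply: countable_measurable.
have mB := mC _ cB; have mk := measurable_int _ ik.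
have DU : D = (D `\` B) `|` (D `&` B) by rewrite setDE -setIUr setUC setUCr setIT.
have mh : measurable_fun D h.
  rewrite DU; apply/measurable_funU; [exact: measurableD|exact: measurableI|split].
    apply: (@eq_measurable_fun _ _ _ _ (D `\` B) k).
      by move=> x; rewrite inE => -[Dx Bx] /=; rewrite hk.
    have mk' := (measurable_EFinP _ _).1 mk.
    by apply: measurable_funS mk' => // x [].
  move=> _ Y mY; apply: mC; apply: sub_countable cB; apply: subset_card_le.
  by move=> x [[]].
have {}mh := (measurable_EFinP _ _).2 mh.
have ae : ae_eq mu D (EFin \o h) (EFin \o k).
  exists B; split => //; first exact: countable_lebesgue_measure0.
  move=> x /= H; apply: contrapT => Bx; apply: H => Dx.
  by rewrite hk.
split; last by rewrite /Rintegral; congr fine; apply: ae_eq_integral.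
apply/integrableP; split => //; case/integrableP: ik => _; apply: le_lt_trans.
rewrite le_eqVlt; apply/orP; left; apply/eqP; apply: ae_eq_integral => //.
- exact: measurableT_comp.
- exact: measurableT_comp.
- exact: ae_eq_abse.
Qed.

Lemma cintg_off_countable D B (f g : R -> R[i]) : measurable D -> countable B ->
  (forall x, D x -> ~ B x -> f x = g x) -> cintg D g ->
  cintg D f /\ cintegral D f = cintegral D g.
Proof.
move=> mD cB fg [g1 g2].
have [f1 e1] := @integrable_off_countable D B (fun x => complex.Re (f x))
  (fun x => complex.Re (g x)) mD cB (fun x Dx Bx => congr1 _ (fg x Dx Bx)) g1.
have [f2 e2] := @integrable_off_countable D B (fun x => complex.Im (f x))
  (fun x => complex.Im (g x)) mD cB (fun x Dx Bx => congr1 _ (fg x Dx Bx)) g2.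
by split; [split|rewrite /cintegral e1 e2].
Qed.

(** Angles t with (e^(i t / 2))^n = 1 are determined by that root of unity. *)
Lemma countable_unity_roots n : (0 < n)%N ->
  countable [set t : R | - pi <= t <= pi /\ upt t ^+ n = 1].
Proof.
move=> n0; have [rs hrs] := closed_field_poly_normal ('X^n - 1 : {poly R[i]}).
have lc : lead_coef ('X^n - 1 : {poly R[i]}) = 1.
  by rewrite (monicP _)//; exact: monic_Xn_sub_1.
apply: finite_set_countable.
apply: (@sub_finite_set _ _ ((fun u : R[i] => 2 * asin (complex.Im u)) @` [set` rs])).
  move=> t [/= tpi ut]; exists (upt t) => /=.
    have : root ('X^n - 1 : {poly R[i]}) (upt t) by rewrite rootE !hornerE ut subrr.
    by rewrite hrs lc scale1r root_prod_XsubC.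
  rewrite /upt /= sinK; first by rewrite mulrCA mulfV ?mulr1// pnatr_eq0.
  rewrite in_itv /= -mulNr !ler_pM2r ?invr_gt0//.
by apply: finite_image; exact: finite_seq.
Qed.

Lemma cfun_ae N n (f g : R[i] -> R[i]) : (0 < n)%N ->
  (forall t, - pi <= t <= pi -> upt t ^+ n != 1 -> f (upt t) = g (upt t)) ->
  (odd N -> forall r, 1 <= r -> tailf f r = tailf g r) ->
  contour_cintg N g -> contour_cintg N f /\ cfun N f = cfun N g.
Proof.
move=> n0 h1 h2 [g1 g2].
have mI : measurable (`[- pi, pi]%classic : set (measurableTypeR R)) by [].
have h (t : R) : (`[- pi, pi]%classic : set R) t ->
    ~ [set t : R | - pi <= t <= pi /\ upt t ^+ n = 1] t -> f (upt t) = g (upt t).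
  rewrite /= in_itv /= => ht Bt; apply: h1 => //.
  by apply/eqP => e; apply: Bt.
have [f1 e1] := cintg_off_countable mI (countable_unity_roots n0) h g1.
have e r : r \in (`[1, +oo[%classic : set R) -> (odd N -> tailf f r = tailf g r).
  by rewrite inE /= in_itv /= andbT => r1 oN; exact: h2.
split; first by split => // oN; apply: eq_cintg (g2 oN) => // r hr; rewrite e.
rewrite /cfun e1; congr (_ + _); case: ifP => // oN; congr (_ * _).
by apply: eq_cintegral => r hr; rewrite e.
Qed.

End AlmostEverywhere.

(** * Power decay along the tail *)

Section Decay.
Variable R : realType.
Local Notation C := (R[i]^o).
Local Notation mu := (@lebesgue_measure R).

Lemma integrable_powR_tail (d : R) : 0 < d ->
  mu.-integrable `[1, +oo[ (EFin \o (fun r : R => r `^ (- d) * r^-1)).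
Proof.
move=> d0; pose F (r : R) := (- d^-1) * r `^ (- d).
pose f (r : R) := r `^ (- d - 1).
have dF (r : R) : 0 < r -> is_derive r 1 F (f r).
  move=> r0; apply: is_derive_eq (is_deriveZ (- d^-1) (is_derive1_powR (- d) r0)) _.
  by rewrite /GRing.scale /= mulrA mulrNN mulVf ?mul1r// gt_eqF.
have cf (r : R) : 0 < r -> {for r, continuous f}.
  by move=> r0; apply: derivR_cont; have [] := is_derive1_powR (- d - 1) r0.
have cf' : {within `[1, +oo[, continuous f}.
  apply: continuous_in_subspaceT => r; rewrite inE /= in_itv /= andbT => r1.
  by apply: cf; lra.
have f0 r : 0 <= f r by exact: powR_ge0.
have E : (\int[mu]_(x in `[1%R, +oo[) (f x)%:E = 0%:E - (F 1%R)%:E)%E.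
  apply: ge0_continuous_FTC2y => //.
  - rewrite -(mulr0 (- d^-1)); apply: cvgM; first exact: cvg_cst.
    apply/cvgrPdist_lt => e e0; pose X := e `^ (- d^-1).
    exists X; split; first exact: num_real.
    move=> r rX; have X0 : 0 < X by exact: powR_gt0.
    have r0 : 0 < r by lra.
    rewrite sub0r normrN ger0_norm ?powR_ge0// powRN.
    rewrite invf_plt ?posrE ?powR_gt0//.
    have -> : e^-1 = X `^ d.
      rewrite /X -powRrM mulNr mulVf ?gt_eqF// powR_inv1//; exact: ltW.
    by apply: gt0_ltr_powR => //; rewrite nnegrE ltW.
  - by move=> r r1; have [] : is_derive r 1 F (f r) by apply: dF; lra.
  - apply: cvg_at_right_filter; apply: derivR_cont.
    by have [] := dF 1 ltr01.
  - move=> r; rewrite in_itv /= andbT => r1; rewrite derive1E.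
    by have [] : is_derive r 1 F (f r) by apply: dF; lra.
have : mu.-integrable `[1, +oo[ (EFin \o f).
  apply/integrableP; split.
    by apply/measurable_EFinP; apply: subspace_continuous_measurable_fun.
  apply: (@le_lt_trans _ _ (\int[mu]_(x in `[1%R, +oo[) (f x)%:E)%E); last first.
    by rewrite E -EFinB ltry.
  rewrite le_eqVlt; apply/orP; left; apply/eqP; apply: eq_integral => x _ /=.
  by rewrite ger0_norm.
apply: eq_integrable => // r; rewrite inE /= in_itv /= andbT => r1.
have r0 : 0 < r by lra.
rewrite /f /= powRD; first by rewrite powR_inv1// ltW.
by rewrite (gt_eqF r0) implybT.
Qed.

Lemma cintg_dominated (D : set (measurableTypeR R)) (f : R -> R[i]) (w : R -> R) :
  measurable D -> (forall x, D x -> {for x, continuous (f : R -> C)}) ->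
  mu.-integrable D (EFin \o w) -> (forall x, D x -> normc (f x) <= w x) -> cintg D f.
Proof.
move=> mD cf iw fw.
have key (h : R -> R) : (forall x, D x -> {for x, continuous h}) ->
    (forall x, D x -> `|h x| <= w x) -> mu.-integrable D (EFin \o h).
  move=> ch hw; apply: le_integrable iw => //.
    apply/measurable_EFinP; apply: subspace_continuous_measurable_fun => //.
    by apply: continuous_in_subspaceT => x; rewrite inE => /ch.
  move=> x Dx /=; rewrite lee_fin; apply: le_trans (hw x Dx) _; exact: ler_norm.
split; apply: key => x Dx.
- exact: (cvg_Re (cf x Dx)).
- exact: le_trans (Re_le_normc _) (fw x Dx).
- exact: (cvg_Im (cf x Dx)).
- exact: le_trans (Im_le_normc _) (fw x Dx).
Qed.

(** With theta = q^k the recurrence makes Q r * r^k bounded, and k > m. *)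
Lemma geometric_decay (q theta R1 B : R) (m : nat) : 0 < q < 1 -> 0 < theta ->
  theta < q ^+ m -> 0 <= B -> 1 <= q * R1 -> exists K d : R, 0 < d /\
  forall Q : R -> R, (forall r, 0 <= Q r) ->
    (forall r, 1 <= r <= R1 -> Q r <= B) ->
    (forall r, R1 <= r -> Q r <= theta * Q (q * r)) ->
    forall r, 1 <= r -> Q r * r ^+ m <= K * r `^ (- d).
Proof.
move=> /andP[q0 q1] th0 thm B0 qR1.
have lnq : ln q < 0 by rewrite ln_lt0// q0.
(* That is, q^k = theta. *)
pose k := ln theta / ln q.
have qk : q `^ k = theta.
  by rewrite /powR gt_eqF// /k divfK ?lt_eqF// lnK.
have km : m%:R < k.
  by rewrite /k ltr_ndivlMr// mulr_natl -lnXn// ltr_ln// posrE exprn_gt0.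
have k0 : 0 < k by apply: le_lt_trans km.
exists (B * R1 `^ k), (k - m%:R); split; first by rewrite subr_gt0.
move=> Q Q0 QB Qs.
have R11 : 1 <= R1 by nra.
have H n : forall r, 1 <= r -> r * q ^+ n <= R1 -> Q r * r `^ k <= B * R1 `^ k.
  elim: n => [|n ih] r r1.
    rewrite expr0 mulr1 => rR; apply: ler_pM; rewrite ?powR_ge0//.
      by apply: QB; rewrite r1.
    by apply: (ge0_ler_powR (ltW k0)); rewrite ?nnegrE//; lra.
  move=> hr; have [rR|rR] := leP r R1.
    apply: ler_pM; rewrite ?powR_ge0//; first by apply: QB; rewrite r1.
    by apply: (ge0_ler_powR (ltW k0)); rewrite ?nnegrE//; lra.
  have qr1 : 1 <= q * r by apply: le_trans qR1 _; rewrite ler_pM2l// ltW.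
  apply: le_trans (ih (q * r) qr1 _); last by rewrite mulrAC -exprS mulrC.
  apply: le_trans (ler_wpM2r (powR_ge0 _ _) (Qs r (ltW rR))) _.
  by rewrite powRM ?(ltW q0)//; [rewrite qk; lra|lra].
move=> r r1; have r0 : 0 < r by lra.
have [n hn] : exists n, r * q ^+ n <= R1.
  have q01 : 0 <= q < 1 by rewrite q1 ltW.
  have Rr : 0 < R1 / r by rewrite divr_gt0//; lra.
  have [n hn] := pow_lt_small q01 Rr.
  by exists n; rewrite mulrC -ler_pdivlMr// ltW.
have h := H n r r1 hn.
have -> : r ^+ m = r `^ k * r `^ (- (k - m%:R)).
  rewrite -powRD; last by rewrite (gt_eqF r0) implybT.
  by rewrite opprB addrC subrK powR_mulrn// ltW.
by rewrite mulrA ler_wpM2r// powR_ge0.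
Qed.

End Decay.

(** * The regular part of the integrand *)

Section DerivableOps.
Variable R : realType.
Local Notation C := (R[i]^o).

Lemma derivC_prod (I : eqType) (s : seq I) (P : pred I) (f : I -> C -> C) (x : C) :
  (forall i, i \in s -> derivable (f i) x 1) ->
  derivable (fun y : C => \prod_(i <- s | P i) f i y : C) x 1.
Proof.
elim: s => [|i s ih] h.
  rewrite (_ : (fun y => _) = fun=> 1); first exact: derivable_cst.
  by apply/funext => y; rewrite big_nil.
have {}ih : derivable (fun y : C => \prod_(i <- s | P i) f i y : C) x 1.
  by apply: ih => k ks; apply: h; rewrite inE ks orbT.
have hi : derivable (f i) x 1 by apply: h; rewrite inE eqxx.
case Pi : (P i); last first.
  rewrite (_ : (fun y => _) = fun y : C => \prod_(j <- s | P j) f j y); first exact: ih.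
  by apply/funext => y; rewrite big_cons Pi.
rewrite (_ : (fun y => _) = fun y : C => f i y * \prod_(j <- s | P j) f j y).
  by apply: derivableM; [exact: hi|exact: ih].
by apply/funext => y; rewrite big_cons Pi.
Qed.

Lemma derivC_X (f : C -> C) (x : C) n : derivable f x 1 ->
  derivable (fun y : C => f y ^+ n : C) x 1.
Proof.
move=> hf; elim: n => [|n ih].
  rewrite (_ : (fun y => _) = fun=> 1); first exact: derivable_cst.
  by apply/funext => y; rewrite expr0.
rewrite (_ : (fun y => _) = (fun y => f y * f y ^+ n)).
  by apply: derivableM; [exact: hf|exact: ih].
by apply/funext => y; rewrite exprS.
Qed.

Lemma derivC_sqr (x : C) : derivable (fun u : C => u ^+ 2 : C) x 1.
Proof. by apply: (@derivC_X (fun u => u)); exact: derivable_id. Qed.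

Lemma derivC_cM (c : C) (f : C -> C) (x : C) : derivable f x 1 ->
  derivable (fun y : C => c * f y : C) x 1.
Proof. by move=> hf; apply: derivableM; [exact: derivable_cst|exact: hf]. Qed.

Lemma derivC_qpoch (q : R[i]) (f : C -> C) (x : C) : normc q < 1 -> derivable f x 1 ->
  derivable (fun y : C => qpoch (f y) q : C) x 1.
Proof.
move=> q1 hf; apply: (@derivC_comp _ f (fun y : C => qpoch y q : C) x hf).
exact: derivable_qpoch.
Qed.

End DerivableOps.

Section Algebra.
Variable F : fieldType.

Lemma Phi_alg (z z' v A B D : F) : v != 0 -> v - v^-1 != 0 ->
  (z - z') / (v - v^-1) * ((1 - v ^+ 2) * A * ((1 - (v ^+ 2)^-1) * B) * D) =
  (z - z') * (- (v - v^-1) * (A * B) * D).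
Proof.
move=> v0 hv; have -> : (1 - v ^+ 2) * A * ((1 - (v ^+ 2)^-1) * B) * D =
   (v - v^-1) * (- (v - v^-1) * (A * B) * D) by field.
by rewrite mulrA divfK.
Qed.

Lemma div_cancel (n x y : F) : x != 0 -> n / (x * y) * x = n / y.
Proof. by move=> x0; rewrite invfM mulrA mulrAC mulfVK. Qed.

Lemma num_alg (p v A B : F) : v != 0 -> p != 0 -> 1 - p * v ^+ 2 != 0 ->
  1 - p * v ^+ 2 * p != 0 ->
  - (p * v - (p * v)^-1) * (A * ((1 - (p * v ^+ 2)^-1) * ((1 - (v ^+ 2)^-1) * B))) =
  (p ^+ 2 * (v ^+ 2) ^+ 2)^-1 *
  (- (v - v^-1) * ((1 - p * v ^+ 2) * ((1 - p * v ^+ 2 * p) * A) * B)).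
Proof. by move=> v0 p0 h1 h2; field; rewrite v0 p0. Qed.

End Algebra.

Section Integrand.
Variable R : realType.
Local Notation C := (R[i]^o).
Variables (N : nat) (q : R[i]).
Hypothesis hN : (2 <= N)%N.
Hypothesis q0 : q != 0.
Hypothesis q1 : normc q < 1.

Notation sg := (sqrtC q).
Notation p := (qhalf N q).

Let N0 : (0 < N)%N. Proof. exact: leq_trans hN. Qed.

Lemma sg_sqr : sg ^+ 2 = q. Proof. exact: sqrtCK. Qed.

Lemma sg_neq0 : sg != 0. Proof. by rewrite sqrtC_eq0. Qed.

Lemma normc_sg : normc sg ^+ 2 = normc q. Proof. by rewrite -normcX sg_sqr. Qed.

Lemma normc_sg_lt1 : normc sg < 1.
Proof. by rewrite -(@expr_lt1 _ 2)// ?normc_ge0// normc_sg. Qed.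

Lemma p_lt1 : normc p < 1.
Proof. by rewrite /qhalf normcX exprn_ilt1 ?normc_ge0 ?normc_sg_lt1// -lt0n. Qed.

Lemma p_neq0 : p != 0. Proof. by rewrite expf_neq0// sg_neq0. Qed.

Lemma p_sqr : p ^+ 2 = q ^+ N. Proof. by rewrite /qhalf exprAC sg_sqr. Qed.

(** Numerator of psi. The two factors of index 0 of (z^N, z^(-N); q^(N/2))_oo, divided by
    z^(N/2) - z^(-N/2), leave -(z^(N/2) - z^(-N/2)). *)
Definition num (u : R[i]) : R[i] := - (u ^+ N - u ^- N) *
  (qpoch (p * (u ^+ 2) ^+ N) p * qpoch (p * ((u ^+ 2) ^+ N)^-1) p).
Definition den (a : nat -> R[i]) (u : R[i]) : R[i] :=
  \prod_(1 <= j < (2 * N).+1) qpoch_pm (a j) (u ^+ 2) q.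
(** The integrand without z - 1/z; unlike Phi it has its correct values at z^N = 1. *)
Definition psi a u := num u / den a u.

Definition Hden (a : nat -> R[i]) (u : R[i]) : R[i] :=
  \prod_(1 <= j < (2 * N).+1)
    (qpoch (a j * u ^+ 2) q * qpoch (a j * (u ^+ 2)^-1 * q) q).
(** psi times the product of the 1 - a_j / z, in the form that is holomorphic at z = a_j. *)
Definition Hf a u := num u / Hden a u.

Definition pz (a : nat -> R[i]) (z : R[i]) : R[i] :=
  \prod_(1 <= j < (2 * N).+1) (1 - a j * z).

Lemma uNsqr (u : R[i]) : (u ^+ 2) ^+ N = (u ^+ N) ^+ 2.
Proof. by rewrite exprAC. Qed.

(** The index-0 factors 1 - z^N and 1 - z^(-N) multiply to -(z^(N/2) - z^(-N/2))^2. *)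
Lemma Phi_Psi a u : u != 0 -> u ^+ N - u ^- N != 0 ->
  Phi N q a u = (u ^+ 2 - (u ^+ 2)^-1) * psi a u.
Proof.
move=> u0 hu; rewrite /Phi /psi /num -/(den a u) /qpoch_pm !mul1r.
rewrite (qpochS p_lt1 ((u ^+ 2) ^+ N)) (qpochS p_lt1 ((u ^+ 2) ^+ N)^-1).
rewrite [p * _]mulrC [p * _^-1]mulrC uNsqr.
by apply: Phi_alg => //; rewrite expf_neq0.
Qed.

Lemma den_Hden a u : den a u = pz a (u ^+ 2)^-1 * Hden a u.
Proof.
rewrite /den /pz /Hden -big_split /=; apply: eq_bigr => j _.
by rewrite /qpoch_pm [in LHS](qpochS q1 (a j * (u ^+ 2)^-1)) mulrCA.
Qed.

Lemma den_Hden_shift a u : u != 0 -> den a u = pz a (u ^+ 2) * Hden a (sg * u).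
Proof.
move=> u0; rewrite /den /pz /Hden -big_split /=; apply: eq_bigr => j _.
have -> : a j * (sg * u) ^+ 2 = a j * u ^+ 2 * q.
  by rewrite exprMn sg_sqr mulrCA mulrC.
have -> : a j / (sg * u) ^+ 2 * q = a j * (u ^+ 2)^-1.
  by rewrite exprMn sg_sqr invfM [q^-1 * _]mulrC mulrA mulfVK.
by rewrite mulrA -(qpochS q1).
Qed.

Lemma num_shift u : u != 0 -> 1 - p * (u ^+ 2) ^+ N != 0 ->
  1 - p * (u ^+ 2) ^+ N * p != 0 ->
  num (sg * u) = (q ^+ N * (u ^+ 2) ^+ (2 * N))^-1 * num u.
Proof.
move=> u0; rewrite uNsqr => h1 h2; set v := u ^+ N in h1 h2 *.
have v0 : v != 0 by rewrite expf_neq0.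
have e1 : (sg * u) ^+ N = p * v by rewrite exprMn.
rewrite /num !uNsqr e1 -/v.
have -> : qpoch (p * (p * v) ^+ 2) p = qpoch (p * v ^+ 2 * p * p) p.
  by congr (qpoch _ p); ring.
have -> : qpoch (p * ((p * v) ^+ 2)^-1) p =
    (1 - (p * v ^+ 2)^-1) * ((1 - (v ^+ 2)^-1) * qpoch (p * (v ^+ 2)^-1) p).
  have -> : p * ((p * v) ^+ 2)^-1 = (p * v ^+ 2)^-1.
    by rewrite exprMn expr2 -mulrA invfM mulrA mulfV ?mul1r// p_neq0.
  rewrite (qpochS p_lt1); congr (_ * _).
  have -> : (p * v ^+ 2)^-1 * p = (v ^+ 2)^-1.
    by rewrite invfM mulrC mulrA mulfV ?mul1r// p_neq0.
  by rewrite (qpochS p_lt1) [_ * p]mulrC.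
rewrite [qpoch (p * v ^+ 2) p](qpochS p_lt1) [qpoch (p * v ^+ 2 * p) p](qpochS p_lt1).
rewrite (num_alg _ _ v0 p_neq0 h1 h2) p_sqr; congr ((_ * _)^-1 * _).
by rewrite /v -!exprM mulnC !mulnA.
Qed.

Lemma Hf_Psi a u : pz a (u ^+ 2)^-1 != 0 -> Hf a u = psi a u * pz a (u ^+ 2)^-1.
Proof.
by move=> h; rewrite /Hf /psi den_Hden div_cancel.
Qed.

(** The shift z -> q z moves the factors 1 - a_j z from one half of the
    denominator to the other, and the theta-like numerator reproduces itself up
    to the monomial q^(-N) z^(-2N). *)
Lemma Hf_shift a u : u != 0 -> 1 - p * (u ^+ 2) ^+ N != 0 ->
  1 - p * (u ^+ 2) ^+ N * p != 0 -> pz a (u ^+ 2) != 0 ->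
  Hf a (sg * u) = (q ^+ N * (u ^+ 2) ^+ (2 * N))^-1 * (psi a u * pz a (u ^+ 2)).
Proof.
move=> u0 h1 h2 h3; by rewrite /Hf num_shift// /psi den_Hden_shift// (div_cancel _ _ h3) -[LHS]mulrA.
Qed.

Lemma derivable_num (u : C) : u != 0 -> derivable (num : C -> C) u 1.
Proof.
move=> u0; have dX n : derivable (fun u : C => (u ^+ 2) ^+ n : C) u 1.
  by apply: (@derivC_X _ (fun u => u ^+ 2)); exact: derivC_sqr.
have dN : derivable (fun u : C => u ^+ N : C) u 1.
  by apply: (@derivC_X _ (fun u => u)); exact: derivable_id.
apply: derivableM.
  apply: derivableN; apply: derivableB; first exact: dN.
  by apply: derivableV; [rewrite expf_neq0|exact: dN].
apply: derivableM; apply: derivC_qpoch; try exact: p_lt1.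
  by apply: derivC_cM; exact: dX.
apply: derivC_cM; apply: derivableV; last exact: dX.
by rewrite !expf_neq0.
Qed.

Lemma derivable_qp (c : C) (u : C) : derivable (fun u : C => qpoch (c * u ^+ 2) q : C) u 1.
Proof. apply: derivC_qpoch; first exact: q1.
by apply: derivC_cM; exact: derivC_sqr. Qed.

Lemma derivable_qm (c d : C) (u : C) : u != 0 ->
  derivable (fun u : C => qpoch (c * (u ^+ 2)^-1 * d) q : C) u 1.
Proof.
move=> u0; apply: derivC_qpoch; first exact: q1.
apply: derivableM; last exact: derivable_cst.
by apply: derivC_cM; apply: derivableV; [rewrite expf_neq0|exact: derivC_sqr].
Qed.

Lemma derivable_Psi a (u : C) : u != 0 -> den a u != 0 -> derivable (psi a : C -> C) u 1.
Proof.
move=> u0 du; apply: derivableM; first exact: derivable_num.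
apply: derivableV; first exact: du.
apply: derivC_prod => j _; apply: derivableM; first exact: derivable_qp.
have := @derivable_qm (a j) 1 u u0.
have -> : (fun u : C => qpoch (a j * (u ^+ 2)^-1 * 1) q : C) =
    fun u : C => qpoch (a j * (u ^+ 2)^-1) q by apply/funext => x; rewrite mulr1.
exact.
Qed.

Lemma derivable_Hf a (u : C) : u != 0 -> Hden a u != 0 -> derivable (Hf a : C -> C) u 1.
Proof.
move=> u0 du; apply: derivableM; first exact: derivable_num.
apply: derivableV; first exact: du.
by apply: derivC_prod => j _; apply: derivableM; [exact: derivable_qp|exact: derivable_qm].
Qed.

Lemma derivable_Psi_param a j (u t : C) : den (set_param a j t) u != 0 ->
  derivable (fun t : C => psi (set_param a j t) u : C) t 1.
Proof.
move=> du; apply: derivC_cM; apply: derivableV; first exact: du.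
apply: derivC_prod => k _; have dk : derivable (fun t : C => set_param a j t k : C) t 1.
  by rewrite /set_param; case: eqP => _; [exact: derivable_id|exact: derivable_cst].
have dq (c : C) : derivable (fun t : C => qpoch (set_param a j t k * c) q : C) t 1.
  apply: derivC_qpoch; first exact: q1.
  by apply: derivableM; [exact: dk|exact: derivable_cst].
by apply: derivableM; exact: dq.
Qed.

(** Points where psi is holomorphic and the shift relation may be divided out. *)
Definition good a u := [/\ u != 0, den a u != 0, pz a (u ^+ 2) != 0,
  pz a (u ^+ 2)^-1 != 0 & 1 - p * (u ^+ 2) ^+ N != 0 /\ 1 - p * (u ^+ 2) ^+ N * p != 0].

Lemma good_Hden a u : good a u -> Hden a u != 0.
Proof. by case=> _ + _ h _; rewrite den_Hden mulf_eq0 negb_or => /andP[]. Qed.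

Lemma one_sub_neq0 (x : R[i]) : normc x < 1 -> 1 - x != 0.
Proof. by move=> h; rewrite subr_eq0; apply/eqP => e; move: h; rewrite -e normc1 ltxx. Qed.

Lemma good_circle a u : (forall j, (1 <= j <= 2 * N)%N -> normc (a j) < 1) ->
  normc u = 1 -> good a u.
Proof.
move=> ha nu; have u0 : u != 0 by rewrite -normc_gt0 nu.
have nz n : normc ((u ^+ 2) ^+ n) = 1 by rewrite !normcX nu !expr1n.
have nz1 : normc (u ^+ 2) = 1 by rewrite normcX nu expr1n.
have haj j : j \in index_iota 1 (2 * N).+1 -> normc (a j) < 1.
  by rewrite mem_index_iota ltnS; exact: ha.
have n1 (x : R[i]) : normc x = 1 -> pz a x != 0.
  move=> nx; rewrite /pz big_seq prodf_seq_neq0; apply/allP => j hj; rewrite hj /=.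
  by apply: one_sub_neq0; rewrite normcM nx mulr1 haj.
split => //.
- rewrite /den big_seq prodf_seq_neq0; apply/allP => j hj; rewrite hj /=.
  rewrite /qpoch_pm mulf_neq0//; apply: qpoch_neq0_lt1 => //.
    by rewrite normcM nz1 mulr1 haj.
  by rewrite normcM normcV nz1 invr1 mulr1 haj.
- exact: n1.
- by apply: n1; rewrite normcV nz1 invr1.
- split; apply: one_sub_neq0; first by rewrite normcM nz mulr1 p_lt1.
  rewrite 2!normcM nz mulr1; have := p_lt1; have := normc_ge0 p; nra.
Qed.

(** Here |a_j z| < 1 and |q a_j / z| < 1, so no factor vanishes. *)
Lemma Hden_annulus a u : (forall j, (1 <= j <= 2 * N)%N -> normc (a j) < 1) ->
  normc q <= normc u ^+ 2 <= 1 -> Hden a u != 0.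
Proof.
move=> ha /andP[h1 h2].
have haj j : j \in index_iota 1 (2 * N).+1 -> normc (a j) < 1.
  by rewrite mem_index_iota ltnS; exact: ha.
have qg : 0 < normc q by rewrite normc_gt0.
have u2 : 0 < normc u ^+ 2 by apply: lt_le_trans h1.
rewrite /Hden big_seq prodf_seq_neq0; apply/allP => j hj; rewrite hj /=.
rewrite mulf_neq0//; apply: qpoch_neq0_lt1 => //.
  rewrite normcM normcX; apply: le_lt_trans (haj j hj).
  by rewrite ler_piMr// normc_ge0.
rewrite 2!normcM normcV normcX; apply: le_lt_trans (haj j hj).
by rewrite -mulrA ler_piMr ?normc_ge0// mulrC ler_pdivrMr// mul1r.
Qed.

End Integrand.

(** * Uniform decay of the integrand *)

Section Sector.
Variable R : realType.

Lemma Re_mul_real (x : R[i]) (r : R) : complex.Re (x * r%:C) = complex.Re x * r.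
Proof. by case: x => a b /=; ring. Qed.

Lemma Im_mul_real (x : R[i]) (r : R) : complex.Im (x * r%:C) = complex.Im x * r.
Proof. by case: x => a b /=; ring. Qed.

Lemma ReB (x y : R[i]) : complex.Re (x - y) = complex.Re x - complex.Re y.
Proof. by case: x; case: y. Qed.

Lemma ImB (x y : R[i]) : complex.Im (x - y) = complex.Im x - complex.Im y.
Proof. by case: x; case: y. Qed.

(** If Re t0 > 0 then Re (1 + t x) >= 1. Otherwise Im t0 is not 0, and 1 + t x is
    close to 1 for small x and has a large imaginary part for the other x. *)
Lemma sector (t0 : R[i]) : ~~ (t0 <= 0) -> exists2 e : R, 0 < e &
  forall t, normc (t - t0) <= e -> forall x, 0 <= x -> e <= normc (1 + t * x%:C).
Proof.
move=> ht0; have [re0|re0] := ltP 0 (complex.Re t0).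
  pose e := Num.min 1 (complex.Re t0); exists e.
    by rewrite lt_min ltr01.
  move=> t ht x x0; have e1 : e <= 1 by rewrite ge_min lexx.
  have e2 : e <= complex.Re t0 by rewrite ge_min lexx orbT.
  apply: le_trans e1 _; apply: le_trans (Re_le_normc _); apply: le_trans (ler_norm _).
  rewrite ReD Re_mul_real /= lerDl mulr_ge0//.
  have := le_trans (ler_norm _) (le_trans (Re_le_normc (t0 - t)) _).
  rewrite normcB => /(_ _ ht); rewrite ReB; lra.
have im0 : complex.Im t0 != 0.
  apply: contraNneq ht0 => h; rewrite lecE /= h eqxx /=; exact: re0.
pose m := `|complex.Im t0|; have m0 : 0 < m by rewrite normr_gt0.
pose M := normc t0 + m; have M0 : 0 < M by rewrite ltr_wpDl// normc_ge0.
have mM : m <= M by rewrite lerDr normc_ge0.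
pose e := Num.min (m / 2) (Num.min 2^-1 (m / (4 * M))).
have e0 : 0 < e.
  by rewrite !lt_min invr_gt0 ltr0n !divr_gt0// mulr_gt0.
have e1 : e <= m / 2 by rewrite ge_min lexx.
have e2 : e <= 2^-1 by rewrite ge_min [X in _ || X]ge_min lexx !orbT.
have e3 : e <= m / (4 * M) by rewrite ge_min [X in _ || X]ge_min lexx !orbT.
exists e => // t ht x x0.
have tM : normc t <= M.
  rewrite -(subrK t0 t); apply: le_trans (normcD _ _) _; rewrite /M addrC lerD2l; lra.
have imt : m / 2 <= `|complex.Im t|.
  have := le_trans (Im_le_normc (t - t0)) ht; rewrite ImB => h.
  have := ler_normD (complex.Im t) (complex.Im t0 - complex.Im t).
  rewrite addrC subrK -/m distrC; lra.
have [xs|xl] := leP x (2 * M)^-1.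
  apply: le_trans e2 _.
  have h : normc (t * x%:C) <= 2^-1.
    rewrite normcM normc_real ger0_norm//.
    apply: le_trans (ler_pM (normc_ge0 _) x0 tM xs) _.
    by rewrite invfM mulrCA mulfV ?gt_eqF// mulr1.
  have := ler_dist_normc 1 (- (t * x%:C)); rewrite opprK normc1 normcN.
  move=> /(le_trans (ler_norm _)); lra.
apply: le_trans e3 _; apply: le_trans (Im_le_normc _).
rewrite ImD Im_mul_real /= add0r normrM (ger0_norm x0).
have -> : m / (4 * M) = m / 2 * (2 * M)^-1 by field; rewrite gt_eqF.
by apply: ler_pM => //; [lra|rewrite invr_ge0 mulr_ge0// ltW|exact: ltW].
Qed.

Lemma uniform_min n (P : nat -> R -> Prop) :
  (forall j e e', P j e -> 0 < e' <= e -> P j e') ->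
  (forall j, (j < n)%N -> exists2 e : R, 0 < e & P j e) ->
  exists2 e : R, 0 < e & forall j, (j < n)%N -> P j e.
Proof.
move=> hP; elim: n => [|n ih] h; first by exists 1.
have [j jn|e1 e10 h1] := ih; first by apply: h; exact: ltnW.
have [e2 e20 h2] := h n (ltnSn n).
have e0 : 0 < Num.min e1 e2 by rewrite lt_min e10 e20.
exists (Num.min e1 e2) => // j; rewrite ltnS leq_eqVlt => /orP[/eqP ->|jn].
  by apply: hP h2 _; rewrite e0 ge_min lexx orbT.
by apply: hP (h1 j jn) _; rewrite e0 ge_min lexx.
Qed.

End Sector.

Section PsiDecay.
Variable R : realType.
Local Notation C := (R[i]^o).
Variables (N : nat) (q : R[i]).
Hypothesis hN : (2 <= N)%N.
Hypothesis q0 : q != 0.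
Hypothesis q1 : normc q < 1.

Notation sg := (sqrtC q).
Notation p := (qhalf N q).
Notation rho := (normc q).
Notation Psi := (psi N q).

(** The square root of -r above the cut. *)
Definition tpt (r : R) : R[i] := 0 +i* Num.sqrt r.

Lemma tpt_sqr r : 0 <= r -> tpt r ^+ 2 = (- r)%:C.
Proof.
move=> r0; rewrite expr2 /tpt; apply/eqP; rewrite eq_complex /=.
by rewrite -[Num.sqrt r * _]expr2 sqr_sqrtr// !mul0r mulr0 addr0 sub0r !eqxx.
Qed.

Lemma tpt_neq0 r : 0 < r -> tpt r != 0.
Proof. by move=> r0; rewrite eq_complex /= eqxx /= gt_eqF// sqrtr_gt0. Qed.

(** Uniform distance from the poles of psi on the circle and on the tail. *)
Definition tame (eps : R) (a : nat -> R[i]) := forall j, (1 <= j <= 2 * N)%N ->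
  eps <= normc (a j) <= 1 - eps /\
  forall x, 0 <= x -> eps <= normc (1 + a j * x%:C).

Definition slit (a : nat -> R[i]) := forall j, (1 <= j <= 2 * N)%N ->
  [/\ a j != 0, normc (a j) < 1 & ~~ (a j <= 0)].

Lemma tame_near a : slit a -> exists2 eps : R, 0 < eps & forall b,
  (forall j, (1 <= j <= 2 * N)%N -> normc (b j - a j) <= eps) -> tame eps b.
Proof.
move=> ha; pose P j (e : R) := (1 <= j <= 2 * N)%N -> forall t, normc (t - a j) <= e ->
  e <= normc t <= 1 - e /\ forall x, 0 <= x -> e <= normc (1 + t * x%:C).
have [||e e0 he] := @uniform_min R (2 * N).+1 P.
- move=> j e e' h /andP[e'0 e'e] hj t ht.
  have [/andP[h1 h2] h3] := h hj t (le_trans ht e'e); split; first by apply/andP; lra.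
  by move=> x x0; apply: le_trans e'e (h3 x x0).
- move=> j _; have [hj|hj] := boolP (1 <= j <= 2 * N)%N; last first.
    by exists 1 => //; rewrite /P (negPf hj).
  have [aj0 aj1 ajs] := ha j hj; have [e e0 he] := sector ajs.
  have n0 : 0 < normc (a j) by rewrite normc_gt0.
  pose e' := Num.min e (Num.min (normc (a j) / 2) ((1 - normc (a j)) / 2)).
  have h1 : e' <= e by rewrite ge_min lexx.
  have h2 : e' <= normc (a j) / 2 by rewrite ge_min [X in _ || X]ge_min lexx !orbT.
  have h3 : e' <= (1 - normc (a j)) / 2 by rewrite ge_min [X in _ || X]ge_min lexx !orbT.
  exists e'; first by rewrite !lt_min e0 !divr_gt0// subr_gt0.
  move=> _ t ht; split; last by move=> x x0; apply: le_trans h1 (he t (le_trans ht h1) x x0).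
  have := le_trans (ler_dist_normc t (a j)) ht.
  rewrite ler_norml => /andP[h4 h5]; apply/andP; split; lra.
exists e => // b hb j hj; apply: (he j _ hj); last exact: hb.
by case/andP: hj => _; rewrite ltnS.
Qed.

Lemma tame_self a : slit a -> exists2 eps : R, 0 < eps & tame eps a.
Proof.
move=> /tame_near[e e0 h]; exists e => //; apply: h => j _.
by rewrite subrr normc0 ltW.
Qed.

Lemma den_lower a u c : 0 <= c ->
  (forall j, (1 <= j <= 2 * N)%N -> c <= normc (qpoch (a j * u ^+ 2) q) /\
     c <= normc (qpoch (a j * (u ^+ 2)^-1) q)) ->
  (c * c) ^+ (2 * N) <= normc (den N q a u).
Proof.
move=> c0 h; rewrite /den normc_prod.
have -> : (c * c) ^+ (2 * N) = \prod_(1 <= j < (2 * N).+1) (c * c).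
  by rewrite prodr_const_nat subSS subn0.
rewrite big_seq [leRHS]big_seq; apply: ler_prod => j.
rewrite mem_index_iota ltnS => hj; have [h1 h2] := h j hj.
by rewrite mulr_ge0//= /qpoch_pm normcM ler_pM.
Qed.

Lemma normc_segment_bounded (f : R -> C) (x y : R) :
  (forall t, x <= t <= y -> {for t, continuous f}) ->
  exists2 M : R, 0 <= M & forall t, x <= t <= y -> normc (f t) <= M.
Proof.
move=> cf; have [xy|yx] := leP x y; last first.
  by exists 0 => // t /andP[h1 h2]; have := le_trans h1 h2; rewrite leNgt yx.
have cn : {within `[x, y], continuous (fun t => normc (f t))}.
  apply: continuous_in_subspaceT => t; rewrite inE /= in_itv /= => ht.
  exact: (cvg_normc (cf t ht)).
have [c _ hc] := EVT_max xy cn; exists (normc (f c)); first exact: normc_ge0.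
by move=> t ht; apply: hc; rewrite in_itv.
Qed.

Lemma cont_tpt (r : R) : 0 < r -> {for r, continuous (tpt : R -> C)}.
Proof.
move=> r0; apply: (@cvg_Complex R R _ _ (fun=> 0) (fun r => Num.sqrt r) 0 (Num.sqrt r)).
  exact: cvg_cst.
exact: sqrt_continuous.
Qed.

Lemma Psi_le a u c M : 0 < c -> normc (num N q u) <= M ->
  (forall j, (1 <= j <= 2 * N)%N -> c <= normc (qpoch (a j * u ^+ 2) q) /\
     c <= normc (qpoch (a j * (u ^+ 2)^-1) q)) ->
  normc (Psi a u) <= M / (c * c) ^+ (2 * N).
Proof.
move=> c0 hM hc; rewrite normcM normcV.
have h := den_lower (ltW c0) hc.
have h0 : 0 < (c * c) ^+ (2 * N) by rewrite exprn_gt0// mulr_gt0.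
apply: ler_pM => //; rewrite ?normc_ge0 ?invr_ge0 ?normc_ge0//.
by rewrite lef_pV2// posrE// (lt_le_trans h0).
Qed.

Lemma Psi_circle_bounded eps : 0 < eps -> exists2 M : R, 0 <= M &
  forall a, tame eps a -> forall t, - pi <= t <= pi -> normc (Psi a (upt t)) <= M.
Proof.
move=> e0; have [M M0 hM] : exists2 M : R, 0 <= M &
    forall t, - pi <= t <= pi -> normc (num N q (upt t)) <= M.
  apply: (@normc_segment_bounded (fun t => num N q (upt t))) => t _.
  apply: (@contC_comp _ _ (num N q : C -> C) (@upt R : R -> C)); last first.
    by apply: derivC_cont; apply: derivable_num => //; rewrite uptE cis_neq0.
  have -> : (@upt R : R -> C) = (fun t => cis (2^-1 * t)) by apply/funext => x; rewrite uptE.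
  exact: (cder1_cont (cder1_cisl _ _)).
have [c c0 hc] := qpoch_lower q1 1 e0.
exists (M / (c * c) ^+ (2 * N)).
  by rewrite divr_ge0// exprn_ge0// mulr_ge0// ltW.
move=> a ta t ht; apply: Psi_le => //; first exact: hM.
have nz : normc (upt t ^+ 2) = 1 by rewrite uptE normcX normc_cis expr1n.
have qk k : normc (q ^+ k) <= 1 by rewrite normcX exprn_ile1 ?normc_ge0// ltW.
have key j z : (1 <= j <= 2 * N)%N -> normc z = 1 -> c <= normc (qpoch (a j * z) q).
  move=> hj z1; have [/andP[_ h2] _] := ta j hj.
  apply: hc => [|k]; first by rewrite normcM z1 mulr1; lra.
  have := le_trans (ler_norm _) (ler_dist_normc 1 (a j * z * q ^+ k)).
  rewrite normc1 2!normcM z1 mulr1.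
  have : normc (a j) * normc (q ^+ k) <= normc (a j) by rewrite ler_piMr ?normc_ge0.
  lra.
by move=> j hj; split; apply: key => //; rewrite normcV nz invr1.
Qed.

Section Tail.
Hypothesis oddN : odd N.
Hypothesis qpos : 0 < q.

Lemma rho_gt0 : 0 < rho. Proof. by rewrite normc_gt0. Qed.

Lemma q_real : q = rho%:C. Proof. by rewrite -normcE ger0_norm// ltW. Qed.

Lemma sg_real : sg = (Num.sqrt rho)%:C.
Proof.
have [s s0 sE] : exists2 s : R, 0 < s & sg = s%:C by apply: gtc0_real; rewrite sqrtC_gt0.
have := @normc_sg R q; rewrite sE normc_real gtr0_norm// => <-.
by rewrite sqrtr_sqr gtr0_norm.
Qed.

Lemma sg_tpt r : sg * tpt r = tpt (rho * r).
Proof.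
rewrite sg_real /tpt sqrtrM ?(ltW rho_gt0)//; apply/eqP; rewrite eq_complex /=.
by apply/andP; split; apply/eqP; ring.
Qed.

Lemma tpt_inv r : 0 <= r -> (tpt r ^+ 2)^-1 = (- r^-1)%:C.
Proof. by move=> r0; rewrite tpt_sqr// -invrN -fmorphV. Qed.

Lemma normc_tail_factor eps a j r k : tame eps a -> (1 <= j <= 2 * N)%N -> 0 <= r ->
  eps <= normc (1 - a j * (- r)%:C * q ^+ k).
Proof.
move=> ta hj r0; have [_ h] := ta j hj.
have -> : 1 - a j * (- r)%:C * q ^+ k = 1 + a j * (r * rho ^+ k)%:C.
  by rewrite {1}q_real rmorphM rmorphN rmorphXn mulrN mulNr opprK mulrA.
by apply: h; rewrite mulr_ge0// exprn_ge0// ltW// rho_gt0.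
Qed.

Lemma pz_tail eps a r : tame eps a -> 0 < eps -> 0 <= r -> pz N a (- r)%:C != 0.
Proof.
move=> ta e0 r0; rewrite /pz big_seq prodf_seq_neq0; apply/allP => j hj; rewrite hj /=.
rewrite -normc_gt0; apply: lt_le_trans e0 _.
have := @normc_tail_factor eps a j r 0 ta; rewrite expr0 mulr1; apply => //.
by move: hj; rewrite mem_index_iota ltnS.
Qed.

Lemma good_tail eps a r : tame eps a -> 0 < eps -> 0 < r -> good N q a (tpt r).
Proof.
move=> ta e0 r0; have ri : 0 <= r^-1 by rewrite invr_ge0 ltW.
split; first exact: tpt_neq0.
- rewrite /den big_seq prodf_seq_neq0; apply/allP => j hj; rewrite hj /=.
  have hj' : (1 <= j <= 2 * N)%N by move: hj; rewrite mem_index_iota ltnS.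
  rewrite /qpoch_pm tpt_inv ?tpt_sqr ?(ltW r0)// mulf_neq0//; apply: qpoch_neq0 => // k.
    rewrite -normc_gt0; apply: lt_le_trans e0 _.
    by apply: normc_tail_factor => //; exact: ltW.
  rewrite -normc_gt0; apply: lt_le_trans e0 _.
  by apply: normc_tail_factor.
- by rewrite tpt_sqr ?(ltW r0)//; apply: pz_tail ta e0 (ltW r0).
- by rewrite tpt_inv ?(ltW r0)//; apply: pz_tail ta e0 ri.
have pE : p = (Num.sqrt rho ^+ N)%:C by rewrite /qhalf sg_real rmorphXn.
have p0 : 0 < Num.sqrt rho ^+ N by rewrite exprn_gt0// sqrtr_gt0 rho_gt0.
have zE : (tpt r ^+ 2) ^+ N = - (r ^+ N)%:C.
  rewrite tpt_sqr ?(ltW r0)// rmorphN exprNn -signr_odd oddN expr1 mulN1r.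
  by rewrite rmorphXn.
have key (x : R) : 0 < x -> 1 - - x%:C != 0 :> R[i].
  by move=> x0; rewrite opprK eq_complex /= negb_and gt_eqF// addr_gt0.
rewrite zE mulrN mulNr pE -!rmorphM; split; apply: key; rewrite !mulr_gt0// exprn_gt0//.
Qed.

(** [Hf_shift] at z = -r, rewritten for psi with the help of [Hf_Psi]. *)
Lemma Psi_rec eps a r : tame eps a -> 0 < eps -> 0 < r ->
  normc (Psi a (tpt r)) * normc (pz N a (- r)%:C) =
  rho ^+ N * r ^+ (2 * N) * (normc (Psi a (tpt (rho * r))) * normc (pz N a (- (rho * r)^-1)%:C)).
Proof.
move=> ta e0 r0; have [u0 _ h3 _ [h5 h6]] := good_tail ta e0 r0.
have rr0 : 0 < rho * r by rewrite mulr_gt0// rho_gt0.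
have [_ _ _ h4 _] := good_tail ta e0 rr0.
have e1 := Hf_shift hN q0 q1 u0 h5 h6 h3.
have e2 := Hf_Psi q1 h4.
rewrite sg_tpt e2 in e1; have := congr1 (@ComplexField.Normc.normc R) e1.
rewrite tpt_inv ?(ltW rr0)// tpt_sqr ?(ltW r0)//.
rewrite [in LHS]normcM [in RHS]normcM normcV [in X in _^-1 * X]normcM => ->.
rewrite [X in X^-1]normcM !normcX normc_real normrN gtr0_norm//.
by rewrite mulVKf// mulf_neq0// expf_neq0// gt_eqF// rho_gt0.
Qed.

(** For large r, |1 + a_j r| is |a_j| r up to a factor tending to 1. *)
Lemma pz_tail_lower eps a r x : tame eps a -> 0 < eps -> 0 < r -> x = r^-1 -> x <= eps ->
  (\prod_(1 <= j < (2 * N).+1) normc (a j)) * (r ^+ (2 * N) * (1 - x / eps) ^+ (2 * N)) <=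
  normc (pz N a (- r)%:C).
Proof.
move=> ta e0 r0 xE xe; have xr : x * r = 1 by rewrite xE mulVf// gt_eqF.
rewrite /pz normc_prod -exprMn.
have -> : (r * (1 - x / eps)) ^+ (2 * N) = \prod_(1 <= j < (2 * N).+1) (r * (1 - x / eps)).
  by rewrite prodr_const_nat subSS subn0.
rewrite -big_split /= big_seq [leRHS]big_seq; apply: ler_prod => j.
rewrite mem_index_iota ltnS => hj; have [/andP[h1 _] _] := ta j hj.
have xe1 : 0 <= 1 - x / eps by rewrite subr_ge0 ler_pdivrMr// mul1r.
rewrite !mulr_ge0 ?normc_ge0 ?(ltW r0)//=.
rewrite rmorphN mulrN opprK.
have := le_trans (ler_norm _) (ler_dist_normc (a j * r%:C) (- 1)).
rewrite opprK normcN normc1 normcM normc_real gtr0_norm// [a j * _ + 1]addrC => h.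
apply: le_trans h.
rewrite mulrA mulrBr mulr1 lerD2l lerN2.
have -> : normc (a j) * r * (x / eps) = normc (a j) / eps * (x * r) by ring.
by rewrite xr mulr1 ler_pdivlMr// mul1r.
Qed.

Lemma pz_tail_upper eps a y : tame eps a -> 0 < eps -> 0 <= y ->
  normc (pz N a (- y)%:C) <= (1 + y) ^+ (2 * N).
Proof.
move=> ta e0 y0; rewrite /pz normc_prod.
have -> : (1 + y) ^+ (2 * N) = \prod_(1 <= j < (2 * N).+1) (1 + y).
  by rewrite prodr_const_nat subSS subn0.
rewrite big_seq [leRHS]big_seq; apply: ler_prod => j.
rewrite mem_index_iota ltnS => hj; have [/andP[_ h1] _] := ta j hj.
rewrite normc_ge0 /=; apply: le_trans (normcBD _ _) _.
rewrite normc1 lerD2l normcM normc_real normrN ger0_norm// ler_piMl//; lra.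
Qed.

Lemma small_ratio (A B e : R) n : 0 < e -> A < B -> exists2 d : R, 0 < d &
  forall x, 0 <= x <= d -> x <= e / 2 /\
    A * (1 + x / rho) ^+ n <= B * (1 - x / e) ^+ n.
Proof.
move=> e0 AB.
pose h (x : R) := B * (1 - x / e) ^+ n - A * (1 + x / rho) ^+ n.
have ch : {for 0, continuous h}.
  have cx (b : R) : {for 0, continuous (fun x : R => x * b)}.
    by apply: continuousM; [exact: cvg_id|exact: cst_continuous].
  have cl (b : R) : {for 0, continuous (fun x : R => 1 + x * b)}.
    by apply: continuousD; [exact: cst_continuous|exact: cx].
  have cp (b : R) : {for 0, continuous (fun x : R => (1 + x * b) ^+ n)}.
    apply: (@continuous_comp _ _ _ (fun x : R => 1 + x * b) (fun y : R => y ^+ n)).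
      exact: cl.
    exact: exprn_continuous.
  have cc (c b : R) : {for 0, continuous (fun x : R => c * (1 + x * b) ^+ n)}.
    by apply: continuousM; [exact: cst_continuous|exact: cp].
  have -> : h = (fun x => B * (1 + x * - e^-1) ^+ n - A * (1 + x * rho^-1) ^+ n).
    by apply/funext => x; rewrite /h mulrN.
  by apply: continuousB; exact: cc.
have h0 : 0 < h 0 by rewrite /h !mul0r subr0 addr0 expr1n !mulr1 subr_gt0.
have /cvgrPdist_lt/(_ _ h0) /nbhs_ballP[d /= d0 hd] := ch.
exists (Num.min (d / 2) (e / 2)); first by rewrite lt_min !divr_gt0.
move=> x /andP[x0]; rewrite le_min => /andP[xd xe]; split => //.
have : `|h 0 - h x| < h 0.
  by apply: hd; rewrite /ball /= sub0r normrN ger0_norm//; lra.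
by rewrite ltr_norml => /andP[_]; rewrite /h; lra.
Qed.

(** One step r -> q r of the recurrence gains a factor that tends to
    q^N / |a_1 ... a_2N| as r grows, which is at most q^N / P < q^m. The constants
    depend on a through eps and P only. *)
Lemma Psi_decay (eps P : R) (m : nat) : 0 < eps -> 0 < P ->
  rho ^+ N < rho ^+ m * P -> exists K d : R, 0 < d /\
  forall a, tame eps a -> P <= \prod_(1 <= j < (2 * N).+1) normc (a j) ->
  forall r, 1 <= r -> normc (Psi a (tpt r)) * r ^+ m <= K * r `^ (- d).
Proof.
move=> e0 P0 hP; have r0 := rho_gt0.
(* Any number strictly between the limiting factor and q^m. *)
pose th := (rho ^+ N / P + rho ^+ m) / 2.
have hP' : rho ^+ N / P < rho ^+ m by rewrite ltr_pdivrMr.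
have NP0 : 0 < rho ^+ N / P by rewrite divr_gt0// exprn_gt0.
have th0 : 0 < th by rewrite divr_gt0// addr_gt0// exprn_gt0.
have thm : th < rho ^+ m by rewrite /th; lra.
have thN : rho ^+ N < th * P by rewrite -ltr_pdivrMr// /th; lra.
have [del del0 hdel] := small_ratio (2 * N) e0 thN.
pose R1 := Num.max rho^-1 del^-1.
have R1r : rho^-1 <= R1 by rewrite le_max lexx.
have R1d : del^-1 <= R1 by rewrite le_max lexx orbT.
have [M M0 hM] : exists2 M : R, 0 <= M &
    forall r, 1 <= r <= R1 -> normc (num N q (tpt r)) <= M.
  apply: (@normc_segment_bounded (fun r => num N q (tpt r))) => r /andP[r1 _].
  have rp : 0 < r by apply: lt_le_trans r1.
  apply: (@contC_comp _ _ (num N q : C -> C) (tpt : R -> C)); first exact: cont_tpt.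
  by apply: derivC_cont; apply: derivable_num => //; apply: tpt_neq0.
have [c c0 hc] := qpoch_lower q1 R1 e0.
have qR1 : 1 <= rho * R1 by rewrite -ler_pdivrMl// mulr1.
have B0 : 0 <= M / (c * c) ^+ (2 * N).
  by rewrite divr_ge0// exprn_ge0// mulr_ge0// ltW.
have [|K [d [d0 hK]]] := geometric_decay _ th0 thm B0 qR1; first by rewrite r0 q1.
exists K, d; split => // a ta hPa; apply: hK => //.
- by move=> r; exact: normc_ge0.
- move=> r hr; have /andP[r1 r2] := hr.
  have rp : 0 < r by apply: lt_le_trans r1.
  have ri : 0 <= r^-1 by rewrite invr_ge0 ltW.
  apply: Psi_le => //; first exact: hM.
  have key j y : (1 <= j <= 2 * N)%N -> 0 <= y <= R1 ->
      c <= normc (qpoch (a j * (- y)%:C) q).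
    move=> hj /andP[y0 y1]; apply: hc => [|k].
      rewrite normcM normc_real normrN ger0_norm//; apply: le_trans y1.
      by have [/andP[_ h2] _] := ta j hj; rewrite ler_piMl//; lra.
    exact: normc_tail_factor.
  move=> j hj; rewrite tpt_inv ?tpt_sqr ?(ltW rp)//; split; apply: key => //.
    by rewrite r2 ltW.
  rewrite ri /= (le_trans _ r2)// (le_trans _ r1)// invf_le1//.
- move=> r hr.
  have rp : 0 < r by apply: lt_le_trans hr; apply: lt_le_trans R1r; rewrite invr_gt0.
  have rr0 : 0 < rho * r by rewrite mulr_gt0.
  pose x := r^-1; have x0 : 0 < x by rewrite invr_gt0.
  have xd : x <= del.
    by rewrite /x -[del]invrK lef_pV2 ?posrE ?invr_gt0// (le_trans R1d).
  have [|xe hx] := hdel x; first by rewrite xd ltW.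
  have xe1 : 0 < 1 - x / eps by rewrite subr_gt0 ltr_pdivrMr//; lra.
  have := Psi_rec ta e0 rp.
  set Q := normc (Psi a (tpt r)); set Q' := normc (Psi a (tpt (rho * r))) => rec.
  have Q0 : 0 <= Q by exact: normc_ge0.
  have Q'0 : 0 <= Q' by exact: normc_ge0.
  have lo := pz_tail_lower ta e0 rp (erefl _ : x = _) (le_trans xe _).
  have {}lo := lo ltac:(lra).
  have up := pz_tail_upper ta e0 (y := (rho * r)^-1) _.
  have {}up := up ltac:(by rewrite invr_ge0 ltW).
  have xE : (rho * r)^-1 = x / rho by rewrite invfM mulrC.
  rewrite xE in up rec.
  pose T := r ^+ (2 * N) * (1 - x / eps) ^+ (2 * N).
  have rN : 0 < r ^+ (2 * N) by rewrite exprn_gt0.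
  have T0 : 0 < P * T by rewrite !mulr_gt0// exprn_gt0.
  rewrite -(ler_pM2r T0).
  have s1 : Q * (P * T) <= Q * normc (pz N a (- r)%:C).
    apply: ler_wpM2l => //; apply: le_trans lo; apply: ler_wpM2r => //.
    by rewrite mulr_ge0 ?exprn_ge0// ltW.
  apply: le_trans s1 _; rewrite rec.
  have s2 : rho ^+ N * r ^+ (2 * N) * (Q' * normc (pz N a (- (x / rho))%:C)) <=
      rho ^+ N * r ^+ (2 * N) * (Q' * (1 + x / rho) ^+ (2 * N)).
    apply: ler_wpM2l; first by rewrite mulr_ge0 ?exprn_ge0// ltW.
    exact: ler_wpM2l.
  apply: le_trans s2 _.
  have -> : rho ^+ N * r ^+ (2 * N) * (Q' * (1 + x / rho) ^+ (2 * N)) =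
    Q' * r ^+ (2 * N) * (rho ^+ N * (1 + x / rho) ^+ (2 * N)) by ring.
  have -> : th * Q' * (P * T) =
    Q' * r ^+ (2 * N) * (th * P * (1 - x / eps) ^+ (2 * N)) by rewrite /T; ring.
  by apply: ler_wpM2l => //; rewrite mulr_ge0// ltW.
Qed.

End Tail.

End PsiDecay.

(** * Convergent integrands and their q-shift *)

Section Admissible.
Variable R : realType.
Local Notation C := (R[i]^o).
Local Notation mu := (@lebesgue_measure R).
Variables (N : nat) (q : R[i]).
Hypothesis hN : (2 <= N)%N.
Hypothesis q0 : q != 0.
Hypothesis q1 : normc q < 1.

Notation rho := (normc q).
Notation Psi := (psi N q).
Notation tame := (@tame R N).
Notation slit := (@slit R N).
Notation tpt := (@tpt R).

Definition nprod (a : nat -> R[i]) : R := \prod_(1 <= j < (2 * N).+1) normc (a j).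

Definition in_disc (a : nat -> R[i]) := forall j, (1 <= j <= 2 * N)%N -> normc (a j) < 1.

(** On the tail psi_a(z) z^m decays like a negative power of r. The case m = 1 is
    the convergence of the integral I_N itself. *)
Definition conv (m : nat) (a : nat -> R[i]) := odd N ->
  [/\ 0 < q, slit a & rho ^+ N < rho ^+ m * nprod a].

(** The multipliers of psi; those that occur are Laurent polynomials in z. *)
Definition reg (h : R[i] -> R[i]) := forall z : C, z != 0 -> derivable (h : C -> C) z 1.

Definition Psimul a (h : R[i] -> R[i]) : R[i] -> R[i] := fun u => Psi a u * h (u ^+ 2).
Notation Psih := Psimul.

Lemma Psi_opp a u : Psi a (- u) = (-1) ^+ N * Psi a u.
Proof.
have vN : (- u) ^+ N = (-1) ^+ N * u ^+ N by exact: exprNn.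
rewrite /psi /num /den sqrrN vN invfM -signr_odd.
rewrite [((-1) ^+ odd N)^-1](_ : _ = (-1) ^+ odd N); last first.
  by case: odd; rewrite ?invrN invr1.
by rewrite -mulrBr; ring.
Qed.

Lemma Psih_opp a h u : Psih a h (- u) = (-1) ^+ N * Psih a h u.
Proof. by rewrite /Psimul Psi_opp sqrrN; exact: (esym (mulrA _ _ _)). Qed.

Lemma good_opp a u : good N q a u -> good N q a (- u).
Proof.
rewrite /good /den sqrrN => -[h1 h2 h3 h4 h5]; split => //.
by rewrite oppr_eq0.
Qed.

Lemma tpt_opp r : 0 +i* - Num.sqrt r = - tpt r.
Proof. by apply/eqP; rewrite eq_complex /= oppr0 !eqxx. Qed.

Lemma derivC_comp_sqr (h : R[i] -> R[i]) (u : C) : u != 0 -> reg h ->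
  derivable (fun u : C => h (u ^+ 2) : C) u 1.
Proof.
move=> u0 rh; apply: (@derivC_comp _ (fun u : C => u ^+ 2 : C) (h : C -> C)); first exact: derivC_sqr.
by apply: rh; rewrite expf_neq0.
Qed.

Lemma derivable_Psih a h (u : C) : good N q a u -> reg h -> derivable (Psih a h : C -> C) u 1.
Proof.
case=> u0 du _ _ _ rh; apply: derivableM; first exact: derivable_Psi.
exact: derivC_comp_sqr.
Qed.

Lemma circle_cintg (f : R[i] -> R[i]) : (forall u : C, normc u = 1 -> derivable (f : C -> C) u 1) ->
  cintg `[- pi, pi] (fun t => f (upt t)).
Proof.
move=> df; apply: cont_cintg => t _; apply: (@contC_comp _ _ (f : C -> C) (@upt R : R -> C)).
  have -> : (@upt R : R -> C) = (fun t => cis (2^-1 * t)) by apply/funext => x; rewrite uptE.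
  exact: (cder1_cont (cder1_cisl _ _)).
by apply: derivC_cont; apply: df; rewrite uptE normc_cis.
Qed.

Lemma adm_circle a h : in_disc a -> reg h ->
  cintg `[- pi, pi] (fun t => Psih a h (upt t)).
Proof.
move=> sa rh; apply: circle_cintg => u nu; apply: derivable_Psih => //.
exact: good_circle.
Qed.

Lemma tail_integrable (K d : R) : 0 < d ->
  mu.-integrable `[1, +oo[ (EFin \o (fun r : R => K * (r `^ (- d) * r^-1))).
Proof.
move=> d0; have := integrable_powR_tail d0 => h.
by have := @integrableZl _ _ _ mu `[1, +oo[%classic (ltac:(exact: measurable_itv)) K _ h.
Qed.

Section Tail.
Hypothesis oddN : odd N.
Hypothesis qpos : 0 < q.

Lemma tailf_Psih a h r : 0 <= r ->
  tailf (Psih a h) r = 2 * (Psi a (tpt r) * h (- r)%:C) * (r^-1)%:C.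
Proof.
move=> r0; rewrite /tailf tpt_opp Psih_opp -signr_odd oddN expr1 mulN1r opprK.
by rewrite /Psimul tpt_sqr//; ring.
Qed.

Lemma tailf_Psih_le a h K L d m r : 1 <= r -> 0 <= K -> 0 <= L ->
  normc (Psi a (tpt r)) * r ^+ m <= K * r `^ (- d) ->
  normc (h (- r)%:C) <= L * r ^+ m ->
  normc (tailf (Psih a h) r) <= 2 * K * L * (r `^ (- d) * r^-1).
Proof.
move=> r1 K0 L0 h1 h2; have r0 : 0 < r by apply: lt_le_trans r1.
rewrite tailf_Psih ?(ltW r0)// 3!normcM normc_real gtr0_norm ?invr_gt0//.
have -> : normc (2 : R[i]) = 2.
  by have := @normc_real R 2; rewrite rmorph_nat ger0_norm.
rewrite [leRHS]mulrA ler_wpM2r ?invr_ge0 ?(ltW r0)// -!mulrA ler_pM2l//.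
apply: (@le_trans _ _ (normc (Psi a (tpt r)) * (L * r ^+ m))).
  by rewrite ler_wpM2l// normc_ge0.
by rewrite mulrCA [K * _]mulrCA ler_wpM2l.
Qed.

Lemma tailf_Psih_cont eps a h r : tame eps a -> 0 < eps -> reg h -> 0 < r ->
  {for r, continuous (tailf (Psih a h) : R -> C)}.
Proof.
move=> ta e0 rh r0; have gd := good_tail q0 q1 oddN qpos ta e0 r0.
apply: tailf_cont; [exact: r0|exact: (derivable_Psih gd rh)|].
by rewrite tpt_opp; apply: (derivable_Psih (good_opp gd) rh).
Qed.

Lemma cintg_tail eps a h K L d m : tame eps a -> 0 < eps -> reg h ->
  0 <= K -> 0 <= L -> 0 < d ->
  (forall r, 1 <= r -> normc (Psi a (tpt r)) * r ^+ m <= K * r `^ (- d)) ->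
  (forall r, 1 <= r -> normc (h (- r)%:C) <= L * r ^+ m) ->
  cintg `[1, +oo[ (tailf (Psih a h)).
Proof.
move=> ta e0 rh K0 L0 d0 h1 h2.
apply: (@cintg_dominated _ _ _ (fun r : R => 2 * K * L * (r `^ (- d) * r^-1))).
- exact: measurable_itv.
- move=> r; rewrite /= in_itv /= andbT => r1; apply: (tailf_Psih_cont ta) => //.
  exact: lt_le_trans r1.
- exact: tail_integrable.
- move=> r; rewrite /= in_itv /= andbT => r1.
  by apply: (tailf_Psih_le r1 K0 L0 (h1 r r1) (h2 r r1)).
Qed.

Lemma decay_nonneg eps P m : 0 < eps -> 0 < P -> rho ^+ N < rho ^+ m * P ->
  exists K d : R, [/\ 0 <= K, 0 < d &
  forall a, tame eps a -> P <= nprod a ->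
  forall r, 1 <= r -> normc (Psi a (tpt r)) * r ^+ m <= K * r `^ (- d)].
Proof.
move=> e0 P0 hP; have [K [d [d0 hK]]] := Psi_decay hN q0 q1 oddN qpos e0 P0 hP.
exists `|K|, d; split => // a ta Pa r r1; apply: le_trans (hK a ta Pa r r1) _.
by rewrite ler_wpM2r ?powR_ge0// ler_norm.
Qed.

End Tail.

Lemma nprod_gt0 a : slit a -> 0 < nprod a.
Proof.
move=> sa; rewrite /nprod big_seq; apply: prodr_gt0 => j.
by rewrite mem_index_iota ltnS => /sa[h _ _]; rewrite normc_gt0.
Qed.

Lemma adm_Psih m a h : in_disc a -> conv m a -> reg h ->
  (odd N -> exists2 L : R, 0 <= L & forall r, 1 <= r -> normc (h (- r)%:C) <= L * r ^+ m) ->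
  contour_cintg N (Psih a h).
Proof.
move=> sa ca rh th; split; first exact: adm_circle.
move=> oN; have [qpos sl hP] := ca oN; have [L L0 hL] := th oN.
have [eps e0 ta] := tame_self sl.
have [K [d [K0 d0 hK]]] := decay_nonneg oN qpos e0 (nprod_gt0 sl) hP.
exact: (cintg_tail oN qpos ta e0 rh K0 L0 d0 (hK a ta (lexx _)) hL).
Qed.

End Admissible.

Section Shift.
Variable R : realType.
Local Notation C := (R[i]^o).
Variables (N : nat) (q : R[i]).
Hypothesis hN : (2 <= N)%N.
Hypothesis q0 : q != 0.
Hypothesis q1 : normc q < 1.

Notation sg := (sqrtC q).
Notation Psih := (@Psimul R N q).
Notation reg := (@reg R).

Lemma cfun_combine (f g : R[i] -> R[i]) (c : R[i]) : contour_cintg N f -> contour_cintg N g ->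
  cfun N (fun u => f u + c * g u) = cfun N f + c * cfun N g.
Proof. by move=> af ag; rewrite cfunD ?cfunZ//; exact: admZ. Qed.

Definition on_contour (u : R[i]) :=
  normc u = 1 \/ odd N /\ exists2 r, 1 <= r & u = @tpt R r \/ u = - @tpt R r.

Lemma cfun_on_contour f g : (forall u, on_contour u -> f u = g u) -> cfun N f = cfun N g.
Proof.
move=> h; apply: cfun_eq => [t|oN r r1].
  by apply: h; left; rewrite uptE normc_cis.
rewrite /tailf tpt_opp; congr ((_ - _) * _); apply: h; right; split => //; exists r => //.
  by left.
by right.
Qed.

Lemma adm_on_contour f g : (forall u, on_contour u -> f u = g u) -> contour_cintg N f -> contour_cintg N g.
Proof.
move=> h; apply: adm_eq => [t|oN r r1].
  by apply: h; left; rewrite uptE normc_cis.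
rewrite /tailf tpt_opp; congr ((_ - _) * _); apply: h; right; split => //; exists r => //.
  by left.
by right.
Qed.

Lemma good_contour a u : in_disc N a -> (odd N -> 0 < q /\ slit N a) -> on_contour u ->
  good N q a u.
Proof.
move=> sa ho [nu|[oN [r r1 hu]]]; first exact: good_circle.
have [qpos sl] := ho oN; have [eps e0 ta] := tame_self sl.
have r0 : 0 < r by apply: lt_le_trans r1.
have gd := good_tail q0 q1 oN qpos ta e0 r0.
by case: hu => ->; [exact: gd|exact: good_opp].
Qed.

(** For f = A Hf_a + B Hf_b the integrals of f (u) and f (sg u) agree, and S is
    the difference of the integrands. It is enough that f and S are integrable,
    which is easier to see than for f (sg u). *)
Lemma contour_shift (a b : nat -> R[i]) (A B S : R[i] -> R[i]) :
  in_disc N a -> in_disc N b -> (odd N -> [/\ 0 < q, slit N a & slit N b]) ->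
  reg A -> reg B ->
  contour_cintg N (fun u => Psih a (fun z => A z * pz N a z^-1) u + Psih b (fun z => B z * pz N b z^-1) u) ->
  contour_cintg N S ->
  (forall u, on_contour u -> S u =
    Psih a (fun z => A z * pz N a z^-1 - A (q * z) * (q ^+ N * z ^+ (2 * N))^-1 * pz N a z) u +
    Psih b (fun z => B z * pz N b z^-1 - B (q * z) * (q ^+ N * z ^+ (2 * N))^-1 * pz N b z) u) ->
  cfun N S = 0.
Proof.
move=> sa sb ho rA rB aL aS hS.
(* Holomorphic also at z = a_j and z = b_j, unlike its expression through psi. *)
pose f (u : R[i]) : R[i] := Hf N q a u * A (u ^+ 2) + Hf N q b u * B (u ^+ 2).
pose L (u : R[i]) := Psih a (fun z => A z * pz N a z^-1) u + Psih b (fun z => B z * pz N b z^-1) u.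
have ga u : on_contour u -> good N q a u.
  by apply: good_contour => // /ho[].
have gb u : on_contour u -> good N q b u.
  by apply: good_contour => // /ho[].
have fL u : on_contour u -> f u = L u.
  move=> hu; have [_ _ _ h1 _] := ga u hu; have [_ _ _ h2 _] := gb u hu.
  by rewrite /f /L /Psimul (Hf_Psi q1 h1) (Hf_Psi q1 h2); ring.
have df u : u != 0 -> Hden N q a u != 0 -> Hden N q b u != 0 -> derivable (f : C -> C) u 1.
  move=> u0 h1 h2; apply: derivableD; apply: derivableM; try exact: derivC_comp_sqr.
    exact: derivable_Hf.
  exact: derivable_Hf.
have dfc u : on_contour u -> derivable (f : C -> C) u 1.
  move=> hu; have g1 := ga u hu; have g2 := gb u hu.
  by apply: df; [case: g1|exact: good_Hden g1|exact: good_Hden g2].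
have af : contour_cintg N f by apply: adm_on_contour aL => u hu; rewrite fL.
have E : cfun N f = cfun N (fun u => f (sg * u)).
  apply: (cfun_shift (sg_sqr q) q0 q1).
  - by move=> oN; have [qpos _ _] := ho oN; apply: gtc0_real; rewrite sqrtC_gt0.
  - move=> u hu; have u0 : u != 0.
      rewrite -normc_eq0 -sqrf_eq0 gt_eqF//; case/andP: hu => hu _.
      by apply: lt_le_trans hu; rewrite normc_gt0.
    by apply: df => //; apply: Hden_annulus.
  - move=> eN u; have num_opp : num N q (- u) = num N q u.
      rewrite /num sqrrN exprNn -signr_odd (negPf eN) mul1r //.
    by rewrite /f /Hf /Hden num_opp sqrrN.
  - move=> oN r r1; rewrite tpt_opp; split; apply: dfc; right; split => //; exists r => //.
      by left.
    by right.
  - by case: af.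
have E2 : cfun N (fun u => f (sg * u)) = cfun N (fun u => f u + (- 1) * S u).
  apply: cfun_on_contour => u hu; have [u0 _ h3 h4 [h5 h6]] := ga u hu.
  have [_ _ h3' h4' _] := gb u hu.
  rewrite (fL u hu) (hS u hu) /f /L (Hf_shift hN q0 q1 u0 h5 h6 h3) (Hf_shift hN q0 q1 u0 h5 h6 h3').
  have -> : (sg * u) ^+ 2 = q * u ^+ 2 by rewrite exprMn sg_sqr.
  by rewrite /Psimul; ring.
move: E; rewrite E2 cfun_combine// => /eqP; rewrite mulN1r -subr_eq0 opprB addrCA subrr addr0.
by move/eqP.
Qed.

End Shift.

(** * Holomorphic dependence on one variable *)

Section ParamDep.
Variable R : realType.
Local Notation C := (R[i]^o).
Local Notation mu := (@lebesgue_measure R).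
Variables (N : nat) (q : R[i]).
Hypothesis hN : (2 <= N)%N.
Hypothesis q0 : q != 0.
Hypothesis q1 : normc q < 1.

Notation rho := (normc q).
Notation Psih := (@Psimul R N q).
Notation reg := (@reg R).
Notation tpt := (@tpt R).

Lemma prod_set_param (a : nat -> R[i]) j t : (1 <= j <= 2 * N)%N ->
  \prod_(1 <= k < (2 * N).+1) set_param a j t k =
  t * \prod_(1 <= k < (2 * N).+1 | k != j) a k.
Proof.
move=> hj; rewrite (bigD1_seq j) ?iota_uniq ?mem_index_iota ?ltnS//=.
rewrite {1}/set_param eqxx; congr (_ * _); apply: eq_bigr => k kj.
by rewrite /set_param (negPf kj).
Qed.

Lemma set_param_id (a : nat -> R[i]) j : set_param a j (a j) = a.
Proof. by apply/funext => k; rewrite /set_param; case: eqP => [->|]. Qed.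

Lemma nprodE (a : nat -> R[i]) : nprod N a = normc (\prod_(1 <= k < (2 * N).+1) a k).
Proof. by rewrite normc_prod. Qed.

Lemma nprod_set_param (a : nat -> R[i]) j t : (1 <= j <= 2 * N)%N ->
  nprod N (set_param a j t) * normc (a j) = normc t * nprod N a.
Proof.
move=> hj; rewrite -[in RHS](set_param_id a j) !nprodE !prod_set_param// !normcM.
by ring.
Qed.

Lemma tame_small eps (a : nat -> R[i]) : 0 < eps -> tame N eps a -> in_disc N a.
Proof. by move=> e0 ta j hj; have [/andP[_ h] _] := ta j hj; lra. Qed.

Lemma derivable_set_param (a : nat -> R[i]) j k (t : C) :
  derivable (fun t : C => set_param a j t k : C) t 1.
Proof. by rewrite /set_param; case: eqP => _; [exact: derivable_id|exact: derivable_cst]. Qed.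

Lemma derivable_Psih_param (a : nat -> R[i]) j (h : R[i] -> R[i] -> R[i]) (u t : C) :
  good N q (set_param a j t) u ->
  (forall z : R[i], z != 0 -> forall t : C, derivable (fun t : C => h t z : C) t 1) ->
  derivable (fun t : C => Psih (set_param a j t) (h t) u : C) t 1.
Proof.
move=> [u0 du _ _ _] dh; apply: derivableM; first exact: derivable_Psi_param.
by apply: dh; rewrite expf_neq0.
Qed.

(** Near b_j the bounds on psi and h are uniform, so [derivable_cintegral]
    applies to the circle and to the tail. *)
Lemma cfun_param_derivable (b : nat -> R[i]) j (h : R[i] -> R[i] -> R[i]) (L e : R) :
  odd N -> 0 < q -> slit N b -> (1 <= j <= 2 * N)%N -> rho ^+ N < nprod N b ->
  (forall t, reg (h t)) ->
  (forall z : R[i], z != 0 -> forall t : C, derivable (fun t : C => h t z : C) t 1) ->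
  0 <= L -> 0 < e ->
  (forall t, normc (t - b j) <= e -> forall z, 1 <= normc z -> normc (h t z) <= L) ->
  derivable (fun t : C => cfun N (Psih (set_param b j t) (h t)) : C) (b j) 1.
Proof.
move=> oN qpos sl hj hP rh dh L0 e0 hL.
have [eps eps0 htame] := tame_near sl.
have nb0 := nprod_gt0 sl.
have bj0 : 0 < normc (b j) by have [] := sl j hj; rewrite normc_gt0.
(* A lower bound for the product of the moduli near b that still ensures decay. *)
pose P := (rho ^+ N + nprod N b) / 2.
have P0 : 0 < P by rewrite divr_gt0// addr_gt0// exprn_gt0// normc_gt0.
have PN : rho ^+ N < rho ^+ 0 * P by rewrite expr0 mul1r /P; lra.
have Pb : P < nprod N b by rewrite /P; lra.
pose r := Num.min eps (Num.min e (normc (b j) * (1 - P / nprod N b))).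
have r0 : 0 < r.
  by rewrite !lt_min eps0 e0 mulr_gt0// subr_gt0 ltr_pdivrMr// mul1r.
have r1 : r <= eps by rewrite ge_min lexx.
have r2 : r <= e by rewrite ge_min [X in _ || X]ge_min lexx !orbT.
have r3 : r <= normc (b j) * (1 - P / nprod N b).
  by rewrite ge_min [X in _ || X]ge_min lexx !orbT.
have tm t : normc (t - b j) <= r -> tame N eps (set_param b j t).
  move=> ht; apply: htame => k _; rewrite /set_param; case: eqP => [->|_].
    exact: le_trans ht r1.
  by rewrite subrr normc0 ltW.
have Pt t : normc (t - b j) <= r -> P <= nprod N (set_param b j t).
  move=> ht; rewrite -(ler_pM2r bj0) nprod_set_param//.
  have := le_trans (ler_norm _) (ler_dist_normc (b j) t); rewrite normcB => h1.
  have h2 : normc (b j) * (P / nprod N b) <= normc t by lra.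
  have := ler_wpM2r (ltW nb0) h2; rewrite -mulrA divfK ?gt_eqF// mulrC.
  exact.
have sm t : normc (t - b j) <= r -> in_disc N (set_param b j t).
  by move=> /tm; exact: tame_small.
have [K [d [K0 d0 hK]]] := decay_nonneg hN q0 q1 oN qpos eps0 P0 PN.
have [M M0 hM] := Psi_circle_bounded hN q1 eps0.
have hLt t : normc (t - b j) <= r -> forall s, 1 <= s -> normc (h t (- s)%:C) <= L * s ^+ 0.
  move=> ht s s1; rewrite expr0 mulr1; apply: hL; first exact: le_trans ht r2.
  by rewrite normc_real normrN ger0_norm// ltW// (lt_le_trans ltr01).
have gt t s : normc (t - b j) <= r -> 1 <= s -> good N q (set_param b j t) (tpt s).
  by move=> /tm ht s1; apply: (good_tail q0 q1 oN qpos ht eps0); apply: lt_le_trans s1.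
rewrite (_ : (fun t => _) = fun t : C =>
   (2 * pi)^-1%:C * cintegral `[- pi, pi] (fun x => Psih (set_param b j t) (h t) (upt x)) +
   (0 +i* (2 * pi))^-1 * cintegral `[1, +oo[ (tailf (Psih (set_param b j t) (h t)))); last first.
  by apply/funext => t; rewrite /cfun oN.
apply: derivableD; apply: derivC_cM.
  apply: (@derivable_cintegral R `[- pi, pi]%classic
    (fun t x => Psih (set_param b j t) (h t) (upt x)) (fun=> M * L) (b j) r r0).
  - exact: measurable_itv.
  - exact: seg_integrable_cst.
  - by move=> t ht; apply: adm_circle => //; exact: sm.
  - move=> t x ht; rewrite /= in_itv /= => hx; rewrite /Psimul normcM.
    apply: ler_pM; rewrite ?normc_ge0//; first by apply: hM => //; exact: tm.
    apply: hL; first exact: le_trans ht r2.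
    by rewrite uptE normcX normc_cis expr1n.
  - move=> t x ht _; apply: (@derivable_Psih_param b j h (upt x) t); last exact: dh.
    by apply: good_circle => //; [exact: sm|rewrite uptE normc_cis].
apply: (@derivable_cintegral R `[1, +oo[%classic
    (fun t x => tailf (Psih (set_param b j t) (h t)) x)
    (fun x => 2 * K * L * (x `^ (- d) * x^-1)) (b j) r r0).
- exact: measurable_itv.
- exact: tail_integrable.
- move=> t ht; have hKt := hK _ (tm t ht) (Pt t ht).
  exact: (cintg_tail hN q0 q1 oN qpos (tm t ht) eps0 (rh t) K0 L0 d0 hKt (hLt t ht)).
- move=> t x ht; rewrite /= in_itv /= andbT => x1.
  apply: (tailf_Psih_le oN x1 K0 L0 _ (hLt t ht x x1)).
  by apply: hK => //; [exact: tm|exact: Pt].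
- move=> t x ht; rewrite /= in_itv /= andbT => x1.
  have x0 : 0 <= x by apply: le_trans x1.
  rewrite (_ : (fun _ => _) = fun t : C =>
     (2 * (x^-1)%:C) * Psih (set_param b j t) (h t) (tpt x)); last first.
    apply/funext => s; rewrite tailf_Psih// /Psimul tpt_sqr//.
    by rewrite mulrAC.
  apply: derivC_cM; apply: (@derivable_Psih_param b j h (tpt x) t); last exact: dh.
  exact: gt.
Qed.

End ParamDep.

(** * First contour relation *)

Section Regular.
Variable R : realType.
Local Notation C := (R[i]^o).
Notation reg := (@reg R).
Implicit Types h k : R[i] -> R[i].

Lemma reg_cst (c : R[i]) : reg (fun=> c).
Proof. by move=> z _; exact: derivable_cst. Qed.

Lemma reg_id : reg (fun z => z).
Proof. by move=> z _; exact: derivable_id. Qed.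

Lemma regM h k : reg h -> reg k -> reg (fun z => h z * k z).
Proof. by move=> rh rk z z0; apply: derivableM; [exact: rh|exact: rk]. Qed.

Lemma regD h k : reg h -> reg k -> reg (fun z => h z + k z).
Proof. by move=> rh rk z z0; apply: derivableD; [exact: rh|exact: rk]. Qed.

Lemma regB h k : reg h -> reg k -> reg (fun z => h z - k z).
Proof. by move=> rh rk z z0; apply: derivableB; [exact: rh|exact: rk]. Qed.

Lemma regX h n : reg h -> reg (fun z => h z ^+ n).
Proof. by move=> rh z z0; apply: derivC_X; exact: rh. Qed.

Lemma regV h : reg h -> (forall z, z != 0 -> h z != 0) -> reg (fun z => (h z)^-1).
Proof. by move=> rh h0 z z0; apply: derivableV; [exact: h0|exact: rh]. Qed.

Lemma reg_inv : reg (fun z => z^-1).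
Proof. by apply: regV; [exact: reg_id|]. Qed.

Lemma reg_prod (I : eqType) (s : seq I) (P : pred I) (f : I -> R[i] -> R[i]) :
  (forall i, reg (f i)) -> reg (fun z => \prod_(i <- s | P i) f i z).
Proof. by move=> rf z z0; apply: derivC_prod => i _; exact: rf. Qed.

Lemma reg_pz N a h : reg h -> reg (fun z => pz N a (h z)).
Proof.
move=> rh; apply: reg_prod => j; apply: regB; first exact: reg_cst.
by apply: regM; [exact: reg_cst|exact: rh].
Qed.

(** Replace the factors one at a time. *)
Lemma prod_perturb (I : eqType) (s : seq I) (c e : I -> R[i]) (eps : R) : 0 <= eps ->
  (forall i, i \in s -> normc (c i) <= 1) -> (forall i, i \in s -> normc (e i) <= eps) ->
  normc (\prod_(i <- s) (c i + e i) - \prod_(i <- s) c i) <=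
  (size s)%:R * (1 + eps) ^+ size s * eps.
Proof.
move=> e0; elim: s => [|i s ih] hc he.
  by rewrite !big_nil subrr normc0 mulr0n !mul0r.
have hc' (k : I) : k \in s -> normc (c k) <= 1 by move=> ks; apply: hc; rewrite inE ks orbT.
have he' (k : I) : k \in s -> normc (e k) <= eps by move=> ks; apply: he; rewrite inE ks orbT.
have ci : normc (c i) <= 1 by apply: hc; rewrite inE eqxx.
have ei : normc (e i) <= eps by apply: he; rewrite inE eqxx.
rewrite !big_cons; set X' := \prod_(j <- s) (c j + e j); set X := \prod_(j <- s) c j.
have -> : (c i + e i) * X' - c i * X = e i * X' + c i * (X' - X) by ring.
have hX' : normc X' <= (1 + eps) ^+ size s.
  have -> : (1 + eps) ^+ size s = \prod_(j <- s) (1 + eps).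
    by rewrite big_const_seq count_predT -Monoid.iteropE.
  rewrite /X' normc_prod.
  rewrite big_seq [leRHS]big_seq; apply: ler_prod => k ks; rewrite normc_ge0 /=.
  by apply: le_trans (normcD _ _) _; apply: lerD; [exact: hc'|exact: he'].
apply: le_trans (normcD _ _) _; rewrite !normcM.
have {ih}ih := ih hc' he'.
have n1 : normc (e i) * normc X' <= eps * (1 + eps) ^+ size s.
  by apply: ler_pM; rewrite ?normc_ge0.
have n2 : normc (c i) * normc (X' - X) <= (size s)%:R * (1 + eps) ^+ size s * eps.
  by apply: le_trans ih; rewrite ler_piMl// normc_ge0.
have p0 : 0 <= (1 + eps) ^+ size s by rewrite exprn_ge0// addr_ge0.
apply: le_trans (lerD n1 n2) _ => /=; rewrite -natr1 exprS.
have s0 : 0 <= (size s)%:R :> R by rewrite ler0n.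
have -> : ((size s)%:R + 1) * ((1 + eps) * (1 + eps) ^+ size s) * eps =
  eps * (1 + eps) ^+ size s + (size s)%:R * (1 + eps) ^+ size s * eps +
  ((size s)%:R + 1) * (eps * eps) * (1 + eps) ^+ size s by ring.
by rewrite lerDl mulr_ge0// mulr_ge0 ?mulr_ge0// addr_ge0.
Qed.

End Regular.

Section StepOne.
Variable R : realType.
Local Notation C := (R[i]^o).
Variables (N : nat) (q : R[i]).
Hypothesis hN : (2 <= N)%N.
Hypothesis q0 : q != 0.
Hypothesis q1 : normc q < 1.

Notation rho := (normc q).
Notation Psih := (@Psimul R N q).
Notation reg := (@reg R).
Notation tpt := (@tpt R).
Notation "'Pr' a" := (\prod_(1 <= j < (2 * N).+1) a j) (at level 10, a at level 8).
Implicit Types a b : nat -> R[i].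

Definition dz (z : R[i]) := z - z^-1.

Lemma reg_dz : reg dz.
Proof. by apply: regB; [exact: reg_id|exact: reg_inv]. Qed.

Definition q_ratio : R[i] := q / q ^+ N.
(** For N odd, lam b = 1 is the first pole of the continuation of I_N. *)
Definition lam b : R[i] := q_ratio * Pr b.
(** What remains of psi_b (z - 1/z) (1 - lam b) when the vanishing integral of the
    shift relation for z Hf_b is subtracted. *)
Definition step_fun b (z : R[i]) : R[i] := (1 - lam b) * dz z - z * pz N b z^-1 +
  q_ratio * z * (z ^+ (2 * N))^-1 * pz N b z.

Lemma reg_gfun b : reg (step_fun b).
Proof.
apply: regD; first apply: regB.
- by apply: regM; [exact: reg_cst|exact: reg_dz].
- by apply: regM; [exact: reg_id|apply: reg_pz; exact: reg_inv].
apply: regM; last by apply: reg_pz; exact: reg_id.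
apply: regM; first by apply: regM; [exact: reg_cst|exact: reg_id].
by apply: regV; [apply: regX; exact: reg_id|move=> z z0; rewrite expf_neq0].
Qed.

Lemma pz_inv b z : z != 0 -> pz N b z = z ^+ (2 * N) * \prod_(1 <= j < (2 * N).+1) (- b j + z^-1).
Proof.
move=> z0; have -> : z ^+ (2 * N) = \prod_(1 <= j < (2 * N).+1) z.
  by rewrite prodr_const_nat subSS subn0.
rewrite -big_split /=; apply: eq_bigr => j _.
by rewrite mulrDr mulfV// addrC mulrN mulrC.
Qed.

Lemma prod_opp b : \prod_(1 <= j < (2 * N).+1) (- b j) = Pr b.
Proof.
under eq_bigr do rewrite -mulN1r.
by rewrite big_split /= prodr_const_nat subSS subn0 mulnC exprM sqrr_sign mul1r.
Qed.

Lemma gfunE b z : z != 0 -> step_fun b z = z * (1 - pz N b z^-1) +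
  q_ratio * z * (\prod_(1 <= j < (2 * N).+1) (- b j + z^-1) - \prod_(1 <= j < (2 * N).+1) (- b j)) -
  (1 - lam b) * z^-1.
Proof.
move=> z0; have zn : z ^+ (2 * N) != 0 by rewrite expf_neq0.
rewrite /step_fun /dz (pz_inv b z0) -[_ * (_ * _) in LHS]mulrA mulKf// prod_opp /lam; ring.
Qed.

Lemma pz_near1 b z : (forall j, (1 <= j <= 2 * N)%N -> normc (b j) <= 1) -> 1 <= normc z ->
  normc (1 - pz N b z^-1) <= (2 * N)%:R * 2 ^+ (2 * N) * (normc z)^-1.
Proof.
move=> hb z1; have z0 : 0 < normc z by apply: lt_le_trans z1.
have zi : 0 <= (normc z)^-1 by rewrite invr_ge0 ltW.
have zi1 : (normc z)^-1 <= 1 by rewrite invf_le1.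
have := @prod_perturb R nat (index_iota 1 (2 * N).+1) (fun=> 1) (fun j => - (b j * z^-1)) _ zi.
rewrite big1_eq size_iota subSS subn0 normcB => h.
apply: le_trans (h _ _) _.
- by move=> j _; rewrite normc1.
- move=> j; rewrite mem_index_iota ltnS normcN normcM normcV => hj.
  by rewrite ler_piMl// hb.
rewrite ler_wpM2r// ler_wpM2l ?ler0n// lerXn2r ?nnegrE ?addr_ge0//.
by have : 1 + (normc z)^-1 <= 2 by lra.
Qed.

Lemma normc_prod_le1 b : (forall j, (1 <= j <= 2 * N)%N -> normc (b j) <= 1) ->
  normc (Pr b) <= 1.
Proof.
move=> hb; rewrite normc_prod big_seq; apply: prodr_ile1 => j.
by rewrite mem_index_iota ltnS normc_ge0 => /hb.
Qed.

(** The terms of order z cancel because lam b is q^(1-N) times the product of the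
    b_j; the form [gfunE] exhibits this as differences of two nearby products. *)
Lemma gfun_bounded : exists2 L : R, 0 <= L & forall b,
  (forall j, (1 <= j <= 2 * N)%N -> normc (b j) <= 1) ->
  forall z, 1 <= normc z -> normc (step_fun b z) <= L.
Proof.
pose M : R := (2 * N)%:R * 2 ^+ (2 * N).
have M0 : 0 <= M by rewrite mulr_ge0 ?ler0n// exprn_ge0.
have k0 := normc_ge0 q_ratio.
exists (M + normc q_ratio * M + (1 + normc q_ratio)) => [|b hb z z1].
  by rewrite !addr_ge0// mulr_ge0.
have z0 : 0 < normc z by apply: lt_le_trans z1.
have zi : 0 <= (normc z)^-1 by rewrite invr_ge0 ltW.
have zi1 : (normc z)^-1 <= 1 by rewrite invf_le1.
rewrite gfunE -?normc_gt0//.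
apply: le_trans (normcBD _ _) _; apply: lerD; first (apply: le_trans (normcD _ _) _; apply: lerD).
- rewrite normcM; have := ler_wpM2l (ltW z0) (pz_near1 hb z1).
  by rewrite -/M mulrCA mulfV ?gt_eqF// mulr1.
- rewrite 2!normcM -mulrA; apply: ler_wpM2l => //.
  have h := @prod_perturb R nat (index_iota 1 (2 * N).+1) (fun j => - b j) (fun=> z^-1) _ zi.
  have {}h := ler_wpM2l (ltW z0) (h _ _).
  apply: le_trans (h _ _) _.
  + by move=> j; rewrite mem_index_iota ltnS normcN; exact: hb.
  + by move=> j _; rewrite normcV.
  rewrite size_iota subSS subn0 mulrCA mulfV ?gt_eqF// mulr1.
  rewrite ler_wpM2l ?ler0n// lerXn2r ?nnegrE ?addr_ge0//.
  by have : 1 + (normc z)^-1 <= 2 by lra.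
rewrite normcM normcV -[leRHS]mulr1; apply: ler_pM; rewrite ?normc_ge0//.
apply: le_trans (normcBD _ _) _; rewrite normc1 lerD2l normcM.
by rewrite ler_piMr// normc_prod_le1.
Qed.

Lemma tail_dz : exists2 L : R, 0 <= L & forall r, 1 <= r -> normc (dz (- r)%:C) <= L * r ^+ 1.
Proof.
exists 2 => // r r1; have r0 : 0 < r by apply: lt_le_trans r1.
apply: le_trans (normcBD _ _) _; rewrite normcV normc_real normrN gtr0_norm//.
have : r^-1 <= 1 by rewrite invf_le1.
by rewrite expr1; lra.
Qed.

Lemma small_le1 b : in_disc N b -> forall j, (1 <= j <= 2 * N)%N -> normc (b j) <= 1.
Proof. by move=> sb j hj; apply/ltW/sb. Qed.

Lemma tail_gfun b : in_disc N b ->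
  exists2 L : R, 0 <= L & forall r, 1 <= r -> normc (step_fun b (- r)%:C) <= L * r ^+ 0.
Proof.
move=> sb; have [L L0 hL] := gfun_bounded; exists L => // r r1.
rewrite expr0 mulr1; apply: hL; first exact: small_le1.
by rewrite normc_real normrN ger0_norm// ltW// (lt_le_trans ltr01).
Qed.

Lemma adm_dz b : in_disc N b -> conv N q 1 b -> contour_cintg N (Psih b dz).
Proof. by move=> sb cb; apply: (adm_Psih hN q0 q1 sb cb reg_dz) => _; exact: tail_dz. Qed.

Lemma adm_gfun b : in_disc N b -> conv N q 0 b -> contour_cintg N (Psih b (step_fun b)).
Proof.
by move=> sb cb; apply: (adm_Psih hN q0 q1 sb cb (@reg_gfun b)) => _; exact: tail_gfun.
Qed.

Lemma rho_pow m n : (m <= n)%N -> rho ^+ n <= rho ^+ m.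
Proof. by move=> mn; rewrite ler_wiXn2l ?normc_ge0// ltW. Qed.

Lemma conv_le m n b : (m <= n)%N -> conv N q n b -> conv N q m b.
Proof.
move=> mn cb oN; have [qp sl h] := cb oN; split => //; apply: lt_le_trans h _.
by rewrite ler_wpM2r ?rho_pow//; apply/ltW/nprod_gt0.
Qed.

(** Phi and psi (z - 1/z) differ at most where z^N = 1. *)
Lemma contour_Psih b : in_disc N b -> conv N q 1 b ->
  contour_integral N q b = cfun N (Psih b dz).
Proof.
move=> sb cb; have Phi_dz u : u != 0 -> u ^+ (2 * N) != 1 -> Phi N q b u = Psih b dz u.
  move=> u0 hu; have hv : u ^+ N - u ^- N != 0.
    rewrite subr_eq0; apply: contra hu => /eqP h.
    by rewrite mulnC exprM expr2 {1}h mulVf// expf_neq0.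
  by rewrite (Phi_Psi hN q1 b u0 hv) /Psimul; exact: mulrC.
rewrite contour_integralE.
have [] // := @cfun_ae R N (2 * N) (Phi N q b) (Psih b dz) _ _ _ (adm_dz sb cb).
- by rewrite muln_gt0 (ltnW hN).
- by move=> t _; apply: Phi_dz; rewrite uptE cis_neq0.
move=> oN r r1; have r0 : 0 < r by apply: lt_le_trans r1.
have t0 : tpt r != 0 by exact: tpt_neq0.
have tn : tpt r ^+ (2 * N) != 1.
  rewrite exprM tpt_sqr ?(ltW r0)// -rmorphXn exprNn -signr_odd oN expr1 mulN1r.
  rewrite eq_complex /= negb_and; apply/orP; left; rewrite lt_eqF//.
  have : 0 < r ^+ N by rewrite exprn_gt0.
  by lra.
rewrite /tailf tpt_opp -/(tpt r) (Phi_dz _ t0 tn) Phi_dz; [by []|by rewrite oppr_eq0|].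
by rewrite exprM sqrrN -exprM.
Qed.

(** [contour_shift] for z Hf_b. *)
Lemma contour_step1 b : in_disc N b -> conv N q 1 b ->
  (1 - lam b) * contour_integral N q b = cfun N (Psih b (step_fun b)).
Proof.
move=> sb cb; rewrite contour_Psih//; apply/eqP; rewrite -subr_eq0 -[- cfun _ _]mulN1r.
have c0 : conv N q 0 b by exact: conv_le cb.
have ad := adm_dz sb cb; have ag := adm_gfun sb c0.
rewrite -cfunZ// -cfun_combine//; last exact: admZ.
apply/eqP; apply: (contour_shift hN q0 q1 (a := b) (b := b) (A := fun=> 0) (B := id)).
- exact: sb.
- exact: sb.
- by move=> oN; have [] := cb oN.
- exact: reg_cst.
- exact: reg_id.
- apply: admD.
    apply: (adm_Psih hN q0 q1 sb c0); first by apply: regM; [exact: reg_cst|apply: reg_pz; exact: reg_inv].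
    by exists 0 => // r _; rewrite mul0r normc0 mul0r.
  apply: (adm_Psih hN q0 q1 sb cb); first by apply: regM; [exact: reg_id|apply: reg_pz; exact: reg_inv].
  have M0 : 0 <= (2 * N)%:R * 2 ^+ (2 * N) :> R by rewrite mulr_ge0 ?ler0n// exprn_ge0.
  exists (1 + (2 * N)%:R * 2 ^+ (2 * N)) => [|r r1]; first by rewrite addr_ge0.
  have r0 : 0 < r by apply: lt_le_trans r1.
  have nr : normc (- r)%:C = r by rewrite normc_real normrN gtr0_norm.
  rewrite normcM nr expr1 mulrC ler_wpM2r ?(ltW r0)//.
  rewrite -[pz _ _ _](subKr 1); apply: le_trans (normcBD _ _) _; rewrite normc1 lerD2l.
  apply: le_trans (pz_near1 (small_le1 sb) _) _; first by rewrite nr.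
  by rewrite nr ler_piMr// invf_le1.
- by apply: admD; apply: admZ.
move=> u hu; rewrite /Psimul /step_fun /q_ratio; set z := u ^+ 2.
have z0 : z != 0 by have [u0 _ _ _ _] := good_contour hN q0 q1 sb (fun oN => let: And3 x y _ := cb oN in conj x y) hu; rewrite expf_neq0.
move: (expf_neq0 N q0) (expf_neq0 (2 * N) z0).
move: (q ^+ N) (z ^+ (2 * N)) => Q Z Q0 Z0.
by field; rewrite Q0 Z0.
Qed.

End StepOne.

(** * A partial fraction identity *)

Section Lagrange.
Variable F : fieldType.
Variables (N : nat) (a : nat -> F).
Hypothesis hN : (2 <= N)%N.

Notation Pa := (\prod_(1 <= j < (2 * N).+1) a j).
Notation D i := (\prod_(1 <= j < N | j != i) (1 - a i * (a j)^-1)).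
(** The coefficient c_i, over an arbitrary field. *)
Definition lagrange_coef i : F :=
  \prod_(N <= m < (2 * N).+1) (1 - a i * a m) / ((1 - Pa) * D i).
(** The factor that matches the leading coefficients at infinity, and also the
    values at 0. *)
Definition lagrange_lead : F := \prod_(1 <= i < N) (- a i) / (1 - Pa).

Definition lagrange_poly : {poly F} :=
  ('X^2 - 1) * (\prod_(1 <= i < N) ((1 - (a i)%:P * 'X) * ('X - (a i)%:P)) -
    \sum_(1 <= i < N) (lagrange_coef i)%:P * ('X *
       \prod_(1 <= j < N | j != i) ((1 - (a j)%:P * 'X) * ('X - (a j)%:P)))) -
  lagrange_lead%:P * (\prod_(1 <= j < (2 * N).+1) ('X - (a j)%:P) -
           \prod_(1 <= j < (2 * N).+1) (1 - (a j)%:P * 'X)).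

Definition lagrange_fun (z : F) : F :=
  (z ^+ 2 - 1) * (\prod_(1 <= i < N) ((1 - a i * z) * (z - a i)) -
    \sum_(1 <= i < N) lagrange_coef i * (z * \prod_(1 <= j < N | j != i) ((1 - a j * z) * (z - a j)))) -
  lagrange_lead * (\prod_(1 <= j < (2 * N).+1) (z - a j) - \prod_(1 <= j < (2 * N).+1) (1 - a j * z)).

Lemma lagrange_horner z : lagrange_poly.[z] = lagrange_fun z.
Proof.
rewrite /lagrange_poly /lagrange_fun !hornerE !horner_prod horner_sum.
congr (_ * (_ - _) - _ * (_ - _)); rewrite ?expr2//.
- by apply: eq_bigr => i _; rewrite !hornerE.
- apply: eq_bigr => i _; rewrite !hornerM hornerC hornerX horner_prod; congr (_ * (_ * _)).
  by apply: eq_bigr => j _; rewrite !hornerE.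
- by apply: eq_bigr => i _; rewrite !hornerE.
- by apply: eq_bigr => i _; rewrite !hornerE.
Qed.

Lemma size_prod_seq_le (I : Type) (s : seq I) (P : pred I) (f : I -> {poly F}) d :
  (forall i, (size (f i) <= d.+1)%N) ->
  (size (\prod_(i <- s | P i) f i)%R <= (d * count P s).+1)%N.
Proof.
move=> h; elim: s => [|i s ih]; first by rewrite big_nil muln0 size_poly1.
rewrite big_cons /=; case: (P i); last by rewrite add0n.
apply: leq_trans (size_polyMleq _ _) _; rewrite -ltnS.
have := leq_add (h i) ih; rewrite mulnDr muln1 addSn addnS => e.
by apply: leq_trans (leqSpred _) _ => //; move: e; case: (_ + _)%N.
Qed.

Lemma size_linear1 (c : F) : (size ('X - c%:P)%R <= 2)%N.
Proof. by rewrite size_XsubC. Qed.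

Lemma size_linear2 (c : F) : (size (1 - c%:P * 'X)%R <= 2)%N.
Proof.
apply: leq_trans (size_polyD _ _) _; rewrite size_polyN geq_max size_poly1 /=.
apply: leq_trans (size_polyMleq _ _) _; rewrite size_polyX addnC /=.
exact: size_polyC_leq1.
Qed.

Lemma size_quadratic (c : F) : (size ((1 - c%:P * 'X) * ('X - c%:P))%R <= 3)%N.
Proof.
apply: leq_trans (size_polyMleq _ _) _.
have := leq_add (size_linear2 c) (size_linear1 c).
by case: (_ + _)%N.
Qed.

Lemma count_remove (S : pred nat) (s : seq nat) i : uniq s -> i \in s -> S i ->
  count S s = (count (fun k => S k && (k != i)) s).+1.
Proof.
elim: s => // j s ih /= /andP[js us]; rewrite inE => /orP[/eqP-> Si|is_ Si].
  rewrite Si eqxx /= add0n add1n; congr _.+1; apply: eq_in_count => k ks.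
  by case: eqP => [e|_]; [rewrite -e ks in js|rewrite andbT].
have ji : j != i by apply: contraNneq js => ->.
by rewrite ji andbT (ih us is_ Si) addnS.
Qed.

Lemma size_lagrange_poly : (size lagrange_poly <= (2 * N).+1)%N.
Proof.
have sub (p r : {poly F}) n : (size p <= n)%N -> (size r <= n)%N -> (size (p - r)%R <= n)%N.
  move=> hp hr; apply: leq_trans (size_polyD _ _) _.
  by rewrite size_polyN geq_max hp hr.
have N2 : (2 * N.-1 + 3 <= (2 * N).+2)%N by case: N hN => // n _; rewrite mulnS /=; lia.
have cN : count xpredT (index_iota 1 N) = N.-1 by rewrite count_predT size_iota subn1.
apply: (sub).
  apply: leq_trans (size_polyMleq _ _) _.
  have s1 : (size ('X^2 - 1 : {poly F})%R <= 3)%N.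
    by apply: sub; rewrite ?size_polyXn// size_poly1.
  have s2 : (size (\prod_(1 <= i < N) ((1 - (a i)%:P * 'X) * ('X - (a i)%:P)) -
    \sum_(1 <= i < N) (lagrange_coef i)%:P * ('X *
       \prod_(1 <= j < N | j != i) ((1 - (a j)%:P * 'X) * ('X - (a j)%:P))))%R <= (2 * N.-1).+1)%N.
    apply: sub; first by rewrite -cN; apply: size_prod_seq_le => i; exact: size_quadratic.
    rewrite big_seq; apply: leq_trans (size_sum _ _ _) _.
    apply/bigmax_leqP_seq => i hi _.
    rewrite mul_polyC; apply: leq_trans (size_scale_leq _ _) _.
    have h := @size_prod_seq_le nat (index_iota 1 N) (fun j => j != i)
      (fun j => (1 - (a j)%:P * 'X) * ('X - (a j)%:P)) 2 (fun j => size_quadratic (a j)).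
    have e : N.-1 = (count (fun j => j != i) (index_iota 1 N)).+1.
      by rewrite -cN (count_remove (iota_uniq 1 (N - 1)) hi).
    apply: leq_trans (size_polyMleq _ _) _; rewrite size_polyX add2n /=.
    apply: leq_ltn_trans h _; rewrite e; move: (count _ _) => c; lia.
  have := leq_add s1 s2; move: (size _) (size _) => x y; lia.
rewrite mul_polyC; apply: leq_trans (size_scale_leq _ _) _.
have c2N : count xpredT (index_iota 1 (2 * N).+1) = (2 * N)%N.
  by rewrite count_predT size_iota subn1.
apply: sub; rewrite -[X in (_ <= X.+1)%N]mul1n -[X in (_ <= (1 * X).+1)%N]c2N;
  apply: size_prod_seq_le => i; [exact: size_linear1|exact: size_linear2].
Qed.

Hypothesis a0 : forall i, (1 <= i < N)%N -> a i != 0.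
Hypothesis aD : forall i, (1 <= i < N)%N -> D i != 0.
Hypothesis Pa1 : 1 - Pa != 0.

Lemma prod_split_N (f : nat -> F) :
  \prod_(1 <= j < (2 * N).+1) f j = \prod_(1 <= j < N) f j * \prod_(N <= j < (2 * N).+1) f j.
Proof. by rewrite (@big_cat_nat _ _ _ N)//=; lia. Qed.

Lemma mem_iota1 i : (1 <= i < N)%N -> i \in index_iota 1 N.
Proof. by rewrite mem_index_iota. Qed.

(** At z = a_i only the i-th term of the sum survives; this is how the
    coefficients are determined. *)
Lemma lagrange_fun_root i : (1 <= i < N)%N -> lagrange_fun (a i) = 0.
Proof.
move=> hi; have ii := mem_iota1 hi; have ui := iota_uniq 1 (N - 1).
pose T := \prod_(1 <= j < N | j != i) (1 - a j * a i).
pose A := \prod_(1 <= j < N | j != i) (- a j).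
pose M := \prod_(N <= m < (2 * N).+1) (1 - a i * a m).
have E0 : \prod_(1 <= j < N) ((1 - a j * a i) * (a i - a j)) = 0.
  by rewrite (bigD1_seq i)//= subrr mulr0 mul0r.
have V : \prod_(1 <= j < N | j != i) (a i - a j) = A * D i.
  rewrite -big_split /= big_seq_cond [RHS]big_seq_cond; apply: eq_bigr => j.
  rewrite mem_index_iota => /andP[hj _].
  by rewrite mulrBr mulr1 mulNr [a i * _]mulrC mulVKf ?a0// opprK addrC.
have E1 : \sum_(1 <= k < N) lagrange_coef k *
    (a i * \prod_(1 <= j < N | j != k) ((1 - a j * a i) * (a i - a j))) =
    lagrange_coef i * (a i * (T * (A * D i))).
  rewrite (bigD1_seq i)//= [X in _ + X]big1_seq ?addr0 ?big_split ?V// => k /andP[ki _].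
  apply/eqP; rewrite !mulf_eq0; apply/orP; right; apply/orP; right.
  rewrite prodf_seq_eq0; apply/hasP; exists i => //=.
  by rewrite eq_sym ki subrr mulr0 eqxx.
have E2 : \prod_(1 <= j < (2 * N).+1) (a i - a j) = 0.
  by rewrite prod_split_N (bigD1_seq i)//= subrr !mul0r.
have E3 : \prod_(1 <= j < (2 * N).+1) (1 - a j * a i) = (1 - a i * a i) * T * M.
  rewrite prod_split_N (bigD1_seq i)//=; congr (_ * _).
  by apply: eq_bigr => j _; rewrite mulrC.
have E4 : \prod_(1 <= j < N) - a j = - a i * A by rewrite (bigD1_seq i).
rewrite /lagrange_fun E0 E1 E2 E3 /lagrange_coef -/M /lagrange_lead E4.
move: (aD hi) Pa1; move: (D i) (1 - Pa) => d P d0 P0.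
by field; rewrite d0 P0.
Qed.

(** The difference of the two sides is antisymmetric under z -> 1/z up to the
    factor z^(2N), so its roots come in pairs z, 1/z. *)
Lemma lagrange_fun_inv z : z != 0 ->
  lagrange_fun z^-1 * z ^+ (2 * N) = - lagrange_fun z.
Proof.
move=> z0; have ui := iota_uniq 1 (N - 1).
have z2N : z ^+ (2 * N) = \prod_(1 <= j < (2 * N).+1) z.
  by rewrite prodr_const_nat subSS subn0.
have zN : z ^+ (2 * N) = z ^+ 2 * \prod_(1 <= j < N) (z * z).
  rewrite big_split /= prodr_const_nat -expr2 -exprM -exprD; congr (_ ^+ _).
  by lia.
have fq x : (1 - x * z^-1) * (z^-1 - x) * (z * z) = (1 - x * z) * (z - x) by field.
have E0 : \prod_(1 <= i < N) ((1 - a i * z^-1) * (z^-1 - a i)) * \prod_(1 <= j < N) (z * z) =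
    \prod_(1 <= i < N) ((1 - a i * z) * (z - a i)).
  by rewrite -big_split /=; apply: eq_bigr => j _; exact: fq.
have E1 : (\sum_(1 <= i < N) lagrange_coef i *
    (z^-1 * \prod_(1 <= j < N | j != i) ((1 - a j * z^-1) * (z^-1 - a j)))) *
    \prod_(1 <= j < N) (z * z) = \sum_(1 <= i < N) lagrange_coef i *
    (z * \prod_(1 <= j < N | j != i) ((1 - a j * z) * (z - a j))).
  rewrite mulr_suml big_seq [RHS]big_seq; apply: eq_bigr => i ii.
  rewrite -mulrA; congr (_ * _); rewrite [X in _ * X](bigD1_seq i)//=.
  have -> : \prod_(1 <= j < N | j != i) ((1 - a j * z) * (z - a j)) =
     \prod_(1 <= j < N | j != i) ((1 - a j * z^-1) * (z^-1 - a j)) *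
     \prod_(1 <= j < N | j != i) (z * z).
    by rewrite -big_split /=; apply: eq_bigr => j _; rewrite fq.
  move: (\prod_(_ <= _ < _ | _) _) (\prod_(_ <= _ < _ | _) (z * z)) => X Y.
  by field.
have E2 : \prod_(1 <= j < (2 * N).+1) (z^-1 - a j) * z ^+ (2 * N) =
    \prod_(1 <= j < (2 * N).+1) (1 - a j * z).
  by rewrite z2N -big_split /=; apply: eq_bigr => j _; rewrite mulrBl mulVf.
have E3 : \prod_(1 <= j < (2 * N).+1) (1 - a j * z^-1) * z ^+ (2 * N) =
    \prod_(1 <= j < (2 * N).+1) (z - a j).
  by rewrite z2N -big_split /=; apply: eq_bigr => j _; rewrite mulrBl mul1r mulfVK.
rewrite /lagrange_fun mulrBl -[lagrange_lead * _ * _]mulrA [(_ - _) * z ^+ _]mulrBl E2 E3 zN -E0 -E1.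
move: (\prod_(_ <= _ < _) (z * z)) => X.
by field.
Qed.

(** A polynomial of degree at most 2N with the roots 0, 1, -1, a_i and 1 / a_i
    for 1 <= i < N: these are 2N + 1 roots. Taking 0 as a root replaces a comparison
    of leading coefficients. *)
Lemma lagrange_fun0 z :
  uniq ([:: 0; 1; -1] ++ [seq a i | i <- index_iota 1 N] ++
        [seq (a i)^-1 | i <- index_iota 1 N]) -> lagrange_fun z = 0.
Proof.
set rs := (X in uniq X) => urs.
suff p0 : lagrange_poly = 0 by rewrite -lagrange_horner p0 horner0.
have [//|pn0] := eqVneq lagrange_poly 0.
have rall : all (root lagrange_poly) rs.
  have r1 (x : F) : x ^+ 2 = 1 -> lagrange_fun x = 0.
    move=> x2.
    have E : \prod_(1 <= j < (2 * N).+1) (x - a j) = \prod_(1 <= j < (2 * N).+1) (1 - a j * x).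
      have -> : \prod_(1 <= j < (2 * N).+1) (x - a j) =
          \prod_(1 <= j < (2 * N).+1) x * \prod_(1 <= j < (2 * N).+1) (1 - a j * x).
        by rewrite -big_split /=; apply: eq_bigr => j _; rewrite mulrBr mulr1 mulrCA -expr2 x2 mulr1.
      by rewrite prodr_const_nat subSS subn0 exprM x2 expr1n mul1r.
    by rewrite /lagrange_fun E x2 !subrr mul0r mulr0 subrr.
  have hroot x : lagrange_fun x = 0 -> root lagrange_poly x.
    by move=> h; rewrite rootE lagrange_horner h.
  rewrite !all_cat /=; apply/and3P; split.
  - rewrite (hroot 1) ?(hroot (-1)) ?andbT; [apply: hroot|apply: r1..];
      rewrite ?sqrrN ?expr1n//.
    rewrite /lagrange_fun expr0n /= sub0r mulN1r.
    rewrite [\sum_(_ <= _ < _) _]big1; last by move=> i _; rewrite mul0r mulr0.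
    rewrite [\prod_(_ <= _ < _) (1 - _)]big1; last by move=> i _; rewrite mulr0 subr0.
    rewrite [\prod_(_ <= _ < _) (_ * _)](eq_bigr (fun i => - a i)); last first.
      by move=> i _; rewrite mulr0 subr0 mul1r sub0r.
    have -> : \prod_(1 <= j < (2 * N).+1) (0 - a j) = Pa.
      under eq_bigr do rewrite sub0r -mulN1r.
      by rewrite big_split /= prodr_const_nat subSS subn0 mulnC exprM sqrr_sign mul1r.
    rewrite /lagrange_lead subr0; move: Pa1; move: (\prod_(1 <= i < N) _) Pa => X P P0.
    by field.
  - apply/allP => _ /mapP[i + ->]; rewrite mem_index_iota => hi.
    by apply/hroot/lagrange_fun_root.
  - apply/allP => _ /mapP[i + ->]; rewrite mem_index_iota => hi.
    apply: hroot; have ai := a0 hi; have := lagrange_fun_inv ai.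
    rewrite lagrange_fun_root// oppr0 => /eqP; rewrite mulf_eq0 expf_eq0 (negPf ai) andbF orbF.
    by move/eqP.
have := leq_trans (max_poly_roots pn0 rall urs) size_lagrange_poly.
rewrite /rs size_cat size_cat !size_map size_iota /=.
by move: hN; lia.
Qed.

End Lagrange.

(** * Effect of q-shifts *)

Section NearOne.
Variable R : realType.
Implicit Types f g : R[i] -> R[i].

(** Tends to 1 at infinity like 1 + O(1/z). *)
Definition near1 f := exists2 L : R, 0 <= L &
  forall z, 1 <= normc z -> normc (f z - 1) <= L * (normc z)^-1.

Lemma near1M f g : near1 f -> near1 g -> near1 (fun z => f z * g z).
Proof.
move=> [L L0 hf] [M M0 hg]; exists (L * (1 + M) + M) => [|z z1].
  by rewrite addr_ge0// mulr_ge0// addr_ge0.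
have z0 : 0 < normc z by apply: lt_le_trans z1.
have zi : 0 <= (normc z)^-1 by rewrite invr_ge0 ltW.
have -> : f z * g z - 1 = (f z - 1) * g z + (g z - 1) by ring.
apply: le_trans (normcD _ _) _; rewrite [leRHS]mulrDl; apply: lerD; last exact: hg.
rewrite normcM mulrAC; apply: ler_pM; rewrite ?normc_ge0//; first exact: hf.
rewrite -(subrK 1 (g z)) addrC; apply: le_trans (normcD _ _) _.
rewrite normc1 lerD2l; apply: le_trans (hg z z1) _.
by rewrite ler_piMr// invf_le1.
Qed.

Lemma near1_prod (I : Type) (s : seq I) (P : pred I) (c : I -> R[i]) :
  near1 (fun z => \prod_(i <- s | P i) (1 - c i * z^-1)).
Proof.
elim: s => [|i s ih].
  by exists 0 => // z z1; rewrite big_nil subrr normc0 mul0r.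
have [Pi|Pi] := boolP (P i); last first.
  by move: ih; congr (near1 _); apply/funext => z; rewrite big_cons (negPf Pi).
suff h : near1 (fun z => (1 - c i * z^-1) * \prod_(j <- s | P j) (1 - c j * z^-1)).
  by move: h; congr (near1 _); apply/funext => z; rewrite big_cons Pi.
apply: near1M ih; exists (normc (c i)); first exact: normc_ge0.
by move=> z z1; rewrite addrC addKr normcN normcM normcV.
Qed.

End NearOne.

Section Indices.
Variable R : realType.
Variable N : nat.
Hypothesis hN : (2 <= N)%N.
Notation "'Pr' a" := (\prod_(1 <= j < (2 * N).+1) a j) (at level 10, a at level 8).
Notation cnt S := (count S (index_iota 1 (2 * N).+1)).
Implicit Types a : nat -> R[i].

Definition shifted (k : nat) := (1 <= k < N)%N.
Definition shifted_but i k := shifted k && (k != i).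

Lemma count_shifted : cnt shifted = N.-1.
Proof.
rewrite /index_iota subn1 /= (_ : (2 * N)%N = (N.-1 + N.+1)%N); last by lia.
rewrite iotaD count_cat [X in (X + _)%N](_ : _ = N.-1); last first.
  rewrite -[RHS](size_iota 1); apply/eqP; rewrite -all_count; apply/allP => k.
  by rewrite mem_iota /shifted; lia.
rewrite [X in (_ + X)%N](_ : _ = 0%N) ?addn0//; apply/eqP.
rewrite -leqn0 leqNgt -has_count; apply/hasPn => k.
by rewrite mem_iota /shifted; lia.
Qed.

Lemma shifted_range i : shifted i -> (1 <= i <= 2 * N)%N.
Proof. by rewrite /shifted; lia. Qed.

Lemma count_shifted_but i : shifted i -> cnt shifted = (cnt (shifted_but i)).+1.
Proof.
move=> hi; apply: count_remove => //; first exact: iota_uniq.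
by rewrite mem_index_iota ltnS shifted_range.
Qed.

Lemma prod_shifted (P : pred nat) (f : nat -> R[i]) :
  \prod_(1 <= j < (2 * N).+1 | shifted j && P j) f j = \prod_(1 <= j < N | P j) f j.
Proof.
rewrite (@big_cat_nat _ _ _ N)//=; [|by lia|by lia].
rewrite [X in _ * X]big1_seq ?mulr1; last first.
  by move=> j /andP[/andP[h _]]; rewrite mem_index_iota /shifted in h *; lia.
rewrite big_seq_cond [RHS]big_seq_cond; apply: eq_bigl => j.
by rewrite mem_index_iota /shifted; case: (1 <= j < N)%N.
Qed.

(** Parameters for which the entries of A are defined. *)
Definition generic a := [/\ forall j, (1 <= j <= 2 * N)%N -> a j != 0 /\ normc (a j) < 1 &
  forall i j, (1 <= i < N)%N -> (1 <= j < N)%N -> i != j -> a i != a j].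

Lemma one_sub_Pa a : generic a -> 1 - Pr a != 0.
Proof.
move=> [h _]; apply: one_sub_neq0; rewrite normc_prod.
rewrite big_ltn; last by lia.
have h1 : normc (a 1%N) < 1 by have [] := h 1%N ltac:(lia).
apply: le_lt_trans h1; rewrite ler_piMr ?normc_ge0//.
rewrite big_seq; apply: prodr_ile1 => j; rewrite mem_index_iota => hj.
by rewrite normc_ge0 ltW//; have [] := h j ltac:(lia).
Qed.

Lemma uniq_roots a : generic a ->
  uniq ([:: 0; 1; -1] ++ [seq a i | i <- index_iota 1 N] ++
        [seq (a i)^-1 | i <- index_iota 1 N]).
Proof.
move=> [h1 h2].
have h3 i : i \in index_iota 1 N -> a i != 0 /\ normc (a i) < 1.
  by rewrite mem_index_iota => hi; apply: h1; lia.
have inj : {in index_iota 1 N &, injective a}.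
  move=> i j; rewrite !mem_index_iota => hi hj e; apply/eqP; apply/contraT => ij.
  by have := h2 i j hi hj ij; rewrite e eqxx.
rewrite cat_uniq [X in [&& _, _ & X]]cat_uniq; apply/and3P; split; last first.
- apply/and3P; split.
  + by rewrite map_inj_in_uniq ?iota_uniq.
  + apply/hasPn => _ /mapP[i hi ->]; apply/negP => /mapP[j hj e].
    have [ai0 ai1] := h3 i hi; have [aj0 aj1] := h3 j hj.
    have := congr1 (@ComplexField.Normc.normc R) e; rewrite normcV => e'.
    by move: aj1; rewrite -e' invf_lt1 ?normc_gt0// => /(lt_trans ai1); rewrite ltxx.
  + rewrite map_inj_in_uniq ?iota_uniq// => i j hi hj /invr_inj; exact: inj.
- apply/hasPn => x; rewrite mem_cat => hx; apply/negP; rewrite !inE => hx'.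
  have {hx'}nx : normc x = 0 \/ normc x = 1.
    case/or3P: hx' => /eqP ->; rewrite ?normc0 ?normcN ?normc1; by [left|right].
  case/orP: hx => /mapP[i hi e]; have [ai0 ai1] := h3 i hi; rewrite -normc_gt0 in ai0.
    by rewrite e in nx; clear e; case: nx => nx; move: ai0 ai1; rewrite nx ltxx.
  have := congr1 (@ComplexField.Normc.normc R) e; rewrite normcV => e'.
  have : 1 < normc x by rewrite e' invf_gt1.
  by case: nx => ->; rewrite ?ltxx// ltr10.
rewrite /= !inE andbT negb_or eq_sym oner_eq0 eq_sym oppr_eq0 oner_eq0 /=.
by rewrite -subr_eq0 opprK -mulr2n pnatr_eq0.
Qed.

Lemma D_neq0 a i : generic a -> (1 <= i < N)%N ->
  \prod_(1 <= j < N | j != i) (1 - a i * (a j)^-1) != 0.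
Proof.
move=> [h1 h2] hi; rewrite big_seq_cond prodf_seq_neq0; apply/allP => j hj /=.
apply/implyP => /andP[_ ji]; move: hj; rewrite mem_index_iota => hj.
have [aj0 _] := h1 j ltac:(lia).
rewrite subr_eq0; apply: contra (h2 i j hi hj _); last by rewrite eq_sym.
by move=> /eqP e; rewrite -[a i](mulfVK aj0) -e mul1r.
Qed.

Definition wt (S : pred nat) a (z : R[i]) :=
  \prod_(1 <= j < (2 * N).+1 | S j) ((1 - a j * z) * (1 - a j * z^-1)).

(** [lagrange_fun0] divided by z^N. *)
Lemma laurent_identity a z : generic a -> z != 0 ->
  dz z * (wt shifted a z - \sum_(1 <= i < N) c_coef N a i * wt (shifted_but i) a z) =
  lagrange_lead N a * (z ^+ N * pz N a z^-1 - (z ^+ N)^-1 * pz N a z).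
Proof.
move=> ga z0; have [h1 _] := ga.
have L := @lagrange_fun0 _ N a hN _ _ _ z (uniq_roots ga).
have {L}L : lagrange_fun N a z = 0.
  apply: L; first by move=> i hi; have [] := h1 i ltac:(lia).
    by move=> i hi; exact: D_neq0.
  exact: one_sub_Pa.
pose Z := z ^+ N.-1; have Z0 : Z != 0 by rewrite expf_neq0.
have zN : z ^+ N = z * Z by rewrite -exprS; congr (_ ^+ _); lia.
have ZE : Z = \prod_(1 <= j < N) z by rewrite prodr_const_nat subn1.
have fq x : (1 - x * z) * (z - x) = (1 - x * z) * (1 - x * z^-1) * z by field.
have E0 : \prod_(1 <= i < N) ((1 - a i * z) * (z - a i)) = wt shifted a z * Z.
  rewrite /wt ZE.
  under [in RHS]eq_bigl do rewrite -[shifted _]andbT.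
  rewrite (prod_shifted xpredT) -big_split /=; apply: eq_bigr => j _; exact: fq.
have E1 i : i \in index_iota 1 N ->
    z * \prod_(1 <= j < N | j != i) ((1 - a j * z) * (z - a j)) = wt (shifted_but i) a z * Z.
  move=> ii; rewrite /wt prod_shifted ZE (bigD1_seq i ii (iota_uniq _ _))/= mulrCA.
  by congr (_ * _); rewrite -big_split /=; apply: eq_bigr => j _; exact: fq.
have E2 : \prod_(1 <= j < (2 * N).+1) (z - a j) = z ^+ N * z ^+ N * pz N a z^-1.
  rewrite -exprD (_ : (N + N)%N = (2 * N)%N); last by lia.
  rewrite (_ : z ^+ (2 * N) = \prod_(1 <= j < (2 * N).+1) z); last first.
    by rewrite prodr_const_nat subSS subn0.
  rewrite -big_split /=; apply: eq_bigr => j _.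
  by rewrite mulrBr mulr1 mulrCA mulfV// mulr1.
move: L; rewrite /lagrange_fun E0 E2 -/(pz N a z).
rewrite (_ : \sum_(1 <= i < N) _ = \sum_(1 <= i < N) c_coef N a i * (wt (shifted_but i) a z * Z)); last first.
  by rewrite big_seq [RHS]big_seq; apply: eq_bigr => i /E1 ->.
under eq_bigr do rewrite mulrA.
rewrite -mulr_suml zN /dz; move: (\sum_(_ <= _ < _) _) (wt shifted a z) => s w.
move: (pz N a z) (pz N a z^-1) => A B; move: (Z) Z0 => {zN ZE E0 E1}Y Z0.
move=> L; apply: (mulfI (mulf_neq0 z0 Z0)).
move: L => /eqP; rewrite subr_eq0 => /eqP L.
transitivity ((z ^+ 2 - 1) * (w * Y - s * Y)); first by field.
by rewrite L; field; rewrite z0 Z0.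
Qed.

End Indices.

Section QShift.
Variable R : realType.
Variables (N : nat) (q : R[i]).
Hypothesis hN : (2 <= N)%N.
Hypothesis q0 : q != 0.
Hypothesis q1 : normc q < 1.

Notation rho := (normc q).
Notation Psi := (psi N q).
Notation "'Pr' a" := (\prod_(1 <= j < (2 * N).+1) a j) (at level 10, a at level 8).
Notation cnt S := (count S (index_iota 1 (2 * N).+1)).
Implicit Types (a b : nat -> R[i]) (S : pred nat).
Notation wt := (@wt R N).

Lemma den_qshift S a u : den N q a u = wt S a (u ^+ 2) * den N q (qshift q S a) u.
Proof.
rewrite /den /wt [in RHS]big_mkcond -big_split /=; apply: eq_bigr => j _.
rewrite /qshift; case: (S j); rewrite ?mul1r// /qpoch_pm.
rewrite [qpoch (a j * u ^+ 2) q](qpochS q1) [qpoch (a j * (u ^+ 2)^-1) q](qpochS q1).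
have e z : q * a j * z = a j * z * q by ring.
by rewrite !e; ring.
Qed.

(** Each (a_j z; q)_oo loses its first factor when a_j becomes q a_j. *)
Lemma Psi_qshift S a u : den N q a u != 0 ->
  Psi (qshift q S a) u = Psi a u * wt S a (u ^+ 2).
Proof.
rewrite /psi (den_qshift S) mulf_eq0 negb_or => /andP[w0 _].
by rewrite [RHS](div_cancel _ _ w0).
Qed.

Lemma prod_qshift S a : Pr (qshift q S a) = q ^+ cnt S * Pr a.
Proof.
rewrite -[q ^+ _](_ : \prod_(1 <= j < (2 * N).+1 | S j) q = _); last first.
  by rewrite big_const_seq -Monoid.iteropE.
rewrite [in RHS]big_mkcond -big_split /=; apply: eq_bigr => j _; rewrite /qshift.
by case: (S j); rewrite ?mul1r.
Qed.

Lemma nprod_qshift S a : nprod N (qshift q S a) = rho ^+ cnt S * nprod N a.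
Proof. by rewrite !nprodE prod_qshift normcM normcX. Qed.

Lemma normc_qshift S a j : normc (qshift q S a j) <= normc (a j).
Proof.
rewrite /qshift; case: (S j) => //; rewrite normcM ler_piMl ?normc_ge0//; exact: ltW.
Qed.

Lemma small_qshift S a : in_disc N a -> in_disc N (qshift q S a).
Proof. by move=> sa j hj; apply: le_lt_trans (normc_qshift _ _ _) (sa j hj). Qed.

Lemma slit_qshift S a : 0 < q -> slit N a -> slit N (qshift q S a).
Proof.
move=> qp sl j hj; have [h1 h2 h3] := sl j hj; split.
- by rewrite /qshift; case: (S j) => //; rewrite mulf_neq0.
- exact: le_lt_trans (normc_qshift _ _ _) h2.
- by rewrite /qshift; case: (S j) => //; rewrite pmulr_rle0.
Qed.

Lemma conv_qshift m S a : conv N q (m + cnt S) a -> conv N q m (qshift q S a).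
Proof.
move=> ca oN; have [qp sl h] := ca oN; split => //; first exact: slit_qshift.
by rewrite nprod_qshift mulrA -exprD.
Qed.

End QShift.

(** * Second contour relation *)

Section StepTwo.
Variable R : realType.
Local Notation C := (R[i]^o).
Variables (N : nat) (q : R[i]).
Hypothesis hN : (2 <= N)%N.
Hypothesis q0 : q != 0.
Hypothesis q1 : normc q < 1.

Notation Psih := (@Psimul R N q).
Notation reg := (@reg R).
Notation gfun := (step_fun N q).
Notation S0 := (shifted N).
Notation S1 := (shifted_but N).
Notation wt := (@wt R N).
Notation "'Pr' a" := (\prod_(1 <= j < (2 * N).+1) a j) (at level 10, a at level 8).
Implicit Types (a b : nat -> R[i]) (S : pred nat).

Lemma generic_small a : generic N a -> in_disc N a.
Proof. by move=> [h _] j hj; have [] := h j hj. Qed.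

Lemma reg_one_sub (c : R[i]) (h : R[i] -> R[i]) : reg h -> reg (fun z => 1 - c * h z).
Proof.
move=> rh; apply: (@regB _ (fun=> 1) (fun z => c * h z)); first exact: reg_cst.
by apply: (@regM _ (fun=> c) h); [exact: reg_cst|exact: rh].
Qed.

Lemma reg_wt S a : reg (wt S a).
Proof.
apply: reg_prod => j; apply: (@regM _ (fun z => 1 - a j * z) (fun z => 1 - a j * z^-1)).
  exact: (reg_one_sub (@reg_id R)).
exact: (reg_one_sub (@reg_inv R)).
Qed.

(** The multiplier of psi_a in the combination to which the contour shift is applied. *)
Definition step2_fun a (z : R[i]) : R[i] := lagrange_lead N a * z ^+ N * pz N a z^-1 -
  (1 - Pr a)^-1 * z * (wt S0 a z * pz N (qshift q S0 a) z^-1).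

Lemma reg_Dfun a : reg (step2_fun a).
Proof.
have rp (b : nat -> R[i]) : reg (fun z => pz N b z^-1) by apply: reg_pz; exact: reg_inv.
apply: (@regB _ (fun z => lagrange_lead N a * z ^+ N * pz N a z^-1)
   (fun z => (1 - Pr a)^-1 * z * (wt S0 a z * pz N (qshift q S0 a) z^-1))).
  apply: (@regM _ (fun z => lagrange_lead N a * z ^+ N)); last exact: rp.
  by apply: (@regM _ (fun=> lagrange_lead N a)); [exact: reg_cst|exact: (regX (@reg_id R))].
apply: (@regM _ (fun z => (1 - Pr a)^-1 * z)).
  by apply: (@regM _ (fun=> (1 - Pr a)^-1)); [exact: reg_cst|exact: (@reg_id R)].
by apply: (@regM _ (wt S0 a)); [exact: reg_wt|exact: rp].
Qed.

(** After division by z^N both parts are products of factors 1 + O(1/z) with the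
    same constant in front, so the power z^N cancels. *)
Lemma tail_Dfun a : generic N a ->
  exists2 L : R, 0 <= L & forall r, 1 <= r -> normc (step2_fun a (- r)%:C) <= L * r ^+ N.-1.
Proof.
move=> ga; have [h1 _] := ga.
pose f1 z := pz N a z^-1.
pose f2 z := \prod_(1 <= j < N) (1 - (a j)^-1 * z^-1) * \prod_(1 <= j < N) (1 - a j * z^-1) *
  pz N (qshift q S0 a) z^-1.
have [L1 L10 hL1] : near1 f1 by exact: near1_prod.
have [L2 L20 hL2] : near1 f2.
  by apply: near1M; [apply: near1M; exact: near1_prod|exact: near1_prod].
exists (normc (lagrange_lead N a) * (L1 + L2)) => [|r r1]; first by rewrite mulr_ge0 ?normc_ge0 ?addr_ge0.
have r0 : 0 < r by apply: lt_le_trans r1.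
have : normc (- r)%:C = r by rewrite normc_real normrN gtr0_norm.
move: ((- r)%:C) => z nr.
have z0 : z != 0 by rewrite -normc_gt0 nr.
have zN : z ^+ N = z ^+ N.-1 * z by rewrite -exprSr; congr (_ ^+ _); lia.
have E : step2_fun a z = lagrange_lead N a * z ^+ N * ((f1 z - 1) - (f2 z - 1)).
  have W : wt S0 a z = \prod_(1 <= j < N) (- a j) * z ^+ N.-1 *
     (\prod_(1 <= j < N) (1 - (a j)^-1 * z^-1) * \prod_(1 <= j < N) (1 - a j * z^-1)).
    rewrite /wt; under [in LHS]eq_bigl do rewrite -[S0 _]andbT.
    rewrite (prod_shifted hN xpredT) big_split /= mulrA; congr (_ * _).
    rewrite (_ : z ^+ N.-1 = \prod_(1 <= j < N) z); last by rewrite prodr_const_nat subn1.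
    rewrite -!big_split /= big_seq [RHS]big_seq; apply: eq_bigr => j.
    rewrite mem_index_iota => hj; have [aj0 _] := h1 j ltac:(lia).
    by field; rewrite aj0 z0.
  rewrite /step2_fun W /f1 /f2 /lagrange_lead zN; move: (one_sub_Pa hN ga).
  by move: (1 - Pr a) => P P0; field.
rewrite E normcM; apply: le_trans (ler_wpM2l (normc_ge0 _) (normcBD _ _)) _.
have z1 : 1 <= normc z by rewrite nr.
have h : normc (f1 z - 1) + normc (f2 z - 1) <= (L1 + L2) * r^-1.
  by rewrite mulrDl -nr lerD ?hL1 ?hL2.
apply: le_trans (ler_wpM2l (normc_ge0 _) h) _.
rewrite normcM zN normcM normcX nr.
have -> : normc (lagrange_lead N a) * (r ^+ N.-1 * r) * ((L1 + L2) * r^-1) =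
    normc (lagrange_lead N a) * (L1 + L2) * r ^+ N.-1 by field; rewrite gt_eqF.
by [].
Qed.

Lemma conv_shifted a : conv N q N.-1 a -> conv N q 0 (qshift q S0 a).
Proof. by move=> ca; apply: conv_qshift => //; rewrite count_shifted. Qed.

Lemma conv_shifted_but a i : S0 i -> conv N q N.-1 a -> conv N q 1 (qshift q (S1 i) a).
Proof. by move=> hi ca; apply: conv_qshift => //; rewrite add1n -count_shifted_but// count_shifted. Qed.

Lemma lam_shifted a : lam N q (qshift q S0 a) = Pr a.
Proof.
rewrite /lam /q_ratio prod_qshift count_shifted// -mulrA.
have -> : q ^+ N = q * q ^+ N.-1 by rewrite -exprS; congr (_ ^+ _); lia.
have Q0 : q ^+ N.-1 != 0 by rewrite expf_neq0.
by move: (q ^+ N.-1) Q0 => Q Q0; field; rewrite Q0 q0.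
Qed.

(** [contour_shift] for the combination of z^N Hf_a and z Hf_b whose leading terms
    at infinity cancel; [laurent_identity] turns the first part of the outcome into
    the sum and cancels the second. *)
Lemma contour_step2 a : generic N a -> conv N q N.-1 a ->
  cfun N (Psih (qshift q S0 a) (gfun (qshift q S0 a))) =
  (1 - Pr a) * \sum_(1 <= i < N)
    c_coef N a i * contour_integral N q (qshift q (S1 i) a).
Proof.
move=> ga ca; have [h1 h2] := ga; have sa := generic_small ga.
set b := qshift q S0 a; pose bb i := qshift q (S1 i) a.
have P0 := one_sub_Pa hN ga.
have sb : in_disc N b by exact: small_qshift.
have cb : conv N q 0 b by exact: conv_shifted.
have sbb i : in_disc N (bb i) by exact: small_qshift.
have cbb i : S0 i -> conv N q 1 (bb i) by move=> hi; exact: conv_shifted_but.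
have ho : odd N -> [/\ 0 < q, slit N a & slit N b].
  by move=> oN; have [qp sl _] := ca oN; split => //; have [] := cb oN.
have hoa : odd N -> 0 < q /\ slit N a by move=> /ho[].
pose T u := \sum_(1 <= i < N) c_coef N a i * Psih (bb i) (@dz R) u.
pose S u := (1 - Pr a)^-1 * Psih b (gfun b) u + -1 * T u.
have aG := adm_gfun hN q0 q1 sb cb.
have aT : contour_cintg N T.
  rewrite (_ : T = fun u => \sum_(1 <= i < N | S0 i) c_coef N a i * Psih (bb i) (@dz R) u).
    by apply: adm_sum => i hi; apply: admZ; apply: (adm_dz hN q0 q1 (sbb i) (cbb i hi)).
  apply/funext => u; rewrite /T big_seq [RHS]big_seq_cond; apply: eq_bigl => i.
  by rewrite mem_index_iota /shifted andbb.
have cT : cfun N T = \sum_(1 <= i < N) c_coef N a i * contour_integral N q (bb i).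
  have e (f : nat -> R[i]) : \sum_(1 <= i < N) f i = \sum_(1 <= i < N | S0 i) f i.
    rewrite big_seq [RHS]big_seq_cond; apply: eq_bigl => i.
    by rewrite mem_index_iota /shifted andbb.
  rewrite e (_ : T = fun u => \sum_(1 <= i < N | S0 i) c_coef N a i * Psih (bb i) (@dz R) u); last first.
    by apply/funext => u; rewrite /T e.
  rewrite cfun_sum => [|i hi].
    apply: eq_bigr => i hi; rewrite cfunZ ?(contour_Psih hN q0 q1 (sbb i) (cbb i hi))//.
    exact: (adm_dz hN q0 q1 (sbb i) (cbb i hi)).
  by apply: admZ; apply: (adm_dz hN q0 q1 (sbb i) (cbb i hi)).
suff : cfun N S = 0.
  rewrite /S (cfun_combine _ (admZ _ aG) aT) cfunZ// cT mulN1r => /eqP.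
  by rewrite subr_eq0 => /eqP <-; rewrite mulVKf.
apply: (contour_shift hN q0 q1 (a := a) (b := b) (A := fun z => lagrange_lead N a * z ^+ N)
   (B := fun z => - (1 - Pr a)^-1 * z)).
- exact: sa.
- exact: sb.
- exact: ho.
- by apply: regM; [exact: reg_cst|apply: regX; exact: reg_id].
- by apply: regM; [exact: reg_cst|exact: reg_id].
- apply: (@adm_on_contour R N (Psih a (step2_fun a))).
    move=> u hu; have [_ du _ _ _] := good_contour hN q0 q1 sa hoa hu.
    by rewrite /Psimul /b Psi_qshift// /step2_fun; ring.
  by apply: (adm_Psih hN q0 q1 sa ca (@reg_Dfun a)) => _; exact: tail_Dfun.
- by apply: admD; apply: admZ.
move=> u hu; have [u0 du _ _ _] := good_contour hN q0 q1 sa hoa hu.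
set z := u ^+ 2; have z0 : z != 0 by rewrite expf_neq0.
have Lid := laurent_identity hN ga z0.
have eT : T u = psi N q a u * (dz z * \sum_(1 <= i < N) c_coef N a i * wt (S1 i) a z).
  rewrite mulr_sumr mulr_sumr; apply: eq_bigr => i _.
  by rewrite /Psimul /bb Psi_qshift// -/z; ring.
rewrite /S eT /Psimul -/z /b Psi_qshift// -/z -/b /step_fun lam_shifted /q_ratio.
move: Lid; rewrite mulrBr.
move: (dz z * \sum_(_ <= _ < _) _) => X.
rewrite [(q * z) ^+ N]exprMn (_ : z ^+ (2 * N) = z ^+ N * z ^+ N); last by rewrite -exprD; congr (_ ^+ _); lia.
have Z0 : z ^+ N != 0 by rewrite expf_neq0.
have Q0 : q ^+ N != 0 by rewrite expf_neq0.
move: (pz N a z) (pz N a z^-1) (pz N b z) (pz N b z^-1) => A A' B B'.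
move: (z ^+ N) (q ^+ N) (1 - Pr a) (dz z) (wt S0 a z) (lagrange_lead N a) (psi N q a u) Z0 Q0 P0.
move=> Z Q P d w K psi Z0 Q0 P0 Lid.
have -> : X = d * w - K * (Z * A' - Z^-1 * A) by rewrite -Lid; ring.
by field; rewrite Z0 Q0 P0.
Qed.

End StepTwo.

(** * From contour integrals to their continuation *)

Section Continuation.
Variable R : realType.
Local Notation C := (R[i]^o).
Variables (N : nat) (q : R[i]) (I : (nat -> R[i]) -> R[i]).
Hypothesis hN : (2 <= N)%N.
Hypothesis q0 : q != 0.
Hypothesis q1 : normc q < 1.
Hypothesis hI : is_IN N q I.

Notation rho := (normc q).
Notation Psih := (@Psimul R N q).
Notation gfun := (step_fun N q).
Notation lam := (lam N q).
Notation slit := (@slit R N).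
Notation conv := (conv N q).
Notation "'Pr' a" := (\prod_(1 <= j < (2 * N).+1) a j) (at level 10, a at level 8).
Implicit Types (a b : nat -> R[i]) (S : pred nat).

Lemma expr_pred (K : nzRingType) (x : K) : x ^+ N = x * x ^+ N.-1.
Proof. by rewrite -exprS prednK// ltnW. Qed.

Lemma ln_prod_seq (s : seq nat) (f : nat -> R) : (forall i, i \in s -> 0 < f i) ->
  0 < \prod_(i <- s) f i /\ ln (\prod_(i <- s) f i) = \sum_(i <- s) ln (f i).
Proof.
elim: s => [|i s ih] h; first by rewrite !big_nil ln1.
have [|p0 pl] := ih; first by move=> k ks; apply: h; rewrite inE ks orbT.
have fi : 0 < f i by apply: h; rewrite inE eqxx.
by rewrite !big_cons -pl lnM ?posrE// mulr_gt0.
Qed.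

Lemma polar_form (w : R[i]) : exists t : R, w != 0 -> w = (normc w)%:C * cis t.
Proof.
have [->|w0] := eqVneq w 0; first by exists 0.
have nw : 0 < normc w by rewrite normc_gt0.
have nc : (normc w)%:C != 0 :> R[i] by rewrite eq_complex /= eqxx andbT gt_eqF.
have [|t _ ht] := @polar R (w / (normc w)%:C).
  by rewrite normcM normcV normc_real gtr0_norm// divff// gt_eqF.
by exists t => _; rewrite -ht mulrC divfK.
Qed.

(** With s_j = log a_j / log q the product of the |a_j| is q^(sum of the Re s_j). *)
Lemma converges_conv a : conv 1 a -> contour_converges N q a.
Proof.
move=> ca oN; have [qp sl h] := ca oN.
have r0 : 0 < rho by rewrite normc_gt0.
have lr : ln rho < 0 by rewrite ln_lt0// r0.
have Rq : complex.Re q = rho by rewrite {1}(q_real qp).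
have [th hth] := choice (fun j => polar_form (a j)).
(* The argument th j of a j is any of its values: only the real parts enter the condition. *)
exists (fun j => (ln (normc (a j)) / ln rho) +i* (th j / ln rho)); split.
  move=> j hj; have [aj0 _ _] := sl j hj; have nj : 0 < normc (a j) by rewrite normc_gt0.
  rewrite /cpow Rq /= divfK ?lt_eqF// -/(cis _) {1}(hth j aj0); congr (_%:C * _).
  by rewrite /powR gt_eqF// divfK ?lt_eqF// lnK.
have [|p0 pl] := @ln_prod_seq (index_iota 1 (2 * N).+1) (fun j => normc (a j)).
  by move=> j; rewrite mem_index_iota ltnS => /sl[h1 _ _]; rewrite normc_gt0.
rewrite /= -mulr_suml -pl ltr_ndivrMr// mulr_natl -lnXn// ltr_ln ?posrE ?exprn_gt0//.
by move: h; rewrite expr_pred expr1 ltr_pM2l.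
Qed.

Definition nonzero_in_disc a := forall j, (1 <= j <= 2 * N)%N -> a j != 0 /\ normc (a j) < 1.

Lemma nz_small a : nonzero_in_disc a -> in_disc N a.
Proof. by move=> h j /h[]. Qed.

Lemma nz_slit a : slit a -> nonzero_in_disc a.
Proof. by move=> h j /h[]. Qed.

Lemma normr_lt1 (x : R[i]) : (`|x| < 1) = (normc x < 1).
Proof. by rewrite -[1]/(1%:C) normc_lt. Qed.

Lemma domain_conv a : nonzero_in_disc a -> conv 1 a -> IN_domain N q a.
Proof.
move=> na ca; split=> [j hj|oN n].
  have [h1 h2] := na j hj; split => //; first by rewrite normr_lt1.
  by move=> oN; have [_ sl _] := ca oN; have [] := sl j hj.
have [qp sl h] := ca oN; have r0 : 0 < rho by rewrite normc_gt0.
apply/eqP => e; move: h; rewrite nprodE e normcX expr1 exprD mulrA -exprS prednK; last by lia.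
by rewrite ltNge ler_piMr// ?exprn_ge0 ?exprn_ile1 ?normc_ge0// ltW.
Qed.

Lemma IN_contour a : nonzero_in_disc a -> conv 1 a -> I a = contour_integral N q a.
Proof.
move=> na ca; have [h _] := hI; apply: h; first exact: domain_conv.
exact: converges_conv.
Qed.

Lemma domain_slit a : odd N -> slit a -> (forall n, Pr a != q ^+ (N.-1 + n)) ->
  IN_domain N q a.
Proof.
move=> oN sl hn; split=> [j hj|_ n]; last exact: hn.
by have [h1 h2 h3] := sl j hj; split => //; rewrite normr_lt1.
Qed.

Lemma set_param2 a j s t : set_param (set_param a j s) j t = set_param a j t.
Proof. by apply/funext => k; rewrite /set_param; case: eqP. Qed.

Lemma set_paramE a j t : set_param a j t j = t.
Proof. by rewrite /set_param eqxx. Qed.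

(** The hypothesis is stated at the j-th entry of a tuple; here that entry is t. *)
Lemma IN_derivable a j (t : C) : odd N -> (1 <= j <= 2 * N)%N ->
  IN_domain N q (set_param a j t) ->
  derivable (fun t : C => I (set_param a j t) : C) t 1.
Proof.
move=> oN hj dm; have [_ h] := hI; have := h oN _ j dm hj.
rewrite set_paramE (_ : (fun s => _) = fun s : C => I (set_param a j s))//.
by apply/funext => s; rewrite set_param2.
Qed.

Lemma slit_set_param a j t : slit a -> t != 0 -> normc t < 1 -> ~~ (t <= 0) ->
  slit (set_param a j t).
Proof.
by move=> sl t0 t1 ts k hk; rewrite /set_param; case: (k == j); [split|exact: (sl k hk)].
Qed.

Lemma derivable_lam a j (t : C) : (1 <= j <= 2 * N)%N ->
  derivable (fun t : C => lam (set_param a j t) : C) t 1.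
Proof.
move=> hj; apply: derivC_cM; apply: derivC_prod => k _; exact: derivable_set_param.
Qed.

Lemma derivable_gfun a j (z : R[i]) : (1 <= j <= 2 * N)%N -> forall t : C,
  derivable (fun t : C => gfun (set_param a j t) z : C) t 1.
Proof.
move=> hj t.
have dpz (w : R[i]) : derivable (fun t : C => pz N (set_param a j t) w : C) t 1.
  apply: derivC_prod => k _; apply: derivableB; first exact: derivable_cst.
  by apply: derivableM; [exact: derivable_set_param|exact: derivable_cst].
apply: derivableD; first apply: derivableB.
- apply: derivableM; last exact: derivable_cst.
  by apply: derivableB; [exact: derivable_cst|exact: derivable_lam].
- by apply: derivC_cM; exact: dpz.
- by apply: derivC_cM; exact: dpz.
Qed.

(** Both sides are holomorphic in b_1 for |b_1 ... b_2N| > q^N, and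
    [contour_step1] gives the identity where |b_1 ... b_2N| > q^(N-1). The last
    hypothesis says that this region is reached before |b_1| = 1. *)
Lemma IN_step1 b : nonzero_in_disc b -> conv 0 b -> IN_domain N q b ->
  (odd N -> rho ^+ N.-1 * normc (b 1%N) < nprod N b) ->
  (1 - lam b) * I b = cfun N (Psih b (gfun b)).
Proof.
move=> nb cb dm hB; have h1 : (1 <= 1 <= 2 * N)%N by lia.
have [oN|eN] := boolP (odd N); last first.
  have cb1 : conv 1 b by move=> oN; rewrite oN in eN.
  by rewrite IN_contour// contour_step1//; exact: nz_small.
have {}hB := hB oN; have [qp sl hP] := cb oN; rewrite expr0 mul1r in hP.
have r0 : 0 < rho by rewrite normc_gt0.
have qr := q_real qp.
pose B := \prod_(1 <= k < (2 * N).+1 | k != 1%N) b k.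
have PB t : Pr (set_param b 1 t) = t * B by exact: prod_set_param.
have Pb : Pr b = b 1%N * B by rewrite -PB set_param_id.
have [b10 b11 _] := sl 1%N h1; have nb1 : 0 < normc (b 1%N) by rewrite normc_gt0.
have nB : nprod N b = normc (b 1%N) * normc B by rewrite nprodE Pb normcM.
have hB' : rho ^+ N.-1 < normc B by move: hB; rewrite nB mulrC ltr_pM2l.
have B0 : 0 < normc B by apply: lt_trans hB'; rewrite exprn_gt0.
have BC : B != 0 by rewrite -normc_gt0.
pose f (t : C) : C := (1 - lam (set_param b 1 t)) * I (set_param b 1 t) -
   cfun N (Psih (set_param b 1 t) (gfun (set_param b 1 t))).
have df (t : C) : rho ^+ N / normc B < normc t < 1 -> slit (set_param b 1 t) ->
    IN_domain N q (set_param b 1 t) -> derivable f t 1.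
  move=> /andP[t1 t2] slt dt; apply: derivableB.
    apply: derivableM; last exact: IN_derivable.
    by apply: derivableB; [exact: derivable_cst|exact: derivable_lam].
  have [L L0 hL] := gfun_bounded N q.
  pose F (s : C) : C :=
    cfun N (Psih (set_param (set_param b 1 t) 1 s) (gfun (set_param b 1 s))).
  have E : (fun s : C => cfun N (Psih (set_param b 1 s) (gfun (set_param b 1 s))) : C) = F.
    by apply/funext => s; rewrite /F set_param2.
  rewrite E; have -> : t = set_param b 1 t 1%N by rewrite set_paramE.
  apply: (@cfun_param_derivable R N q hN q0 q1 (set_param b 1 t) 1%N
    (fun s => gfun (set_param b 1 s)) L (1 - normc t) oN qp slt h1 _ _ _ L0 _ _).
  - by rewrite nprodE PB normcM -ltr_pdivrMr.
  - by move=> s; apply: reg_gfun.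
  - by move=> z _; apply: derivable_gfun.
  - by rewrite subr_gt0.
  - rewrite set_paramE => s hs z z1; apply: (hL _ _ z z1) => k hk.
    rewrite /set_param; case: (k == 1%N).
      rewrite -(subrK t s); apply: le_trans (normcD _ _) _; lra.
    by have [_ bk1 _] := sl k hk; exact: ltW.
have off (t : C) : 0 < normc t < 1 -> off_rays [:: -1; B] t ->
    slit (set_param b 1 t) /\ IN_domain N q (set_param b 1 t).
  move=> /andP[t0 t1] ot.
  have slt : slit (set_param b 1 t).
    apply: slit_set_param => //; first by rewrite -normc_gt0.
    apply/negP => t_le0; have := ot (-1); rewrite !inE eqxx => /(_ isT); apply.
    by rewrite mulrN1 oppr_ge0.
  split => //; apply: domain_slit => // n; rewrite PB; apply/eqP => e.
  have := ot B; rewrite !inE eqxx orbT => /(_ isT); apply.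
  by rewrite e exprn_ge0// ltW.
have d0 : 0 <= rho ^+ N / normc B by rewrite divr_ge0 ?exprn_ge0// ltW.
suff : f (b 1%N) = 0 by rewrite /f set_param_id => /eqP; rewrite subr_eq0 => /eqP.
apply: (@ray_identity R f [:: -1; B] (rho ^+ N / normc B) (rho ^+ N.-1 / normc B)) => //.
- by move=> v; rewrite !inE => /orP[]/eqP ->; rewrite ?oppr_eq0 ?oner_eq0.
- by rewrite ltr_pdivrMr// mul1r.
- move=> t ht ot; have /andP[t1 t2] := ht; have [|s1 s2] := off t _ ot.
    by rewrite t2 andbT; apply: le_lt_trans t1.
  exact: df.
- move=> t /andP[t1 t2] ot.
  have t0 : 0 < normc t by apply: le_lt_trans t1; rewrite divr_ge0 ?exprn_ge0// ltW.
  have [|s1 s2] := off t _ ot; first by rewrite t0 t2.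
  have c1 : conv 1 (set_param b 1 t).
    move=> _; split => //; rewrite nprodE PB normcM expr1.
    by rewrite expr_pred ltr_pM2l// -ltr_pdivrMr.
  have nzt := nz_slit s1.
  by rewrite /f IN_contour// contour_step1 ?subrr//; exact: nz_small.
- by rewrite b11 andbT ltr_pdivrMr// -nB.
- by apply: df; rewrite ?set_param_id// b11 andbT ltr_pdivrMr// -nB.
Qed.

End Continuation.

(** * Uniqueness of the continuation *)

Section Domain.
Variable R : realType.
Local Notation C := (R[i]^o).
Variables (N : nat) (q : R[i]) (I : (nat -> R[i]) -> R[i]).
Hypothesis hN : (2 <= N)%N.
Hypothesis q0 : q != 0.
Hypothesis q1 : normc q < 1.
Hypothesis hI : is_IN N q I.
Hypothesis oN : odd N.
Hypothesis qp : 0 < q.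

Notation rho := (normc q).
Notation slit := (@slit R N).
Notation S0 := (shifted N).
Notation "'Pr' a" := (\prod_(1 <= j < (2 * N).+1) a j) (at level 10, a at level 8).
Implicit Types (a b : nat -> R[i]) (S : pred nat).

(** The tuples allowed in the theorem when N is odd. *)
Definition slit_domain a := [/\ slit a,
  forall i j, (1 <= i < N)%N -> (1 <= j < N)%N -> i != j -> a i != a j &
  forall n, Pr a != q ^+ n.+1].

Lemma Dom_generic a : slit_domain a -> generic N a.
Proof. by move=> [h1 h2 _]; split => // j /h1[]. Qed.

Lemma bernoulli (x : R) n : 0 <= x <= 1 -> 1 - n%:R * x <= (1 - x) ^+ n.
Proof.
move=> /andP[x0 x1]; elim: n => [|n ih]; first by rewrite mul0r subr0 expr0.
rewrite exprS; have n0 : 0 <= n%:R :> R by rewrite ler0n.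
have x1' : 0 <= 1 - x by rewrite subr_ge0.
apply: le_trans (ler_wpM2l x1' ih); rewrite -natr1.
have : 0 <= n%:R * (x * x) by rewrite mulr_ge0// mulr_ge0.
lra.
Qed.

(** From Bernoulli's inequality. *)
Lemma root_above (r : R) n : 0 < r < 1 -> exists2 d : R, 0 < d < 1 & r < d ^+ n.
Proof.
move=> /andP[r0 r1]; have n1 : 0 < n.+1%:R :> R by rewrite ltr0n.
pose x := (1 - r) / (2 * n.+1%:R).
have x0 : 0 < x by rewrite divr_gt0 ?subr_gt0// mulr_gt0.
have nx : n.+1%:R * x = (1 - r) / 2 by rewrite /x; field; rewrite gt_eqF.
have xs : x <= n.+1%:R * x by rewrite ler_peMl ?(ltW x0)// ler1n.
exists (1 - x); first by apply/andP; lra.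
apply: lt_le_trans (bernoulli n _); last by apply/andP; lra.
have : n%:R * x <= n.+1%:R * x by rewrite ler_wpM2r ?(ltW x0)// ler_nat.
lra.
Qed.

(** Each condition on the j-th entry excludes points of the given rays only. *)
Lemma Dom_set_param a j (t : R[i]) : slit_domain a -> (1 <= j <= 2 * N)%N -> 0 < normc t < 1 ->
  off_rays ([:: -1; \prod_(1 <= k < (2 * N).+1 | k != j) a k] ++
    [seq (a i)^-1 | i <- index_iota 1 N & i != j]) t ->
  slit_domain (set_param a j t).
Proof.
move=> [sl dst pr] hj /andP[t0 t1] ot.
have tne (i : nat) : (1 <= i < N)%N -> i != j -> t != a i.
  move=> hi ij; apply/eqP => e; apply: (ot (a i)^-1).
    rewrite mem_cat; apply/orP; right; apply/mapP; exists i => //.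
    by rewrite mem_filter ij mem_index_iota.
  have [ai0 _ _] := sl i (shifted_range hN hi).
  by rewrite e mulfV// ler01.
split.
- apply: slit_set_param => //; first by rewrite -normc_gt0.
  apply/negP => t_le0; apply: (ot (-1)); first by rewrite mem_cat !inE eqxx.
  by rewrite mulrN1 oppr_ge0.
- move=> i k hi hk ik; rewrite /set_param; have [ij|ij] := eqVneq i j.
    have kj : k != j by rewrite -ij eq_sym.
    by rewrite (negPf kj) tne.
  have [kj|kj] := eqVneq k j; last exact: dst.
  by rewrite eq_sym tne.
- move=> n; rewrite prod_set_param//; apply/eqP => e.
  apply: (ot (\prod_(1 <= k < (2 * N).+1 | k != j) a k)).
    by rewrite mem_cat !inE eqxx orbT.
  by rewrite e exprn_ge0// ltW.
Qed.

(** Choose d < 1 such that |a_1 ... a_2N| > q as soon as all |a_j| > d. By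
    induction on the number of entries with |a_j| <= d: as a function of such an
    entry, E vanishes when its modulus exceeds d, hence everywhere by
    [ray_identity]. *)
Lemma continuation (E : (nat -> R[i]) -> R[i]) :
  (forall a j (t : C), (1 <= j <= 2 * N)%N -> slit_domain (set_param a j t) ->
     derivable (fun t : C => E (set_param a j t) : C) t 1) ->
  (forall a, slit_domain a -> rho < nprod N a -> E a = 0) ->
  forall a, slit_domain a -> E a = 0.
Proof.
move=> dE zE; have r0 : 0 < rho by rewrite normc_gt0.
have [|d /andP[d0 d1] hd] := @root_above rho (2 * N); first by rewrite r0 q1.
pose s := index_iota 1 (2 * N).+1.
have us : uniq s by exact: iota_uniq.
have sE j : (j \in s) = (1 <= j <= 2 * N)%N by rewrite mem_index_iota ltnS.
suff H k : forall a, slit_domain a -> (count (fun j => (normc (a j) <= d)%R) s <= k)%N -> E a = 0.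
  by move=> a da; exact: (H _ a da (leqnn _)).
elim: k => [|k ih] a da ck.
  apply: zE => //; apply: lt_le_trans hd _; rewrite /nprod.
  rewrite (_ : d ^+ (2 * N) = \prod_(1 <= j < (2 * N).+1) d); last first.
    by rewrite prodr_const_nat subSS subn0.
  rewrite big_seq [leRHS]big_seq; apply: ler_prod => j hj; rewrite (ltW d0) /=.
  move: ck; rewrite leqn0 -leqn0 leqNgt -has_count => /hasPn/(_ j hj).
  by rewrite -ltNge => /ltW.
have [|hk] := leqP (count (fun j => (normc (a j) <= d)%R) s) k; first exact: ih.
have : has (fun j => (normc (a j) <= d)%R) s by rewrite has_count (leq_trans _ hk).
move=> /hasP[j js aj]; have hj : (1 <= j <= 2 * N)%N by rewrite -sE.
have [sl dst pr] := da.
pose vs := [:: -1; \prod_(1 <= k < (2 * N).+1 | k != j) a k] ++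
    [seq (a i)^-1 | i <- index_iota 1 N & i != j].
pose f (t : C) : C := E (set_param a j t).
suff : f (a j) = 0 by rewrite /f set_param_id.
have [aj0 aj1 _] := sl j hj.
apply: (@ray_identity R f vs 0 d) => //.
- move=> v; rewrite mem_cat => /orP[|/mapP[i + ->]].
    rewrite !inE => /orP[]/eqP ->; first by rewrite oppr_eq0 oner_eq0.
    rewrite prodf_seq_neq0; apply/allP => i; rewrite sE => hi; apply/implyP => _.
    by have [] := sl i hi.
  rewrite mem_filter mem_index_iota => /andP[_ hi].
  by have [h _ _] := sl i (shifted_range hN hi); rewrite invr_eq0.
- move=> t ht ot; apply: dE => //; exact: Dom_set_param.
- move=> t /andP[dt t1] ot; have t0 : 0 < normc t by apply: lt_trans dt.
  apply: ih; first by apply: Dom_set_param => //; rewrite t0 t1.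
  have cE := @count_remove (fun j => (normc (a j) <= d)%R) s j us js aj.
  rewrite -ltnS (leq_trans _ ck)// cE ltnS.
  apply: sub_count => i; rewrite /set_param; case: (i == j) => /=.
    by rewrite leNgt dt.
  by rewrite andbT.
- by rewrite normc_gt0 aj0 aj1.
- by apply: dE => //; rewrite set_param_id.
Qed.

Lemma derivable_param_inv a j k (t : C) : set_param a j t k != 0 ->
  derivable (fun t : C => (set_param a j t k)^-1 : C) t 1.
Proof. by move=> h; apply: derivableV; [exact: h|exact: derivable_set_param]. Qed.

Lemma derivable_one_sub (f g : C -> C) (t : C) : derivable f t 1 -> derivable g t 1 ->
  derivable (fun t : C => 1 - f t * g t : C) t 1.
Proof.
move=> df dg; apply: derivableB; first exact: derivable_cst.
by apply: derivableM; [exact: df|exact: dg].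
Qed.

Lemma derivable_c_coef a j i (t : C) : slit_domain (set_param a j t) -> (1 <= i < N)%N ->
  derivable (fun t : C => c_coef N (set_param a j t) i : C) t 1.
Proof.
move=> dm hi; have ga := Dom_generic dm; have [sl _ _] := dm.
apply: derivableM.
  apply: derivC_prod => m _.
  by apply: derivable_one_sub; exact: derivable_set_param.
apply: derivableV; first by rewrite mulf_neq0; [|exact: one_sub_Pa|exact: D_neq0].
apply: derivableM.
  apply: derivableB; first exact: derivable_cst.
  by apply: derivC_prod => m _; exact: derivable_set_param.
apply: derivC_prod => m hm.
apply: derivable_one_sub; first exact: derivable_set_param.
rewrite mem_index_iota in hm.
by apply: derivable_param_inv; have [] := sl m (shifted_range hN hm).
Qed.

Lemma derivable_d_coef a j i (t : C) : slit_domain (set_param a j t) -> (1 <= i < N)%N ->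
  derivable (fun t : C => d_coef (set_param a j t) i : C) t 1.
Proof.
move=> dm hi; have [sl _ _] := dm.
apply: derivableM.
  by apply: derivable_one_sub; exact: derivable_set_param.
apply: derivable_one_sub; first exact: derivable_set_param.
by apply: derivable_param_inv; have [] := sl i (shifted_range hN hi).
Qed.

Lemma qshift_set_param S a j t :
  qshift q S (set_param a j t) = set_param (qshift q S a) j ((if S j then q else 1) * t).
Proof.
apply/funext => k; rewrite /qshift /set_param; have [->|_] := eqVneq k j => //.
by case: (S j); rewrite ?mul1r.
Qed.

(** At most N - 1 entries are shifted, and |a_1 ... a_2N| < 1. *)
Lemma qshift_domain S a : slit_domain a -> (forall k, S k -> S0 k) ->
  IN_domain N q (qshift q S a).
Proof.
move=> da sS; have [sl _ pr] := da; apply: domain_slit => //; first exact: slit_qshift.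
move=> n; rewrite prod_qshift.
set c := count S _; have cN : (c <= N.-1)%N.
  by rewrite -(count_shifted hN); apply: sub_count.
rewrite (_ : (N.-1 + n)%N = (c + (N.-1 - c + n))%N); last by lia.
rewrite exprD (inj_eq (mulfI _)) ?expf_neq0//.
case: (_ + n)%N => [|m]; last exact: pr.
by have := one_sub_Pa hN (Dom_generic da); rewrite subr_eq0 eq_sym expr0.
Qed.

Lemma IN_qshift_derivable S a j (t : C) : (forall k, S k -> S0 k) ->
  (1 <= j <= 2 * N)%N -> slit_domain (set_param a j t) ->
  derivable (fun t : C => I (qshift q S (set_param a j t)) : C) t 1.
Proof.
move=> sS hj dm; pose c := if S j then q else 1.
rewrite (_ : (fun t => _) = fun t : C => I (set_param (qshift q S a) j (c * t)) : C); last first.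
  by apply/funext => s; rewrite qshift_set_param.
apply: (@derivC_comp _ (fun t : C => c * t : C)
  (fun t : C => I (set_param (qshift q S a) j t) : C)).
  by apply: derivC_cM; exact: derivable_id.
apply: (IN_derivable hI oN hj); have := qshift_domain dm sS.
by rewrite qshift_set_param.
Qed.

End Domain.

(** * The columns of the system *)

Section Columns.
Variable R : realType.
Local Notation C := (R[i]^o).
Variables (N : nat) (q : R[i]) (I : (nat -> R[i]) -> R[i]).
Hypothesis hN : (2 <= N)%N.
Hypothesis q0 : q != 0.
Hypothesis q1 : normc q < 1.
Hypothesis hI : is_IN N q I.
Hypothesis qodd : odd N -> 0 < q.

Notation rho := (normc q).
Notation S0 := (shifted N).
Notation S1 := (shifted_but N).
Notation conv := (conv N q).
Notation slit_domain := (slit_domain N q).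
Implicit Types (a b : nat -> R[i]) (S : pred nat).

(** The shifts in the j-th component of the vector of integrals. *)
Definition shifted_but1 j k := S1 1 k && (k != j).

Lemma nz_qshift S a : nonzero_in_disc N a -> nonzero_in_disc N (qshift q S a).
Proof.
move=> na j hj; have [h1 h2] := na j hj; split.
  by rewrite /qshift; case: (S j) => //; rewrite mulf_neq0.
exact: le_lt_trans (normc_qshift q1 _ _ _) h2.
Qed.

Lemma conv_far a : (odd N -> slit_domain a /\ rho < nprod N a) -> conv N.-1 a.
Proof.
move=> h oN; have [[sl _ _] hr] := h oN; split => //; first exact: qodd.
by rewrite (expr_pred hN) mulrC ltr_pM2l// exprn_gt0// normc_gt0.
Qed.

Lemma qshift_ext S S' a : (forall k, S k = S' k) -> qshift q S a = qshift q S' a.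
Proof. by move=> h; apply/funext => k; rewrite /qshift h. Qed.

Lemma IN_far S a : nonzero_in_disc N a -> conv N.-1 a -> (count S (index_iota 1 (2 * N).+1) < N.-1)%N ->
  I (qshift q S a) = contour_integral N q (qshift q S a) /\
  conv 1 (qshift q S a).
Proof.
move=> na ca hc; have cS : conv 1 (qshift q S a).
  by apply: conv_qshift => //; apply: (conv_le q1 _ ca); rewrite add1n.
by split => //; apply: IN_contour => //; exact: nz_qshift.
Qed.

Lemma count_shifted_but_lt i : S0 i -> (count (S1 i) (index_iota 1 (2 * N).+1) < N.-1)%N.
Proof. by move=> hi; rewrite -(count_shifted hN) (count_shifted_but hN hi). Qed.

Lemma count_shifted_but1_lt j : S0 j -> (count (shifted_but1 j) (index_iota 1 (2 * N).+1) < N.-1)%N.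
Proof.
move=> hj; apply: leq_ltn_trans (count_shifted_but_lt hj); apply: sub_count => k.
by rewrite /shifted_but1 /shifted_but /= => /andP[/andP[-> _] ->].
Qed.

(** [contour_step1], continued in b_1, and [contour_step2] evaluate the same
    integral. *)
Lemma column_first_far a : generic N a -> (odd N -> slit_domain a /\ rho < nprod N a) ->
  I (qshift q S0 a) = \sum_(1 <= i < N) c_coef N a i * I (qshift q (S1 i) a).
Proof.
move=> ga far; have [na _] := ga; have ca := conv_far far.
have cb : conv 0 (qshift q S0 a) by exact: conv_shifted.
have dm : IN_domain N q (qshift q S0 a).
  have [oN|eN] := boolP (odd N).
    by apply: qshift_domain => //; [exact: qodd|have [] := far oN].
  by apply: domain_conv => //; [exact: nz_qshift|move=> oN; rewrite oN in eN].
have hB : odd N -> rho ^+ N.-1 * normc (qshift q S0 a 1%N) < nprod N (qshift q S0 a).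
  move=> oN; have [_ hr] := far oN; have [_ a1] := na 1%N (shifted_range hN (hN : S0 1)).
  rewrite nprod_qshift count_shifted// ltr_pM2l ?exprn_gt0 ?normc_gt0//.
  rewrite /qshift /shifted hN /= normcM; apply: lt_trans hr.
  by rewrite gtr_pMr// normc_gt0.
have e1 := IN_step1 hN q0 q1 hI (@nz_qshift S0 a na) cb dm hB.
rewrite contour_step2// lam_shifted// in e1.
apply: (mulfI (one_sub_Pa hN ga)); rewrite e1; congr (_ * _).
rewrite big_seq [RHS]big_seq; apply: eq_bigr => i; rewrite mem_index_iota => hi.
by have [-> _] := IN_far na ca (count_shifted_but_lt hi).
Qed.

Lemma wt_pred1 a k z : (1 <= k <= 2 * N)%N ->
  wt N (pred1 k) a z = (1 - a k * z) * (1 - a k * z^-1).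
Proof.
move=> hk; rewrite /wt -big_filter filter_pred1_uniq ?iota_uniq ?big_seq1//.
by rewrite mem_index_iota ltnS.
Qed.

Lemma qshift_shifted_but a j : (1 < j < N)%N ->
  qshift q (S1 j) a = qshift q (pred1 1%N) (qshift q (shifted_but1 j) a).
Proof.
move=> hj; apply/funext => k; rewrite /qshift /shifted_but1 /shifted_but /shifted /=.
have [->|k1] := eqVneq k 1%N; last by rewrite andbT.
by rewrite andbF /= hN; have -> : 1%N != j by lia.
Qed.

Lemma qshift_shifted_but_1 a j : (1 < j < N)%N ->
  qshift q (S1 1) a = qshift q (pred1 j) (qshift q (shifted_but1 j) a).
Proof.
move=> hj; apply/funext => k; rewrite /qshift /shifted_but1 /shifted_but /shifted /=.
have [->|kj] := eqVneq k j; last by rewrite andbT.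
by rewrite andbF /=; have -> : ((1 <= j < N) && (j != 1))%N by lia.
Qed.

(** The integrands satisfy the relation pointwise, by the identity between
    (1 - a_1 z) (1 - a_1 / z) and (1 - a_j z) (1 - a_j / z). *)
Lemma column_other_far a j : (1 < j < N)%N ->
  generic N a -> (odd N -> slit_domain a /\ rho < nprod N a) ->
  I (qshift q (S1 j) a) =
    a 1%N / a j * I (qshift q (S1 1) a) + d_coef a j * I (qshift q (shifted_but1 j) a).
Proof.
move=> hj ga far; have [na _] := ga; have ca := conv_far far.
have sj : S0 j by case/andP: hj => h1 h2; rewrite /shifted h2 (ltnW h1).
have [-> cj] := IN_far na ca (count_shifted_but_lt sj).
have [-> c1] := IN_far na ca (count_shifted_but_lt (hN : S0 1)).
have [-> c2] := IN_far na ca (count_shifted_but1_lt sj).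
have sm S : in_disc N (qshift q S a) by apply: small_qshift => // k /na[].
rewrite (contour_Psih hN q0 q1 (sm _) cj) (contour_Psih hN q0 q1 (sm _) c1).
rewrite (contour_Psih hN q0 q1 (sm _) c2).
have ad1 := adm_dz hN q0 q1 (sm _) c1; have ad2 := adm_dz hN q0 q1 (sm _) c2.
rewrite -(cfunZ _ ad1) -(cfun_combine _ (admZ _ ad1) ad2).
apply: cfun_on_contour => u hu.
have ho : odd N -> 0 < q /\ slit N (qshift q (shifted_but1 j) a) by move=> oN; have [] := c2 oN.
have [u0 du _ _ _] := good_contour hN q0 q1 (sm _) ho hu.
rewrite /Psimul (qshift_shifted_but a hj) (qshift_shifted_but_1 a hj).
rewrite (Psi_qshift q1 (pred1 1%N) du) (Psi_qshift q1 (pred1 j) du).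
have rj := shifted_range hN sj; have r1 := shifted_range hN (hN : S0 1).
rewrite !wt_pred1//.
have -> : qshift q (shifted_but1 j) a 1%N = a 1%N by rewrite /qshift /shifted_but1 /shifted_but andbF.
have -> : qshift q (shifted_but1 j) a j = a j by rewrite /qshift /shifted_but1 eqxx andbF.
have [aj0 _] := na j rj; have z0 : u ^+ 2 != 0 by rewrite expf_neq0.
rewrite /d_coef; move: (u ^+ 2) z0 (psi N q _ u) (dz _) => z z0 psi D.
by field; rewrite aj0 z0.
Qed.

Lemma derivC_sum_in (s : seq nat) (f : nat -> C -> C) (x : C) :
  (forall i, i \in s -> derivable (f i) x 1) ->
  derivable (fun y : C => \sum_(i <- s) f i y : C) x 1.
Proof.
elim: s => [|i s ih] h.
  rewrite (_ : (fun y => _) = fun=> 0); first exact: derivable_cst.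
  by apply/funext => y; rewrite big_nil.
rewrite (_ : (fun y => _) = fun y : C => f i y + \sum_(j <- s) f j y).
  apply: derivableD; first by apply: h; rewrite inE eqxx.
  by apply: ih => k ks; apply: h; rewrite inE ks orbT.
by apply/funext => y; rewrite big_cons.
Qed.

Lemma shifted_but_shifted i k : S1 i k -> S0 k. Proof. by case/andP. Qed.

Lemma shifted_but1_shifted i k : shifted_but1 i k -> S0 k. Proof. by case/andP => /andP[]. Qed.

Lemma column_first a : generic N a -> (odd N -> slit_domain a) ->
  I (qshift q S0 a) = \sum_(1 <= i < N) c_coef N a i * I (qshift q (S1 i) a).
Proof.
move=> ga da; have [oN|eN] := boolP (odd N); last first.
  by apply: column_first_far => // oN; rewrite oN in eN.
have qp := qodd oN; have dI := @IN_qshift_derivable R N q I hN q0 q1 hI oN qp.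
apply/eqP; rewrite -subr_eq0; apply/eqP.
apply: (continuation (E := fun a => I (qshift q S0 a) -
   \sum_(1 <= i < N) c_coef N a i * I (qshift q (S1 i) a)) hN q0 q1 qp _ _ (da oN)).
- move=> b j t hj dm; apply: derivableB; first exact: (dI _ _ _ _ (fun _ h => h) hj dm).
  apply: derivC_sum_in => i; rewrite mem_index_iota => hi.
  apply: derivableM; first exact: (derivable_c_coef hN dm hi).
  exact: (dI _ _ _ _ (@shifted_but_shifted i) hj dm).
- move=> b db hb; rewrite (column_first_far (Dom_generic db)) ?subrr//.
Qed.

Lemma column_other a j : (1 < j < N)%N -> generic N a -> (odd N -> slit_domain a) ->
  I (qshift q (S1 j) a) =
    a 1%N / a j * I (qshift q (S1 1) a) + d_coef a j * I (qshift q (shifted_but1 j) a).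
Proof.
move=> hj ga da; have [oN|eN] := boolP (odd N); last first.
  by apply: column_other_far => // oN; rewrite oN in eN.
have qp := qodd oN; have dI := @IN_qshift_derivable R N q I hN q0 q1 hI oN qp.
have hj' : (1 <= j < N)%N by case/andP: hj => h1 ->; rewrite ltnW.
apply/eqP; rewrite -subr_eq0; apply/eqP.
apply: (continuation (E := fun a => I (qshift q (S1 j) a) -
   (a 1%N / a j * I (qshift q (S1 1) a) + d_coef a j * I (qshift q (shifted_but1 j) a)))
   hN q0 q1 qp _ _ (da oN)).
- move=> b k t hk dm; have [sl _ _] := dm.
  apply: derivableB; first exact: (dI _ _ _ _ (@shifted_but_shifted j) hk dm).
  apply: derivableD; apply: derivableM.
  + apply: derivableM; first exact: derivable_set_param.
    by apply: derivable_param_inv; have [] := sl j (shifted_range hN hj').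
  + exact: (dI _ _ _ _ (@shifted_but_shifted 1%N) hk dm).
  + exact: (derivable_d_coef hN dm hj').
  + exact: (dI _ _ _ _ (@shifted_but1_shifted j) hk dm).
- by move=> b db hb; rewrite (column_other_far hj (Dom_generic db)) ?subrr.
Qed.

(** The upper factor of A produces T_(a_1) I_i for i >= 2 and c_1 I_1 in the first
    place; the lower factor then adds the c_i T_(a_1) I_i to the latter. *)
Lemma q_difference_system a : generic N a -> (odd N -> slit_domain a) ->
  Tq q 1 (vecI N q I) a = vecI N q I a *m A_mx N a.
Proof.
move=> ga da.
have vE b (i : 'I_N.-1) : vecI N q I b 0 i =
    I (qshift q (fun k => (2 <= k < N)%N && (k != i.+1)) b) by rewrite mxE.
have v0 (i : 'I_N.-1) : i = 0%N :> nat -> vecI N q I a 0 i = I (qshift q (S1 1) a).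
  move=> i0; rewrite vE; congr (I _); apply: qshift_ext => k; rewrite i0 /shifted_but /shifted.
  by lia.
have v1 (i : 'I_N.-1) : i != 0%N :> nat -> vecI N q I a 0 i = I (qshift q (shifted_but1 i.+1) a).
  move=> i0; rewrite vE; congr (I _); apply: qshift_ext => k; rewrite /shifted_but1 /shifted_but /shifted.
  by lia.
have t0 (i : 'I_N.-1) : i = 0%N :> nat -> Tq q 1 (vecI N q I) a 0 i = I (qshift q S0 a).
  move=> i0; rewrite /Tq vE; congr (I _); apply/funext => k; rewrite /qshift i0 /shifted /=.
  have [->|k1] := eqVneq k 1%N; first by rewrite hN.
  rewrite andbT (_ : (1 <= k < N)%N = (1 < k < N)%N)//.
  by lia.
have t1 (i : 'I_N.-1) : i != 0%N :> nat ->
    Tq q 1 (vecI N q I) a 0 i = I (qshift q (S1 i.+1) a).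
  move=> i0; rewrite /Tq vE; congr (I _); apply/funext => k; rewrite /qshift /shifted_but /shifted /=.
  have [->|k1] := eqVneq k 1%N.
    by rewrite hN /= eqSS eq_sym i0.
  rewrite (_ : (1 <= k < N)%N = (1 < k < N)%N)//.
  by lia.
have n0 : (0 < N.-1)%N by lia.
pose o := Ordinal n0.
pose w := vecI N q I a *m A_upper N a.
have w0 : w 0 o = c_coef N a 1 * I (qshift q (S1 1) a).
  rewrite mxE (bigD1 o)//= big1 ?addr0 => [|k ko]; first by rewrite v0// mxE /= mulrC.
  rewrite [A_upper _ _ _ _]mxE.
  have k0 : (k == 0%N :> nat) = false by apply: negbTE; apply: contra ko => /eqP h; apply/eqP/val_inj.
  by rewrite k0 (negPf ko) mulr0.
have w1 (l : 'I_N.-1) : l != 0%N :> nat -> w 0 l = I (qshift q (S1 l.+1) a).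
  move=> l0; have lo : l != o by apply: contra l0 => /eqP ->.
  have hl : (1 < l.+1 < N)%N by have := ltn_ord l; lia.
  rewrite mxE (bigD1 o)//= (bigD1 l)//= big1 ?addr0 => [|k /andP[ko kl]].
    rewrite v0// v1// !mxE /= (negPf l0) eqxx (column_other hl ga da).
    by rewrite mulrC [d_coef _ _ * _]mulrC.
  rewrite [A_upper _ _ _ _]mxE.
  have k0 : (k == 0%N :> nat) = false by apply: negbTE; apply: contra ko => /eqP h; apply/eqP/val_inj.
  by rewrite k0 (negPf kl) mulr0.
apply/rowP => i; rewrite /A_mx mulmxA -/w [RHS]mxE.
have [i0|i0] := eqVneq (i : nat) 0%N; last first.
  rewrite t1// (bigD1 i)//= big1 ?addr0 => [|k ki]; rewrite [A_lower _ _ _ _]mxE.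
    by rewrite eqxx mulr1 w1.
  by rewrite (negPf ki) (negPf i0) mulr0.
have -> : i = o by apply/val_inj.
rewrite t0// column_first// big_add1 big_mkord; apply: eq_bigr => l _.
rewrite [A_lower _ _ _ _]mxE /=; have [->|lo] := eqVneq l o.
  by rewrite mulr1 w0.
have l0 : (l != 0%N :> nat) by apply: contra lo => /eqP h; apply/eqP/val_inj.
by rewrite w1// mulrC.
Qed.

End Columns.

Theorem corollary3p1 (R : realType) (N : nat) (q : R[i])
    (I : (nat -> R[i]) -> R[i]) (a : nat -> R[i])
    (hN : (2 <= N)%N)
    (hq : q != 0 /\ `|q| < 1)
    (hq_odd : odd N -> 0 < q)
    (hI : is_IN N q I)
    (ha : forall j, (1 <= j <= 2 * N)%N -> a j != 0 /\ `|a j| < 1)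
    (* the entries of A are defined *)
    (ha_neq : forall i j, (1 <= i < N)%N -> (1 <= j < N)%N -> i != j ->
       a i != a j)
    (* for N odd, all the arguments of I_N that occur lie in its domain *)
    (ha_odd : odd N ->
       (forall j, (1 <= j <= 2 * N)%N -> ~~ (a j <= 0)) /\
       (forall n : nat, \prod_(1 <= j < (2 * N).+1) a j != q ^+ n.+1)) :
  Tq q 1 (vecI N q I) a = vecI N q I a *m A_mx N a.
Proof.
have [q0 q1] := hq; rewrite normr_lt1 in q1.
have ha' j : (1 <= j <= 2 * N)%N -> a j != 0 /\ normc (a j) < 1.
  by move=> /ha[h1 h2]; rewrite -normr_lt1.
apply: q_difference_system => //.
by move=> oN; have [h1 h2] := ha_odd oN; split => // j hj; have [] := ha' j hj; split => //; exact: h1.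
Qed.
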